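(* Assume that $r\geq 3$, $m\geq2$ and $1\leq t\leq m$. Let $M^m_{t'}$ be a pseudo-Riemannian hypersurface with diagonalizable shape operator in a pseudo-Riemannian space form $N^{m+1}_t(c_0)$, where $c_0=0$ or $c_0=1$. Assume that there exist at most two distinct principal curvatures and that they are constant on $M^m_{t'}$. If $M^m_{t'}$ is proper $r$-harmonic, then the ambient space is $\mathbb{S}^{m+1}_t$ (i.e. $c_0=1$) and $M^m_{t'}$ is, up to local congruence, one of the following hypersurfaces of $\mathbb{S}^{m+1}_t\subset\mathbb{R}^{m+2}_t$: (a) the small pseudo-hypersphere $\mathbb{S}^m_t(r)=\{x\in\mathbb{S}^{m+1}_t:x_{m+2}=\sqrt{1-(1/r)}\}$; (b) a generalised pseudo-Clifford torus $$\mathbb{S}^k_\ell(c)\times\mathbb{S}^{m-k}_{t-\ell}\left(\tfrac{c}{c-1}\right)=\Big\{x\in\mathbb{S}^{m+1}_t:\ -\sum_{i=1}^{\ell}x_i^2+\sum_{i=t+1}^{t+k-\ell+1}x_i^2=\tfrac1c,\ \ -\sum_{i=\ell+1}^{t}x_i^2+\sum_{i=t+k-\ell+2}^{m+2}x_i^2=\tfrac{c-1}{c}\Big\}$$ with $1\le k\le m-1$, $0\le\ell\le k$, $0\le\ell\le t$, $t-\ell\le m-k$, $c>1$, $c\ne\frac mk$ and $$k\,c^3-k(r+2)\,c^2+[m(r-1)+k(r+2)]\,c-m\,r=0 .$$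
   Context: Space forms. $\mathbb{R}^n_t$ is $\mathbb{R}^n$ with $\langle x,y\rangle=-\sum_{i=1}^t x_iy_i+\sum_{i=t+1}^n x_iy_i$. $\mathbb{S}^n_t(c)=\{x\in\mathbb{R}^{n+1}_t:\langle x,x\rangle=1/c\}$ for $c>0$, with the induced metric (index $t$, constant sectional curvature $c$), and $\mathbb{S}^n_t=\mathbb{S}^n_t(1)$. $N^{n}_t(0)=\mathbb{R}^n_t$ and $N^n_t(1)=\mathbb{S}^n_t$. All manifolds are connected (a connected component is chosen if necessary). The curvature convention on a space form of curvature $c$ is $R(X,Y)Z=c(\langle Y,Z\rangle X-\langle X,Z\rangle Y)$. ''Up to local congruence'' means that, locally, some isometry of the ambient space maps the hypersurface onto an open part of the model. Hypersurfaces. A pseudo-Riemannian hypersurface $\varphi:M^m_{t'}\to N^{m+1}_t$ is an immersed hypersurface with nondegenerate induced metric, of index $t'$. With unit normal $\eta$, $\varepsilon=\langle\eta,\eta\rangle=\pm1$ and shape operator $A(X)=-\nabla^N_X\eta$, the mean curvature function is $f=\frac1m\varepsilon\operatorname{Tr}A$; $M$ is minimal if $f\equiv0$. Principal curvatures are the eigenvalues of $A$; ''diagonalizable'' means diagonalizable over $\mathbb{R}$. $r$-harmonicity. Let $\{e_i\}$ be a local orthonormal frame of $M$ with $\langle e_i,e_j\rangle=\varepsilon_i\delta_{ij}$. For a smooth map $\varphi:M\to N$ of pseudo-Riemannian manifolds, $\tau(\varphi)=\sum_i\varepsilon_i[\nabla^\varphi_{e_i}d\varphi(e_i)-d\varphi(\nabla^M_{e_i}e_i)]$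 and $\overline\Delta=-\sum_i\varepsilon_i(\nabla^\varphi_{e_i}\nabla^\varphi_{e_i}-\nabla^\varphi_{\nabla^M_{e_i}e_i})$ on sections of $\varphi^{-1}TN$, where $\nabla^\varphi$ is the induced connection. With $\tau=\tau(\varphi)$ and summation over $i$ understood, for $s\geq1$, $$\tau_{2s}(\varphi)=\overline\Delta^{2s-1}\tau-\varepsilon_iR^N(\overline\Delta^{2s-2}\tau,d\varphi(e_i))d\varphi(e_i)-\sum_{\ell=1}^{s-1}\{\varepsilon_iR^N(\nabla^\varphi_{e_i}\overline\Delta^{s+\ell-2}\tau,\overline\Delta^{s-\ell-1}\tau)d\varphi(e_i)-\varepsilon_iR^N(\overline\Delta^{s+\ell-2}\tau,\nabla^\varphi_{e_i}\overline\Delta^{s-\ell-1}\tau)d\varphi(e_i)\},$$ $$\tau_{2s+1}(\varphi)=\overline\Delta^{2s}\tau-\varepsilon_iR^N(\overline\Delta^{2s-1}\tau,d\varphi(e_i))d\varphi(e_i)-\sum_{\ell=1}^{s-1}\{\varepsilon_iR^N(\nabla^\varphi_{e_i}\overline\Delta^{s+\ell-1}\tau,\overline\Delta^{s-\ell-1}\tau)d\varphi(e_i)-\varepsilon_iR^N(\overline\Delta^{s+\ell-1}\tau,\nabla^\varphi_{e_i}\overline\Delta^{s-\ell-1}\tau)d\varphi(e_i)\}-\varepsilon_iR^N(\nabla^\varphi_{e_i}\overline\Delta^{s-1}\tau,\overline\Delta^{s-1}\tau)d\varphi(e_i).$$ $\varphi$ is $r$-harmonic if $\tau_r(\varphi)=0$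 ($r\ge2$). A hypersurface is $r$-harmonic if its isometric immersion is, and proper $r$-harmonic if in addition it is not minimal. *)

(* Defs.v *)
From mathcomp Require Import all_boot all_order all_algebra.
From mathcomp Require Import all_classical all_reals all_analysis.

Set Implicit Arguments.
Unset Strict Implicit.
Unset Printing Implicit Defensive.

Import Order.TTheory GRing.Theory Num.Theory.
Import numFieldNormedType.Exports.

Local Open Scope classical_set_scope.
Local Open Scope ring_scope.

Section Smooth.
Context {R : realType}.

Fixpoint Ck_on {V W : normedModType R} (k : nat) (O : set V) (f : V -> W) :
    Prop :=
  match k with
  | 0 => forall u, O u -> {for u, continuous f}
  | k'.+1 => (forall u, O u -> differentiable f u) /\
             forall v, Ck_on k' O (fun u => 'D_v f u)
  end.

(* Meant for open O; values of f outside O are then irrelevant. *)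
Definition smooth_on {V W : normedModType R} (O : set V) (f : V -> W) : Prop :=
  forall k, Ck_on k O f.

Record chart (M : topologicalType) (m : nat) := Chart {
  chart_dom : set M;
  chart_map : M -> 'rV[R]_m;
  chart_inv : 'rV[R]_m -> M }.

Definition chart_img (M : topologicalType) m (x : chart M m) : set 'rV[R]_m :=
  chart_map x @` chart_dom x.

Record is_chart (M : topologicalType) m (x : chart M m) : Prop := IsChart {
  chart_dom_open : open (chart_dom x);
  chart_img_open : open (chart_img x);
  chart_mapK : {in chart_dom x, cancel (chart_map x) (chart_inv x)};
  chart_map_continuous : forall p, chart_dom x p ->
    {for p, continuous (chart_map x)};
  chart_inv_continuous : forall u, chart_img x u ->
    {for u, continuous (chart_inv x)} }.

Record smooth_manifold (M : topologicalType) m (atlas : set (chart M m)) :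
    Prop := SmoothManifold {
  manifold_hausdorff : hausdorff_space M;
  manifold_second_countable : @second_countable M;
  atlas_chart : forall x, atlas x -> is_chart x;
  atlas_cover : forall p, exists2 x, atlas x & chart_dom x p;
  atlas_compatible : forall x y, atlas x -> atlas y ->
    smooth_on (chart_map x @` (chart_dom x `&` chart_dom y))
              (chart_map y \o chart_inv x) }.

End Smooth.

Arguments chart R M m : clear implicits.

Section SpaceForms.
Context {R : realType}.

(* The scalar product of R^d_t; coordinates are numbered from 0, so the
   time-like ones are those of index i < t. *)
Definition inner {d : nat} (t : nat) (x y : 'rV[R]_d) : R :=
  - (\sum_(i < d | (i < t)%N) x 0 i * y 0 i)
  + \sum_(i < d | (t <= i)%N) x 0 i * y 0 i.

(* N^n_t(c0) for c0 = 0 (false) or c0 = 1 (true), as a subset of R^(c0 + n)_t: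
   all of R^n_t in the first case, the unit quadric of R^(n+1)_t in the
   second. *)
Definition space_form (c0 : bool) (n t : nat) : set 'rV[R]_(c0 + n) :=
  [set x | c0 -> inner t x x = 1].

Arguments space_form c0 n t : clear implicits.

Definition tangent (c0 : bool) (n t : nat) (p : 'rV[R]_(c0 + n)) :
    set 'rV[R]_(c0 + n) :=
  [set v | c0 -> inner t p v = 0].

Definition curvature (c0 : bool) (n t : nat) (x y z : 'rV[R]_(c0 + n)) :
    'rV[R]_(c0 + n) :=
  c0%:R *: (inner t y z *: x - inner t x z *: y).

(* Smoothness on N is smoothness of F near N in the ambient vector space; the
   inverse of F on N is smooth because F is bijective with invertible
   differentials. *)
Definition space_form_isometry (c0 : bool) (n t : nat)
    (F : 'rV[R]_(c0 + n) -> 'rV[R]_(c0 + n)) : Prop :=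
  [/\ set_bij (space_form c0 n t) (space_form c0 n t) F,
      exists W, [/\ open W, space_form c0 n t `<=` W & smooth_on W F]
    & forall p, space_form c0 n t p ->
      forall v w, tangent t p v -> tangent t p w ->
      inner t ('D_v F p) ('D_w F p) = inner t v w].

End SpaceForms.

Arguments space_form {R} c0 n t.

(* Local geometry of a hypersurface Phi : O -> N^(m+1)_t(c0), O open in R^m.
   Vector fields on O are maps R^m -> R^m and sections of Phi^-1 TN are maps
   from R^m to the ambient vector space; only their values on O matter. *)
Section LocalGeometry.
Context {R : realType} (c0 : bool) (t m : nat).
Context (Phi : 'rV[R]_m -> 'rV[R]_(c0 + m.+1)).

Local Notation vfield := ('rV[R]_m -> 'rV[R]_m).
Local Notation alongmap := ('rV[R]_m -> 'rV[R]_(c0 + m.+1)).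

Definition push (X : vfield) : alongmap := fun u => 'D_(X u) Phi u.

(* The Levi-Civita connection of N is the tangential part of the flat
   connection; for c0 = 1 the position vector is the unit normal of N. *)
Definition cov (X : vfield) (V : alongmap) : alongmap := fun u =>
  'D_(X u) V u - (c0%:R * inner t ('D_(X u) V u) (Phi u)) *: Phi u.

Definition metric (u : 'rV[R]_m) : 'M[R]_m :=
  \matrix_(i, j) inner t ('D_('e_i) Phi u) ('D_('e_j) Phi u).

Definition christoffel (u : 'rV[R]_m) (k i j : 'I_m) : R :=
  2^-1 * \sum_l invmx (metric u) k l *
    (('D_('e_i) metric u) j l + ('D_('e_j) metric u) i l
     - ('D_('e_l) metric u) i j).

Definition levi_civita (X Y : vfield) : vfield := fun u =>
  'D_(X u) Y u +
  \row_k \sum_i \sum_j christoffel u k i j * X u 0 i * Y u 0 j.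

Definition unit_normal (O : set 'rV[R]_m) (eps : R) (eta : alongmap) : Prop :=
  [/\ eps = 1 \/ eps = -1, smooth_on O eta
    & forall u, O u -> [/\ tangent t (Phi u) (eta u),
        forall v, inner t ('D_v Phi u) (eta u) = 0
      & inner t (eta u) (eta u) = eps]].

(* The matrix of A in the coordinate basis: row i holds the coordinates of
   A(e_i) = - cov e_i eta in the basis of the D_(e_j) Phi (rows of the jacobian),
   so that A acts on row vectors on the right. *)
Definition shape_operator (eta : alongmap) (u : 'rV[R]_m) : 'M[R]_m :=
  - (\matrix_(i < m) cov (fun=> 'e_i) eta u) *m pinvmx (jacobian Phi u).

Definition mean_curvature (eps : R) (eta : alongmap) (u : 'rV[R]_m) : R :=
  m%:R^-1 * eps * \tr (shape_operator eta u).

Definition orthonormal_frame (O : set 'rV[R]_m) (eps : 'I_m -> R)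
    (e : 'I_m -> vfield) : Prop :=
  [/\ forall i, eps i = 1 \/ eps i = -1, forall i, smooth_on O (e i)
    & forall u, O u -> forall i j,
      inner t (push (e i) u) (push (e j) u) = eps i *+ (i == j)].

Section Frame.
Context (eps : 'I_m -> R) (e : 'I_m -> vfield).

Definition tension : alongmap := fun u =>
  \sum_i eps i *:
    (cov (e i) (push (e i)) u - push (levi_civita (e i) (e i)) u).

Definition rough_laplacian (V : alongmap) : alongmap := fun u =>
  - \sum_i eps i *:
      (cov (e i) (cov (e i) V) u - cov (levi_civita (e i) (e i)) V u).

Local Notation tau := tension.
Local Notation Lap k := (iter k rough_laplacian).
Local Notation RN := (curvature t).

Definition polytension_even (s : nat) : alongmap := fun u =>
  Lap (2 * s - 1) tau u
  - \sum_i eps i *: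
      RN (Lap (2 * s - 2) tau u) (push (e i) u) (push (e i) u)
  - \sum_(1 <= l < s)
      (\sum_i eps i *: RN (cov (e i) (Lap (s + l - 2) tau) u)
                          (Lap (s - l - 1) tau u) (push (e i) u)
       - \sum_i eps i *: RN (Lap (s + l - 2) tau u)
                            (cov (e i) (Lap (s - l - 1) tau) u)
                            (push (e i) u)).

Definition polytension_odd (s : nat) : alongmap := fun u =>
  Lap (2 * s) tau u
  - \sum_i eps i *:
      RN (Lap (2 * s - 1) tau u) (push (e i) u) (push (e i) u)
  - \sum_(1 <= l < s)
      (\sum_i eps i *: RN (cov (e i) (Lap (s + l - 1) tau) u)
                          (Lap (s - l - 1) tau u) (push (e i) u)
       - \sum_i eps i *: RN (Lap (s + l - 1) tau u)
                            (cov (e i) (Lap (s - l - 1) tau) u)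
                            (push (e i) u))
  - \sum_i eps i *: RN (cov (e i) (Lap (s - 1) tau) u)
                       (Lap (s - 1) tau u) (push (e i) u).

(* tau_r for r >= 2. *)
Definition polytension (r : nat) : alongmap :=
  if odd r then polytension_odd r./2 else polytension_even r./2.

End Frame.
End LocalGeometry.

Definition has_index {R : realType} {m : nat} (g : 'M[R]_m) (s : nat) : Prop :=
  let negative_definite k (W : 'M[R]_(k, m)) :=
    row_free W /\
    forall v : 'rV[R]_k, v != 0 -> (v *m W *m g *m (v *m W)^T) 0 0 < 0 in
  (exists W : 'M[R]_(s, m), negative_definite s W) /\
  forall k (W : 'M[R]_(k, m)), negative_definite k W -> (k <= s)%N.

(* Principal curvatures, mean curvature, etc. depend on a unit normal and on an
   orthonormal frame, which in general exist only locally and, for the normal,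
   up to sign. *)
Section Hypersurface.
Context {R : realType} (c0 : bool) (t m : nat) (M : topologicalType).
Context (atlas : set (chart R M m)) (phi : M -> 'rV[R]_(c0 + m.+1)).

Definition pseudo_hypersurface (t' : nat) : Prop :=
  (forall p, space_form c0 m.+1 t (phi p)) /\
  forall x, atlas x ->
    smooth_on (chart_img x) (phi \o chart_inv x) /\
    forall u, chart_img x u ->
      [/\ row_free (jacobian (phi \o chart_inv x) u),
          metric t (phi \o chart_inv x) u \in unitmx
        & has_index (metric t (phi \o chart_inv x) u) t'].

Definition diagonalizable_shape_operator : Prop :=
  forall x, atlas x -> forall O eps eta, open O -> O `<=` chart_img x ->
  unit_normal t (phi \o chart_inv x) O eps eta ->
  forall u, O u -> diagonalizable (shape_operator t (phi \o chart_inv x) eta u).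

(* The constants are the same on all of M, for suitable choices of the sign of
   the local unit normals. *)
Definition at_most_two_constant_principal_curvatures : Prop :=
  exists lambda mu : R,
  forall x, atlas x -> forall u, chart_img x u ->
  exists O eps eta, [/\ open O, O u, O `<=` chart_img x,
    unit_normal t (phi \o chart_inv x) O eps eta
  & forall v, O v -> forall a,
    eigenvalue (shape_operator t (phi \o chart_inv x) eta v) a ->
    a = lambda \/ a = mu].

Definition minimal : Prop :=
  forall x, atlas x -> forall O eps eta, open O -> O `<=` chart_img x ->
  unit_normal t (phi \o chart_inv x) O eps eta ->
  forall u, O u -> mean_curvature t (phi \o chart_inv x) eps eta u = 0.

Definition polyharmonic (r : nat) : Prop :=
  forall x, atlas x -> forall u, chart_img x u ->
  exists O eps e, [/\ open O, O u, O `<=` chart_img x,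
    orthonormal_frame t (phi \o chart_inv x) O eps e
  & forall v, O v -> polytension t (phi \o chart_inv x) eps e r v = 0].

Definition proper_polyharmonic (r : nat) : Prop :=
  polyharmonic r /\ ~ minimal.

(* "Open part" of S means relatively open subset of S. *)
Definition locally_congruent (S : set 'rV[R]_(c0 + m.+1)) : Prop :=
  forall p : M, exists U F, [/\ open U, U p, space_form_isometry t F
    & exists2 O, open O & F @` (phi @` U) = O `&` S].

End Hypersurface.

(* Here d = n + 1 is the dimension of the vector space containing S^n_t. *)
Section Models.
Context {R : realType}.

Definition small_pseudo_hypersphere (d t r : nat) : set 'rV[R]_d :=
  [set x | inner t x x = 1 /\
    forall i : 'I_d, i = d.-1 :> nat -> x 0 i = Num.sqrt (1 - r%:R^-1)].

Definition pseudo_clifford_torus (d t k l : nat) (c : R) : set 'rV[R]_d :=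
  [set x | [/\ inner t x x = 1,
    - (\sum_(i < d | (i < l)%N) x 0 i ^+ 2)
    + \sum_(i < d | (t <= i < t + k - l + 1)%N) x 0 i ^+ 2 = c^-1
  & - (\sum_(i < d | (l <= i < t)%N) x 0 i ^+ 2)
    + \sum_(i < d | (t + k - l + 1 <= i)%N) x 0 i ^+ 2 = (c - 1) / c]].

End Models.

Arguments small_pseudo_hypersphere {R} d t r.
Arguments pseudo_clifford_torus {R} d t k l c.

(* Main.v *)
(* Let T = tr A and a = tr A^2, which are locally constant. In a moving orthonormal
   frame the tension field is eps T eta, and by the Codazzi equation the rough
   Laplacian multiplies a constant multiple of eta by eps a. Hence r-harmonicity
   reads T (eps a)^(r-3) ((eps a)^2 - c0 m eps a - c0 (r-2) eps T^2) = 0, and T <> 0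
   forces c0 = 1 and eps = 1.

   If two principal curvatures la <> mu occur, then 1 + la mu = 0 by the Gauss
   equation; in the umbilic case put mu := - 1 / la. The focal maps P = eta + la Phi
   and Q = eta + mu Phi then take their values in two fixed orthogonal complementary
   subspaces of the ambient vector space, because the projection S onto the span of
   P and dP has zero derivative. So Phi = (P - Q) / (la - mu) lies in a product of
   two quadrics, and a linear isometry adapted to the two subspaces carries this
   product to the model. If both curvatures occur, then S is the same on all of M
   by connectedness, hence so are the integers k and l. *)

Require Import Defs.
From mathcomp Require Import all_boot all_order all_algebra.
From mathcomp Require Import all_classical all_reals all_analysis.
From mathcomp Require Import perm ring lra zify.

Set Implicit Arguments.
Unset Strict Implicit.
Unset Printing Implicit Defensive.

Import Order.TTheory GRing.Theory Num.Theory.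
Import numFieldNormedType.Exports.

Local Open Scope classical_set_scope.
Local Open Scope ring_scope.

(** * Calculus *)

(** The principal curvatures are fixed only up to the sign of the local normals, and their
    multiplicities could a priori jump. On a ball this is settled by the continuity of [\tr A],
    which takes finitely many values. Globally, whether [\tr A] vanishes depends neither on the
    chart nor on the normal; so, [M] being connected and the immersion not minimal, [T] vanishes
    nowhere. That the multiplicity is the same everywhere, and that umbilic and mixed balls do not
    coexist, is algebra: with [x = la ^+ 2] the r-harmonic equation is affine in the multiplicity
    and excludes a second solution. The focal maps do depend on the normal; a change of its sign is
    excluded by [la + mu != 0], because [x = 1] would give [T = 0].

    Both [c0 = 1] and [eps = 1] rest on [a > 0], which holds because the eigenvalues are real. The
    constant of the torus is [c = 1 + la ^+ 2], the square norm of [P]. The small pseudo-hypersphere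
    is treated as one half of the torus with [k = m], [l = t], [c = r], the half being selected by
    the sign of the last coordinate. *)

Section MatrixCalculus.
Context {R : realType} {V : normedModType R}.

Lemma derive_coord m n (f : V -> 'M[R]_(m, n)) (x v : V) i j :
  differentiable f x -> ('D_v f x) i j = 'D_v (fun y => f y i j) x.
Proof. by move=> df; rewrite derive_mx ?mxE//; exact: diff_derivable. Qed.

Lemma differentiable_entry m n (f : V -> 'M[R]_(m, n)) (x : V) i j :
  differentiable f x -> differentiable (fun y => f y i j) x.
Proof.
move=> df; apply: (@differentiable_comp _ _ _ _ f (fun M : 'M[R]_(m, n) => M i j)) => //.
exact: differentiable_coord.
Qed.

Lemma differentiable_mx m n (f : V -> 'M[R]_(m, n)) (x : V) :
  (forall i j, differentiable (fun y => f y i j) x) -> differentiable f x.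
Proof.
move=> df.
have -> : f = \sum_i \sum_j (fun y => f y i j *: delta_mx i j).
  apply/funext => y; rewrite {1}(matrix_sum_delta (f y)) fct_sumE.
  by apply: eq_bigr => i _; rewrite fct_sumE.
apply: differentiable_sum => i; apply: differentiable_sum => j.
exact: differentiableZl.
Qed.

Lemma differentiable_mulmx m n p (f : V -> 'M[R]_(m, n)) (g : V -> 'M[R]_(n, p))
    (x : V) :
  differentiable f x -> differentiable g x ->
  differentiable (fun y => f y *m g y) x.
Proof.
move=> df dg; apply: differentiable_mx => i j.
have -> : (fun y => (f y *m g y) i j) =
    \sum_k ((fun y => f y i k) * (fun y => g y k j)).
  by apply/funext => y; rewrite mxE fct_sumE.
apply: differentiable_sum => k.
by apply: differentiableM; exact: differentiable_entry.
Qed.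

Lemma derive_mulmx m n p (f : V -> 'M[R]_(m, n)) (g : V -> 'M[R]_(n, p))
    (x v : V) :
  differentiable f x -> differentiable g x ->
  'D_v (fun y => f y *m g y) x = 'D_v f x *m g x + f x *m 'D_v g x.
Proof.
move=> df dg; apply/matrixP => i j.
rewrite derive_coord; last exact: differentiable_mulmx.
have -> : (fun y => (f y *m g y) i j) =
    \sum_k ((fun y => f y i k) * (fun y => g y k j)).
  by apply/funext => y; rewrite mxE fct_sumE.
rewrite derive_sum; last first.
  by move=> k; apply/derivableM; apply/diff_derivable/differentiable_entry.
rewrite !mxE -big_split; apply: eq_bigr => k _ /=.
rewrite deriveM; [|exact/diff_derivable/differentiable_entry..].
rewrite !derive_coord// addrC; congr (_ + _).
by rewrite /GRing.scale /= mulrC.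
Qed.

Lemma differentiable_trmx m n (f : V -> 'M[R]_(m, n)) (x : V) :
  differentiable f x -> differentiable (fun y => (f y)^T) x.
Proof.
move=> df; apply: differentiable_mx => i j.
rewrite (_ : (fun _ => _) = fun y => f y j i); last by apply/funext=> y; rewrite mxE.
exact: differentiable_entry.
Qed.

Lemma derive_trmx m n (f : V -> 'M[R]_(m, n)) (x v : V) :
  differentiable f x -> 'D_v (fun y => (f y)^T) x = ('D_v f x)^T.
Proof.
move=> df; apply/matrixP => i j.
rewrite derive_coord; last exact: differentiable_trmx.
rewrite mxE derive_coord//; congr ('D_v _ x).
by apply/funext => y; rewrite mxE.
Qed.

Lemma differentiable_scale m n (a : V -> R) (f : V -> 'M[R]_(m, n)) (x : V) :
  differentiable a x -> differentiable f x ->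
  differentiable (fun y => a y *: f y) x.
Proof.
move=> da df; apply: differentiable_mx => i j.
rewrite (_ : (fun _ => _) = a * (fun y => f y i j)).
  by apply: differentiableM => //; exact: differentiable_entry.
by apply/funext=> y; rewrite mxE.
Qed.

Lemma derive_scale m n (a : V -> R) (f : V -> 'M[R]_(m, n)) (x v : V) :
  differentiable a x -> differentiable f x ->
  'D_v (fun y => a y *: f y) x = 'D_v a x *: f x + a x *: 'D_v f x.
Proof.
move=> da df; apply/matrixP => i j.
rewrite derive_coord; last exact: differentiable_scale.
rewrite (_ : (fun _ => _) = a * (fun y => f y i j)); last first.
  by apply/funext=> y; rewrite mxE.
rewrite deriveM; [|exact/diff_derivable|exact/diff_derivable/differentiable_entry].
by rewrite !mxE derive_coord// addrC; congr (_ + _); rewrite /GRing.scale /= mulrC.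
Qed.

Lemma derive_sumE (W : normedModType R) n (h : 'I_n -> V -> W) (x v : V) :
  (forall i, differentiable (h i) x) ->
  'D_v (fun y => \sum_i h i y) x = \sum_i 'D_v (h i) x.
Proof.
move=> dh; rewrite -derive_sum; last by move=> i; exact/diff_derivable.
by congr ('D_v _ x); apply/funext => y; rewrite fct_sumE.
Qed.

Lemma differentiable_sumE (W : normedModType R) n (h : 'I_n -> V -> W) (x : V) :
  (forall i, differentiable (h i) x) ->
  differentiable (fun y => \sum_i h i y) x.
Proof.
move=> dh; rewrite (_ : (fun _ => _) = \sum_i h i).
  exact: differentiable_sum.
by apply/funext => y; rewrite fct_sumE.
Qed.

End MatrixCalculus.

(** * Mean values along lines and the symmetry of second derivatives *)

Section Lines.
Context {R : realType} {V : normedModType R}.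

Lemma is_derive_line (W : normedModType R) (f : V -> W) (y v : V) (t : R) :
  differentiable f (y + t *: v) ->
  is_derive t 1 (fun a : R => f (y + a *: v)) ('D_v f (y + t *: v)).
Proof.
move=> df; have /(_ v) := diff_derivable df; rewrite /derivable => dfv.
have eqg : (fun h : R => h^-1 *: (f (y + (h%:A + t) *: v) - f (y + t *: v))) =
           (fun h : R => h^-1 *: (f (h *: v + (y + t *: v)) - f (y + t *: v))).
  apply/funext => h; congr (_ *: (f _ - _)).
  by rewrite [h%:A]mulr1 scalerDl addrCA.
by split; rewrite /derivable /derive /= eqg.
Qed.

Lemma constant_on_ball (f : V -> R) (x : V) (r : R) :
  (forall y, ball x r y -> differentiable f y) ->
  (forall y, ball x r y -> forall v, 'D_v f y = 0) ->
  forall y, ball x r y -> f y = f x.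
Proof.
move=> df f0 y xy.
have r0 : 0 < r by rewrite -ball_normE /= in xy; rewrite (le_lt_trans _ xy).
have seg (t : R) : 0 <= t <= 1 -> ball x r (x + t *: (y - x)).
  move=> /andP[t0 t1]; move: xy; rewrite -!ball_normE /= => xy.
  rewrite opprD addNKr normrN normrZ ger0_norm// distrC.
  by rewrite (le_lt_trans _ xy)// ler_piMl.
pose g (t : R) := f (x + t *: (y - x)).
have dg (t : R) : 0 <= t <= 1 -> is_derive t 1 g 0.
  move=> t01; rewrite -(f0 _ (seg t t01) (y - x)).
  exact/is_derive_line/df/seg.
have [||c _] := @MVT_segment R g (fun=> 0) 0 1 ler01.
- by move=> t /itvP t01; apply: dg; rewrite !t01.
- apply: derivable_within_continuous => t /itvP t01.
  by have [] : is_derive t 1 g 0 by apply: dg; rewrite !t01.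
- by rewrite mul0r => /eqP; rewrite subr_eq0 /g scale1r subrKC scale0r addr0 => /eqP.
Qed.

Lemma constant_mx_on_ball m n (f : V -> 'M[R]_(m, n)) (x : V) (r : R) :
  (forall y, ball x r y -> differentiable f y) ->
  (forall y, ball x r y -> forall v, 'D_v f y = 0) ->
  forall y, ball x r y -> f y = f x.
Proof.
move=> df f0 y xy; apply/matrixP => i j.
apply: (constant_on_ball (f := fun y => f y i j) _ _ xy) => z xz.
  exact/differentiable_entry/df.
by move=> v; rewrite -derive_coord ?f0 ?mxE//; exact: df.
Qed.

Lemma nbhs_square (P : set V) (x v w : V) : nbhs x P ->
  exists2 d : R, 0 < d & forall a b, `|a| <= d -> `|b| <= d ->
    P (x + a *: v + b *: w).
Proof.
move=> /nbhs_ballP[e /= e0 eP].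
have K0 : 0 < `|v| + `|w| + 1 by rewrite ltr_wpDl// addr_ge0.
exists (e / (`|v| + `|w| + 1)) => [|a b ad bd]; first exact: divr_gt0.
apply: eP; rewrite -ball_normE /= -addrA opprD addNKr normrN.
apply: (le_lt_trans (ler_normD _ _)); rewrite !normrZ.
apply: (@le_lt_trans _ _ (e / (`|v| + `|w| + 1) * (`|v| + `|w|))).
  by rewrite mulrDr lerD// ler_wpM2r.
by rewrite -mulrA gtr_pMr// mulrC ltr_pdivrMr// mul1r ltrDl.
Qed.

Arguments nbhs_square {P x} v w.

(** The mean value theorem is applied twice: to the increment of [f] between two parallel segments
    in direction [v], then to [fv] in direction [w]. *)
Lemma second_difference (f fv : V -> R) (x v w : V) (s : R) : 0 < s ->
  (forall a b, `|a| <= s -> `|b| <= s -> let y := x + a *: v + b *: w in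
    [/\ differentiable f y, 'D_v f y = fv y & differentiable fv y]) ->
  exists a b : R, [/\ `|a| <= s, `|b| <= s &
    f (x + s *: v + s *: w) - f (x + s *: v) - f (x + s *: w) + f x =
    s * s * 'D_w fv (x + a *: v + b *: w)].
Proof.
move=> s0 df.
have ns (t : R) : 0 <= t <= s -> `|t| <= s by move=> /andP[? ?]; rewrite ger0_norm.
have ns0 : `|0 : R| <= s by rewrite normr0 ltW.
have nss : `|s| <= s by rewrite ger0_norm// ltW.
pose g (t : R) := f (x + s *: w + t *: v) - f (x + t *: v).
have dg (t : R) : 0 <= t <= s ->
    is_derive t 1 g (fv (x + s *: w + t *: v) - fv (x + t *: v)).
  move=> ts; have [d1 e1 _] := df t s (ns _ ts) nss.
  have := df t 0 (ns _ ts) ns0; rewrite scale0r addr0 => -[d2 e2 _].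
  rewrite -e2 addrAC -e1 addrAC; apply: is_deriveB; apply: is_derive_line => //.
  by rewrite addrAC.
have [||a /itvP ais] := @MVT_segment R g
   (fun t => fv (x + s *: w + t *: v) - fv (x + t *: v)) 0 s (ltW s0).
- by move=> t /itvP ts; apply: dg; rewrite !ts.
- apply: derivable_within_continuous => t /itvP ts.
  by have /dg[] : 0 <= t <= s by rewrite !ts.
rewrite subr0 => gE.
have as_ : `|a| <= s by apply: ns; rewrite !ais.
pose h (t : R) := fv (x + a *: v + t *: w).
have dh (t : R) : 0 <= t <= s ->
    is_derive t 1 h ('D_w fv (x + a *: v + t *: w)).
  by move=> ts; apply: is_derive_line; have [] := df a t as_ (ns _ ts).
have [||b /itvP bis] := @MVT_segment R h
   (fun t => 'D_w fv (x + a *: v + t *: w)) 0 s (ltW s0).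
- by move=> t /itvP ts; apply: dh; rewrite !ts.
- apply: derivable_within_continuous => t /itvP ts.
  by have /dh[] : 0 <= t <= s by rewrite !ts.
rewrite subr0 => hE.
exists a, b; split=> //; first by apply: ns; rewrite !bis.
have gE' : g s - g 0 = (h s - h 0) * s.
  by rewrite gE /h scale0r addr0 [x + s *: w + _]addrAC.
rewrite hE in gE'; transitivity (g s - g 0); last by rewrite gE'; ring.
by rewrite /g !scale0r !addr0 [x + s *: w + _]addrAC; ring.
Qed.

(** The second difference of [f] over a small parallelogram is symmetric in [v] and [w], so it is
    [s * s] times a value of [fvw] and also times a value of [fwv], at two points close to [x];
    continuity closes the gap. The partial derivatives are passed as functions agreeing with them
    near [x], so that entries of a vector-valued derivative can be supplied. *)
Lemma schwarz_scalar (f fv fw fvw fwv : V -> R) (x v w : V) :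
  (\forall y \near x, [/\ differentiable f y, 'D_v f y = fv y & 'D_w f y = fw y]) ->
  (\forall y \near x, differentiable fv y /\ 'D_w fv y = fvw y) ->
  (\forall y \near x, differentiable fw y /\ 'D_v fw y = fwv y) ->
  {for x, continuous fvw} -> {for x, continuous fwv} -> fvw x = fwv x.
Proof.
move=> df dvf dwf c1 c2; apply/eqP; rewrite -subr_eq0 -normr_le0.
apply/ler_addgt0Pl => e e0; rewrite addr0.
have e20 : 0 < e / 2 by rewrite divr_gt0.
move/cvgrPdist_lt : c1 => /(_ _ e20) c1.
move/cvgrPdist_lt : c2 => /(_ _ e20) c2.
have /(nbhs_square v w)[s s0 sP] : \forall y \near x,
   [/\ [/\ differentiable f y, 'D_v f y = fv y & 'D_w f y = fw y],
      differentiable fv y /\ 'D_w fv y = fvw y,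
      differentiable fw y /\ 'D_v fw y = fwv y,
      `|fvw x - fvw y| < e / 2 & `|fwv x - fwv y| < e / 2].
  by near=> y; split; near: y.
have [|a [b [as_ bs E1]]] := @second_difference f fv x v w s s0.
  by move=> a b ha hb /=; have [[? ? ?] [? ?] _ _ _] := sP _ _ ha hb.
have [|b' [a' [bs' as' E2]]] := @second_difference f fw x w v s s0.
  by move=> a' b' ha hb /=; rewrite addrAC; have [[? ? ?] _ [? ?] _ _] := sP _ _ hb ha.
have [_ [_ e1] _ h1 _] := sP _ _ as_ bs.
have [_ _ [_ e2] _ h2] := sP _ _ as' bs'.
have E : fvw (x + a *: v + b *: w) = fwv (x + a' *: v + b' *: w).
  apply: (mulfI (mulf_neq0 (lt0r_neq0 s0) (lt0r_neq0 s0))).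
  rewrite -e1 -E1 -e2 [x + a' *: v + _]addrAC -E2 [x + s *: w + _]addrAC; ring.
rewrite E in h1; rewrite distrC in h2; rewrite [leRHS](splitr e).
by apply: (le_trans (ler_distD _ _ _)); apply: lerD; [exact: ltW h1|exact: ltW h2].
Unshelve. all: by end_near. Qed.

End Lines.
Arguments nbhs_square {R V P x} v w.

(** * Smooth maps and derivatives along vector fields *)

Section Smooth.
Context {R : realType}.

Lemma smooth_differentiable {V W : normedModType R} (O : set V) (f : V -> W) u :
  smooth_on O f -> O u -> differentiable f u.
Proof. by move=> sf; have [h _] := sf 1%N; exact: h. Qed.

Lemma smooth_derive {V W : normedModType R} (O : set V) (f : V -> W) v :
  smooth_on O f -> smooth_on O (fun u => 'D_v f u).
Proof. by move=> sf k; have [_ +] := sf k.+1; apply. Qed.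

Lemma smooth_continuous {V W : normedModType R} (O : set V) (f : V -> W) u :
  smooth_on O f -> O u -> {for u, continuous f}.
Proof. by move=> sf; have := sf 0%N; exact. Qed.

Lemma smooth_subset {V W : normedModType R} (O O' : set V) (f : V -> W) :
  O `<=` O' -> smooth_on O' f -> smooth_on O f.
Proof.
move=> sub sf k; elim: k f {sf}(sf k) => [|k IH] f /=; first by move=> h u /sub; exact: h.
by move=> [h1 h2]; split=> [u /sub|v]; [exact: h1|exact/IH/h2].
Qed.

Lemma near_open {T : topologicalType} (O : set T) (P : set T) u :
  open O -> O u -> (forall v, O v -> P v) -> \forall v \near u, P v.
Proof. by move=> oO Ou OP; apply: filterS OP _; exact: open_nbhs_nbhs. Qed.

Lemma derive_eq_on {V W : normedModType R} (O : set V) (f g : V -> W) u v :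
  open O -> O u -> (forall y, O y -> f y = g y) -> 'D_v f u = 'D_v g u.
Proof. by move=> oO Ou fg; apply: near_eq_derive; exact: near_open oO Ou fg. Qed.

(** The differential of [g] serves [f]: the first-order expansion only concerns points near [x], and
    [diff_unique] identifies its linear part with the differential of [f]. *)
Lemma near_eq_differentiable {V W : normedModType R} (f g : V -> W) (x : V) :
  (\forall y \near x, g y = f y) -> differentiable g x -> differentiable f x.
Proof.
move=> gf dg; have fgx : g x = f x by exact: nbhs_singleton gf.
have [cd Eg] := (diff_locallyP x g).1 dg.
have Ef : f \o shift x = cst (f x) + 'd g x +o_ 0 id.
  apply/eqaddoP => e e0; move/eqaddoP : Eg => /(_ _ e0) Eg.
  have gf0 : \forall h \near (0 : V), g (h + x) = f (h + x).
    move: gf; rewrite (near_shift 0 x)/=; apply: filterS => h.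
    by rewrite /= subr0.
  by apply: filterS2 gf0 Eg => h gh; rewrite !fctE /= gh fgx.
by apply/diff_locallyP; rewrite (diff_unique cd Ef).
Qed.

Lemma differentiable_eq_on {V W : normedModType R} (O : set V) (f g : V -> W) u :
  open O -> O u -> (forall y, O y -> f y = g y) -> differentiable g u ->
  differentiable f u.
Proof.
move=> oO Ou fg; apply: near_eq_differentiable.
by apply: near_open oO Ou _ => y /fg.
Qed.

Lemma Ck_eq_on {V W : normedModType R} k (O : set V) (f g : V -> W) :
  open O -> (forall y, O y -> f y = g y) -> Ck_on k O g -> Ck_on k O f.
Proof.
move=> oO; elim: k f g => [|k IH] f g fg /=.
  move=> cg u Ou.
  rewrite /prop_for /continuous_at fg//; apply: cvg_trans (cg _ Ou).
  by apply: near_eq_cvg; apply: near_open oO Ou _ => y Oy; rewrite fg.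
move=> [dg cg]; split=> [u Ou|v].
  exact: differentiable_eq_on oO Ou fg (dg _ Ou).
by apply: IH (cg v) => y Oy; exact: derive_eq_on oO Oy fg.
Qed.

Lemma schwarz {V : normedModType R} d (O : set V) (f : V -> 'rV[R]_d) u v w :
  open O -> O u -> smooth_on O f ->
  'D_w (fun y => 'D_v f y) u = 'D_v (fun y => 'D_w f y) u.
Proof.
move=> oO Ou sf; apply/matrixP => i j.
have E (g : V -> 'rV[R]_d) a y : smooth_on O g -> O y ->
    differentiable (fun z => g z i j) y /\
    'D_a (fun z => g z i j) y = ('D_a g y) i j.
  move=> sg Oy; have dg := smooth_differentiable sg Oy.
  by rewrite derive_coord//; split=> //; exact: differentiable_entry.
have C a b : {for u, continuous (fun y => ('D_b (fun y => 'D_a f y) y) i j)}.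
  apply: (@continuous_comp _ _ _ _ (fun M : 'rV[R]_d => M i j)).
    exact: smooth_continuous (smooth_derive _ (smooth_derive _ sf)) Ou.
  exact: coord_continuous.
apply: (schwarz_scalar (f := fun z => f z i j) (v := v) (w := w)
  (fv := fun y => ('D_v f y) i j) (fw := fun y => ('D_w f y) i j) _ _ _ (C v w) (C w v));
  apply: near_open oO Ou _ => y Oy.
- by have [d1 e1] := E f v y sf Oy; have [_ e2] := E f w y sf Oy.
- exact: E (smooth_derive v sf) Oy.
- exact: E (smooth_derive w sf) Oy.
Qed.

Lemma derive_dir_sum {W : normedModType R} m (f : 'rV[R]_m -> W) u v :
  differentiable f u -> 'D_v f u = \sum_k v 0 k *: 'D_('e_k) f u.
Proof.
move=> df; rewrite deriveE// {1}[v]row_sum_delta linear_sum /=.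
by apply: eq_bigr => k _; rewrite linearZ /= deriveE.
Qed.

Section DirectionFields.
Context {m d : nat} (O : set 'rV[R]_m) (f : 'rV[R]_m -> 'rV[R]_d).
Hypotheses (oO : open O) (sf : smooth_on O f).
Implicit Types (X : 'rV[R]_m -> 'rV[R]_m).

Lemma differentiable_dir X u : O u -> differentiable X u ->
  differentiable (fun y => 'D_(X y) f y) u.
Proof.
move=> Ou dX.
apply: (differentiable_eq_on (g := fun y => \sum_k X y 0 k *: 'D_('e_k) f y) oO Ou).
  by move=> y Oy; rewrite derive_dir_sum//; exact: smooth_differentiable sf Oy.
apply: differentiable_sumE => k; apply: differentiable_scale.
  exact: differentiable_entry.
exact: smooth_differentiable (smooth_derive _ sf) Ou.
Qed.

(** Product rule for the pairing of a moving direction with the differential of [f], read off in the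
    basis ['e_k]. *)
Lemma derive_dir X u v : O u -> differentiable X u ->
  'D_v (fun y => 'D_(X y) f y) u =
  'D_('D_v X u) f u + 'D_v (fun y => 'D_(X u) f y) u.
Proof.
move=> Ou dX; have df y : O y -> differentiable f y.
  by move=> Oy; exact: smooth_differentiable sf Oy.
have ddf k : differentiable (fun y => 'D_('e_k) f y) u.
  exact: smooth_differentiable (smooth_derive _ sf) Ou.
have dXk k : differentiable (fun y => X y 0 k) u by exact: differentiable_entry.
transitivity ('D_v (fun y => \sum_k X y 0 k *: 'D_('e_k) f y) u).
  by apply: derive_eq_on oO Ou _ => y Oy; rewrite derive_dir_sum//; exact: df.
rewrite derive_sumE; last by move=> k; exact: differentiable_scale.
rewrite (derive_dir_sum _ (df _ Ou)).
have -> : 'D_v (fun y => 'D_(X u) f y) u =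
    'D_v (fun y => \sum_k X u 0 k *: 'D_('e_k) f y) u.
  by apply: derive_eq_on oO Ou _ => y Oy; rewrite derive_dir_sum//; exact: df.
rewrite derive_sumE; last by move=> k; exact: differentiable_scale.
rewrite -big_split /=; apply: eq_bigr => k _.
rewrite derive_scale// derive_coord// derive_scale//.
by rewrite derive_cst scale0r add0r.
Qed.

End DirectionFields.

Lemma derive_lincomb {V : normedModType R} d (O : set V) (f g : V -> 'rV[R]_d) a u v :
  smooth_on O f -> smooth_on O g -> O u ->
  'D_v (fun y => f y + a *: g y) u = 'D_v f u + a *: 'D_v g u.
Proof.
move=> sf sg Ou.
have df := smooth_differentiable sf Ou; have dg := smooth_differentiable sg Ou.
rewrite deriveD ?deriveZ//; first exact/diff_derivable.
- exact/diff_derivable.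
- exact/derivableZ/diff_derivable.
Qed.

Lemma smooth_lincomb {V : normedModType R} d (O : set V) (f g : V -> 'rV[R]_d) a :
  open O -> smooth_on O f -> smooth_on O g ->
  smooth_on O (fun y => f y + a *: g y).
Proof.
move=> oO sf sg k; elim: k f g sf sg => [|k IH] f g sf sg /=.
  move=> u Ou; apply: differentiable_continuous.
  apply: differentiableD; first exact: smooth_differentiable sf Ou.
  by apply: differentiableZ; exact: smooth_differentiable sg Ou.
split=> [u Ou|v].
  apply: differentiableD; first exact: smooth_differentiable sf Ou.
  by apply: differentiableZ; exact: smooth_differentiable sg Ou.
apply: (Ck_eq_on (g := fun y => 'D_v f y + a *: 'D_v g y) oO).
  by move=> y Oy; exact: derive_lincomb sf sg Oy.
by apply: IH; exact: smooth_derive.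
Qed.

End Smooth.

(** * Open mapping theorem for differentiable maps *)

Section OpenMap.
Context {R : realType}.

Lemma norm_entry_le n (v : 'rV[R]_n) j : `|v 0 j| <= `|v|.
Proof.
rewrite [leRHS]/Num.Def.normr/= mx_normrE.
exact: (le_bigmax _ (fun ij : 'I_1 * 'I_n => `|v ij.1 ij.2|) (0, j)).
Qed.

(** The norm of a row vector is the maximum of its entries. It is compared with the sum of squares
    because the latter is differentiable, so that a minimum can be tested by a derivative. *)
Lemma sum_sqr_ge n (v : 'rV[R]_n) : `|v| ^+ 2 <= \sum_j v 0 j ^+ 2.
Proof.
have [->|v0] := eqVneq v 0.
  by rewrite normr0 expr0n sumr_ge0// => j _; rewrite sqr_ge0.
have [|[i j] /= E] := @mx_norm_neq0 R 1 n v.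
  by apply: contra v0 => /eqP/mx_norm_eq0/eqP.
rewrite [`|v|]/Num.Def.normr/= E (ord1 i) real_normK ?num_real//.
by rewrite (bigD1 j)//= lerDl sumr_ge0// => k _; rewrite sqr_ge0.
Qed.

Lemma sum_sqr_le n (v : 'rV[R]_n) : \sum_j v 0 j ^+ 2 <= n%:R * `|v| ^+ 2.
Proof.
rewrite -[n in n%:R]card_ord -sumr_const mulr_suml ler_sum// => j _.
by rewrite mul1r -real_normK ?num_real// lerXn2r ?nnegrE ?norm_entry_le.
Qed.

Lemma differentiable_mulmxr n p (J : 'M[R]_(n, p)) (v : 'rV[R]_n) :
  differentiable (fun x : 'rV[R]_n => x *m J) v.
Proof. exact: differentiable_mulmx. Qed.

Lemma derive_mulmxr n p (J : 'M[R]_(n, p)) (x v : 'rV[R]_n) :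
  'D_v (fun x : 'rV[R]_n => x *m J) x = v *m J.
Proof. by rewrite derive_mulmx// derive_id derive_cst mulmx0 addr0. Qed.

Lemma invertible_bound n (J : 'M[R]_n) : J \in unitmx ->
  exists2 C : R, 0 < C & forall v : 'rV[R]_n, `|v| <= C * `|v *m J|.
Proof.
move=> uJ.
have [|C C0 CP] := linear_lipschitz (f := @mulmxr R 1 n n (invmx J)).
  by move=> v; apply: differentiable_continuous; exact: differentiable_mulmxr.
exists C => // v; have := CP (v *m J).
by rewrite /= mulmxK.
Qed.

Lemma derive_sum_sqr {V : normedModType R} n (f : V -> 'rV[R]_n) (x v : V) :
  differentiable f x ->
  differentiable (fun y => \sum_j f y 0 j ^+ 2) x /\
  'D_v (fun y => \sum_j f y 0 j ^+ 2) x = 2 * \sum_j f x 0 j * 'D_v f x 0 j.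
Proof.
move=> df.
have d j : differentiable (fun y => f y 0 j) x by exact: differentiable_entry.
have sqE j : (fun y => f y 0 j ^+ 2) = (fun y => f y 0 j) * (fun y => f y 0 j).
  by apply/funext => y; rewrite expr2.
have d2 j : differentiable (fun y => f y 0 j ^+ 2) x.
  by rewrite sqE; exact: differentiableM.
split; first exact: differentiable_sumE.
rewrite derive_sumE// mulr_sumr; apply: eq_bigr => j _.
rewrite sqE deriveM; [|exact/diff_derivable..].
by rewrite derive_coord// /GRing.scale /= mulr_natl mulr2n.
Qed.

(* A minimum of |f - y|^2 over a small closed ball is interior if y is close to
   the value at the centre, and there the invertible differential forces f = y. *)
Lemma open_map n (f : 'rV[R]_n -> 'rV[R]_n) (O : set 'rV[R]_n) : open O ->
  (forall x, O x -> differentiable f x /\ forall v, 'D_v f x = 0 -> v = 0) ->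
  open (f @` O).
Proof.
move=> oO fP; rewrite openE => _ [x0 Ox0 <-].
have uJ x : O x -> jacobian f x \in unitmx.
  move=> /fP[df inj]; rewrite -row_free_unit -kermx_eq0.
  apply/rowV0P => v /sub_kermxP vJ; apply: inj.
  by rewrite deriveEjacobian.
have [C C0 CP] := invertible_bound (uJ _ Ox0).
have [df0 _] := fP _ Ox0.
have C20 : 0 < (2 * C)^-1 by rewrite invr_gt0 mulr_gt0.
(* [C] bounds the inverse of the differential, so the linear part has size at least [|h| / C]; the
   remainder of the expansion takes away at most half of that. *)
have /nbhs_ballP[e /= e0 eP] : \forall h \near (0 : 'rV[R]_n),
    (2 * C)^-1 * `|h| <= `|f (h + x0) - f x0|.
  have /eqaddoP/(_ _ C20) := diff_locally df0.
  apply: filterS => h /=; rewrite !fctE.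
  have -> : 'd f x0 h = h *m jacobian f x0 by rewrite -deriveE// deriveEjacobian.
  have := CP h.
  set a := f (h + x0) - f x0; set b := h *m _.
  rewrite opprD addrA -/a => h1 h2.
  have h3 : `|b| <= `|a| + `|a - b|.
    rewrite -[b in leLHS](subKr a); exact: ler_normB.
  rewrite -(ler_pM2l C0) mulrA.
  have CV : C * (2 * C)^-1 = 2^-1.
    by rewrite invfM mulrCA divff ?mulr1// gt_eqF.
  rewrite CV; have : C * `|b| <= C * `|a| + 2^-1 * `|h|.
    rewrite -CV -mulrA -mulrDr ler_wpM2l ?(ltW C0)//.
    by apply: (le_trans h3); rewrite lerD2l.
  by lra.
have /nbhs_ballP[e' /= e'0 e'P] : nbhs x0 O by exact: open_nbhs_nbhs.
pose rho := Num.min e e' / 2.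
have rho0 : 0 < rho by rewrite divr_gt0// lt_min e0.
have [rhoe rhoe'] : rho < e /\ rho < e'.
  have : Num.min e e' <= e by rewrite ge_min lexx.
  have : Num.min e e' <= e' by rewrite ge_min lexx orbT.
  by rewrite /rho; move: rho0; rewrite /rho; lra.
pose B := [set x : 'rV[R]_n | `|x0 - x| <= rho].
have BO : B `<=` O.
  by move=> x; rewrite /B /= => h; apply: e'P; rewrite -ball_normE /= (le_lt_trans h).
have cB : compact B.
  apply: bounded_closed_compact.
    exists (`|x0| + rho); split; first exact: num_real.
    move=> M MB x; rewrite /B /= => h; apply/ltW/(le_lt_trans _ MB).
    rewrite -[x](subKr x0); apply: (le_trans (ler_normB _ _)).
    by rewrite lerD2l.
  have -> : B = closed_ball_ Num.Def.normr x0 rho by [].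
  by rewrite -closed_ballE//; exact: closed_ball_closed.
pose s := (2 * C)^-1 * rho.
have s0 : 0 < s by exact: mulr_gt0.
(* On the boundary of [B] the map moves by at least [s]. The factor [n + 1] absorbs the comparison
   of the two norms: at the centre [E] is below [(s / 2) ^+ 2], while [d <= s / 2] keeps it at least
   that large on the boundary. *)
pose d := s / (2 * (n%:R + 1)).
have n10 : 0 < n%:R + 1 :> R by rewrite ltr_wpDl.
have d0 : 0 < d by rewrite divr_gt0// mulr_gt0.
apply/nbhs_ballP; exists d => // y; rewrite -ball_normE /= => yd.
pose E (x : 'rV[R]_n) := \sum_j (f x - y) 0 j ^+ 2.
have dfy x : O x -> differentiable (fun x => f x - y) x.
  by move=> /fP[df _]; exact: differentiableB.
have dE x : O x -> differentiable E x.
  by move=> Ox; have [] := derive_sum_sqr 0 (dfy _ Ox).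
have [||c] := @EVT_min_rV R n E B _ cB.
- by exists x0; rewrite /B /= subrr normr0 ltW.
- apply: continuous_in_subspaceT => x; rewrite inE => /BO Ox.
  exact/differentiable_continuous/dE.
rewrite inE => cinB cmin.
have Oc := BO _ cinB.
have x0B : x0 \in B by rewrite inE /B /= subrr normr0 ltW.
have E0 : E x0 < (s / 2) ^+ 2.
  apply: (le_lt_trans (sum_sqr_le _)).
  apply: (@le_lt_trans _ _ (n%:R * d ^+ 2)).
    by rewrite ler_wpM2l// lerXn2r ?nnegrE ?(ltW d0)// ltW.
  have -> : (s / 2) ^+ 2 = (n%:R + 1) ^+ 2 * d ^+ 2.
    by rewrite -exprMn /d; congr (_ ^+ 2); field; rewrite gt_eqF.
  rewrite ltr_pM2r ?exprn_gt0//.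
  have : 0 <= n%:R :> R by []. nra.
have cint : `|x0 - c| < rho.
  rewrite lt_neqAle cinB andbT; apply/eqP => crho.
  have := cmin _ x0B; apply/negP; rewrite -ltNge.
  apply: (lt_le_trans E0); apply: (le_trans _ (sum_sqr_ge _)).
  rewrite lerXn2r ?nnegrE ?divr_ge0 ?(ltW s0)//.
  have := eP (c - x0); rewrite -ball_normE /= sub0r normrN distrC crho.
  move=> /(_ rhoe); rewrite subrK -/s => h1.
  have h2 : `|f c - f x0| <= `|f c - y| + `|f x0 - y|.
    by rewrite (distrC (f x0)); exact: ler_distD.
  have h3 : d <= s / 2.
    rewrite /d ler_pM2l// lef_pV2 ?posrE ?mulr_gt0// ler_peMr//.
    by rewrite lerDr.
  by lra.
exists c => //.
(* Along this direction the derivative of [E] is twice the sum of the squares of the entries of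
   [f c - y]. *)
have [v vE] : exists v, 'D_v f c = f c - y.
  exists ((f c - y) *m invmx (jacobian f c)).
  have [df _] := fP _ Oc; rewrite deriveEjacobian// mulmxKV//; exact: uJ.
have [de' E'] := derive_sum_sqr v (dfy _ Oc).
have dcst : 'D_v (fun x => f x - y) c = 'D_v f c.
  have [df _] := fP _ Oc; rewrite deriveB//; last exact/diff_derivable.
  by rewrite derive_cst subr0.
have [a a0 aP] : exists2 a : R, 0 < a & forall t, `|t| < a -> B (c + t *: v).
  have : nbhs c B.
    apply: filterS (nbhsx_ballx c (rho - `|x0 - c|) _); last by rewrite subr_gt0.
    move=> x; rewrite -ball_normE /B /= => h.
    by apply: (le_trans (ler_distD c _ _)); lra.
  move=> /(nbhs_square 0 v)[a a0 aP]; exists a => // t ta.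
  by have := aP 0 t; rewrite scale0r addr0 normr0; apply; exact: ltW.
have Ec (t : R) : t \in `]- a, a[ -> `|t| < a by rewrite in_itv /= ltr_norml.
have dl (t : R) : `|t| < a ->
    is_derive t 1 (fun t : R => E (c + t *: v)) ('D_v E (c + t *: v)).
  by move=> ta; apply: is_derive_line; exact/dE/BO/aP.
have [||||_] := @derive1_at_min R (fun t : R => E (c + t *: v)) (- a) a 0.
- by rewrite ge0_cp// ltW.
- by move=> t /Ec/dl[].
- by rewrite in_itv /= oppr_lt0 a0.
- move=> t /Ec ta; rewrite scale0r addr0; apply: cmin.
  by rewrite inE; exact: aP.
have [|_ ->] := dl 0; first by rewrite normr0.
rewrite scale0r addr0 /E E' dcst vE => /eqP.
rewrite mulf_eq0 (pnatr_eq0 _ 2) /= => /eqP sum0.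
have /psumr_eq0P Z : \sum_j (f c - y) 0 j * (f c - y) 0 j = 0 by [].
apply/eqP; rewrite -subr_eq0; apply/eqP/rowP => j; rewrite [RHS]mxE.
have /eqP := Z (fun j _ => sqr_ge0 _) j isT.
by rewrite mulf_eq0 orbb => /eqP.
Qed.

End OpenMap.

(** * Linear algebra of scalar products *)

Section Inner.
Context {R : realType} {d : nat} (t : nat).
Implicit Types x y z : 'rV[R]_d.

Definition gram : 'M[R]_d := diag_mx (\row_i (-1) ^+ (i < t)%N).

Lemma innerE x y : inner t x y = \sum_(i < d) (-1) ^+ (i < t)%N * x 0 i * y 0 i.
Proof.
rewrite [RHS](bigID (fun i : 'I_d => (i < t)%N)) /= /inner; congr (_ + _).
  by rewrite -sumrN; apply: eq_bigr => i ->; rewrite expr1 mulN1r mulNr.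
apply: eq_big => [i|i]; first by rewrite -leqNgt.
by rewrite leqNgt => /negbTE ->; rewrite expr0 mul1r.
Qed.

Lemma inner_gram x y : inner t x y = (x *m gram *m y^T) 0 0.
Proof.
rewrite innerE mxE; apply: eq_bigr => i _.
by rewrite mul_mx_diag !mxE (mulrC (x 0 i)).
Qed.

Lemma gramK : gram *m gram = 1%:M.
Proof.
rewrite mulmx_diag -diag_const_mx; congr diag_mx; apply/rowP => i.
by rewrite !mxE -signr_addb addbb.
Qed.

Lemma tr_gram : gram^T = gram. Proof. exact: tr_diag_mx. Qed.

Lemma innerC x y : inner t x y = inner t y x.
Proof. by rewrite !innerE; apply: eq_bigr => i _; rewrite mulrAC. Qed.

Lemma innerDl x y z : inner t (x + y) z = inner t x z + inner t y z.
Proof. by rewrite !inner_gram !mulmxDl mxE. Qed.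

Lemma innerDr x y z : inner t x (y + z) = inner t x y + inner t x z.
Proof. by rewrite ![inner t x _]innerC innerDl. Qed.

Lemma innerZl a x y : inner t (a *: x) y = a * inner t x y.
Proof. by rewrite !inner_gram -!scalemxAl mxE. Qed.

Lemma innerZr a x y : inner t x (a *: y) = a * inner t x y.
Proof. by rewrite ![inner t x _]innerC innerZl. Qed.

Lemma innerNl x y : inner t (- x) y = - inner t x y.
Proof. by rewrite -scaleN1r innerZl mulN1r. Qed.

Lemma innerNr x y : inner t x (- y) = - inner t x y.
Proof. by rewrite -scaleN1r innerZr mulN1r. Qed.

Lemma innerBl x y z : inner t (x - y) z = inner t x z - inner t y z.
Proof. by rewrite innerDl innerNl. Qed.

Lemma innerBr x y z : inner t x (y - z) = inner t x y - inner t x z.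
Proof. by rewrite innerDr innerNr. Qed.

Lemma inner0l x : inner t 0 x = 0.
Proof. by rewrite -[0](scale0r x) innerZl mul0r. Qed.

Lemma inner0r x : inner t x 0 = 0.
Proof. by rewrite innerC inner0l. Qed.

Lemma inner_suml (I : Type) (s : seq I) (P : pred I) (F : I -> 'rV[R]_d) x :
  inner t (\sum_(i <- s | P i) F i) x = \sum_(i <- s | P i) inner t (F i) x.
Proof. by elim/big_ind2 : _ => [|a b c e <- <-|//]; rewrite ?inner0l ?innerDl. Qed.

Lemma inner_sumr (I : Type) (s : seq I) (P : pred I) (F : I -> 'rV[R]_d) x :
  inner t x (\sum_(i <- s | P i) F i) = \sum_(i <- s | P i) inner t x (F i).
Proof. by rewrite innerC inner_suml; apply: eq_bigr => i _; rewrite innerC. Qed.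

Lemma inner_nondeg x : (forall y, inner t x y = 0) -> x = 0.
Proof.
move=> x0; apply/rowP => j; have := x0 (delta_mx 0 j).
rewrite inner_gram trmx_delta -colE mxE mul_mx_diag !mxE => /eqP.
by rewrite mulf_eq0 signr_eq0 orbF => /eqP.
Qed.

Lemma inner_mulmx m n (v : 'rV[R]_m) (w : 'rV[R]_n) A B :
  inner t (v *m A) (w *m B) = (v *m (A *m gram *m B^T) *m w^T) 0 0.
Proof. by rewrite inner_gram trmx_mul !mulmxA. Qed.

Lemma bilin_eq0 m n (A : 'M[R]_(m, n)) :
  (forall v w : 'rV_ _, (v *m A *m w^T) 0 0 = 0) -> A = 0.
Proof.
move=> A0; apply/matrixP => i j; have := A0 (delta_mx 0 i) (delta_mx 0 j).
by rewrite -rowE trmx_delta -colE !mxE.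
Qed.

Lemma row_eq0 n (z : 'rV[R]_n) : (forall w : 'rV_n, (z *m w^T) 0 0 = 0) -> z = 0.
Proof.
by move=> z0; apply: bilin_eq0 => v w; rewrite (mx11_scalar v) mul_scalar_mx -scalemxAl mxE z0 mulr0.
Qed.

End Inner.
Arguments gram {R d} t.

Section InnerCalculus.
Context {R : realType} {V : normedModType R} {d : nat} (t : nat).
Implicit Types f g : V -> 'rV[R]_d.

Lemma differentiable_inner f g (x : V) :
  differentiable f x -> differentiable g x ->
  differentiable (fun y => inner t (f y) (g y)) x.
Proof.
move=> df dg.
rewrite (_ : (fun _ => _) = fun y => (f y *m gram t *m (g y)^T) 0 0).
  by apply: differentiable_entry; do 2?apply: differentiable_mulmx => //;
     exact: differentiable_trmx.
by apply/funext => y; rewrite inner_gram.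
Qed.

Lemma derive_inner f g (x v : V) :
  differentiable f x -> differentiable g x ->
  'D_v (fun y => inner t (f y) (g y)) x =
  inner t ('D_v f x) (g x) + inner t (f x) ('D_v g x).
Proof.
move=> df dg.
rewrite (_ : (fun _ => _) = fun y => (f y *m gram t *m (g y)^T) 0 0); last first.
  by apply/funext => y; rewrite inner_gram.
have d1 : differentiable (fun y => f y *m gram t) x by exact: differentiable_mulmx.
have d2 : differentiable (fun y => (g y)^T) x by exact: differentiable_trmx.
rewrite -derive_coord; last exact: differentiable_mulmx.
rewrite derive_mulmx// derive_mulmx// derive_cst mulmx0 addr0 derive_trmx//.
by rewrite !inner_gram mxE.
Qed.

End InnerCalculus.

Section Frames.
Context {R : realType} (t : nat).

(* The vectors p (present only when c0 holds), n and the rows of J form a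
   basis, because their Gram matrix is block diagonal with invertible blocks. *)
Lemma adapted_basis_eq0 (c0 : bool) m (p n W : 'rV[R]_(c0 + m.+1))
    (J : 'M[R]_(m, c0 + m.+1)) :
  (c0 -> inner t p p = 1) -> inner t n n != 0 -> (c0 -> inner t p n = 0) ->
  (forall v, c0 -> inner t p (v *m J) = 0) -> (forall v, inner t n (v *m J) = 0) ->
  J *m gram t *m J^T \in unitmx ->
  (c0 -> inner t W p = 0) -> inner t W n = 0 ->
  (forall v, inner t W (v *m J) = 0) -> W = 0.
Proof.
move=> pp nn pn pJ nJ uG Wp Wn WJ.
have c0P : c0 \/ c0 = false by case: (c0); [left|right].
(* A block of [c0] rows equal to [p] is one row or none, so that [B] is square in both cases. *)
pose B : 'M[R]_(c0 + (1 + m), c0 + m.+1) :=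
  col_mx (\matrix_(i < c0) p) (col_mx n J).
have zB z0 z1 z2 : row_mx z0 (row_mx z1 z2) *m B =
    (\sum_i z0 0 i) *: p + (z1 0 0 *: n + z2 *m J).
  rewrite !mul_row_col; congr (_ + (_ + _)).
    apply/rowP => j; rewrite !mxE mulr_suml; apply: eq_bigr => i _.
    by rewrite mxE.
  by rewrite [z1 in LHS]mx11_scalar mul_scalar_mx.
have Jeq0 (z2 : 'rV[R]_m) : (forall v, inner t (z2 *m J) (v *m J) = 0) -> z2 = 0.
  move=> h; suff : z2 *m (J *m gram t *m J^T) = 0.
    by move/(canRL (mulmxK uG)); rewrite mul0mx.
  by apply: row_eq0 => w; rewrite -inner_mulmx h.
have uB : B \in unitmx.
  rewrite -row_free_unit -kermx_eq0; apply/rowV0P => z /sub_kermxP.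
  rewrite -[z]hsubmxK -[rsubmx z]hsubmxK zB.
  set z0 := lsubmx z; set z1 := lsubmx _; set z2 := rsubmx _.
  set s := \sum_i _ => E.
  have sE (c : c0 = false) : s = 0 by rewrite /s big1// => -[k kP] _; exfalso; move: kP; rewrite c.
  have z20 : z2 = 0.
    apply: Jeq0 => v; have := inner0l t (v *m J); rewrite -E !innerDl !innerZl nJ.
    rewrite mulr0 add0r; have [c|/sE->] := c0P; last by rewrite mul0r add0r.
    by rewrite pJ// mulr0 add0r.
  have z10 : z1 = 0.
    have := inner0l t n; rewrite -E !innerDl !innerZl z20 mul0mx inner0l addr0.
    have -> : s * inner t p n = 0.
      by have [c|/sE->] := c0P; rewrite ?mul0r ?pn ?mulr0.
    by move/eqP; rewrite add0r mulf_eq0 (negbTE nn) orbF => /eqP z1E; rewrite [z1]mx11_scalar z1E raddf0.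
  have s0 : s = 0.
    have [c|/sE//] := c0P.
    have := inner0l t p; rewrite -E z20 z10 mxE scale0r mul0mx !addr0 innerZl.
    by rewrite pp// mulr1.
  have -> : z0 = 0.
    apply/rowP => i; rewrite [RHS]mxE; move: s0; rewrite /s.
    have ci : c0 by have [//|c] := c0P; exfalso; case: i => k; rewrite c.
    have i0 k : k = i by apply: val_inj; case: k i => k + [i]; rewrite ci /=; lia.
    by rewrite (bigD1 i)//= big1 ?addr0// => k /eqP; rewrite (i0 k).
  by rewrite z10 z20 !row_mx0.
have WB : W *m (gram t *m B^T) = 0.
  apply: row_eq0 => z; rewrite -[z]hsubmxK -[rsubmx z]hsubmxK.
  rewrite mulmxA -mulmxA -trmx_mul zB -inner_gram !innerDr !innerZr Wn WJ mulr0 !addr0.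
  have [c|c] := c0P; first by rewrite Wp// mulr0.
  by rewrite big1 ?mul0r// => -[k kP] _; exfalso; move: kP; rewrite c.
move/(congr1 (mulmx^~ (invmx (gram t *m B^T)))): WB.
rewrite mul0mx mulmxK// unitmx_mul unitmx_tr uB andbT.
by have [] := mulmx1_unit (@gramK R (c0 + m.+1) t).
Qed.

End Frames.

(** * Orthonormal bases adapted to a self-adjoint projection *)

Section AdaptedBases.
Context {R : realType} (d t : nat) (S : 'M[R]_d).

(** [s i] tells whether [b i] is time-like, [sd i] whether it lies in the image or in the kernel of
    the projection [S]. Sequences indexed by [nat], of which only the first [j] terms count, keep
    the type fixed while the basis grows. *)
Definition adapted (j : nat) (b : nat -> 'rV[R]_d) (s sd : nat -> bool) : Prop :=
  (forall i k, (i < j)%N -> (k < j)%N ->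
     inner t (b i) (b k) = (-1) ^+ s i *+ (i == k)) /\
  forall i, (i < j)%N -> b i *m S = (sd i)%:R *: b i.

Hypothesis (SS : S *m S = S).
Hypothesis (Sadj : forall x y : 'rV_d, inner t (x *m S) y = inner t x (y *m S)).

Lemma adapted_normalize j b s sd w (f : bool) : adapted j b s sd ->
  inner t w w != 0 -> (forall i, (i < j)%N -> inner t w (b i) = 0) ->
  w *m S = f%:R *: w ->
  exists x e, adapted j.+1 (fun i => if i == j then x else b i)
    (fun i => if i == j then e else s i) (fun i => if i == j then f else sd i).
Proof.
move=> [bb bS] ww wb wS; pose e := inner t w w < 0.
pose a := (Num.sqrt `|inner t w w|)^-1.
have aa : a * a * inner t w w = (-1) ^+ e.
  rewrite /a -invfM -expr2 sqr_sqrtr//.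
  by rewrite [X in _ * X]numEsign mulrCA mulVf ?mulr1// normr_eq0.
have lt' i : (i < j.+1)%N -> i != j -> (i < j)%N by lia.
exists (a *: w), e; split=> [i k|i].
  case: (eqVneq i j) => [->|ij]; case: (eqVneq k j) => [->|kj].
  - by move=> _ _; rewrite innerZl innerZr mulrA aa.
  - by move=> _ kj'; rewrite innerZl wb ?lt'// mulr0.
  - by move=> ij' _; rewrite innerC innerZl wb ?lt'// mulr0 (negbTE ij).
  - by move=> ij' kj'; apply: bb; exact: lt'.
case: (eqVneq i j) => [_ _|ij ij']; last by apply: bS; exact: lt'.
by rewrite -scalemxAl wS scalerA mulrC -scalerA.
Qed.

(** Gram-Schmidt for an indefinite product, where the vector to be normalised must not be null. The
    product is nondegenerate on the orthogonal complement of the given vectors, which is stable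
    under [S]; so there is a non-null [x] in it, and one of its orthogonal parts [x *m S] and
    [x - x *m S] is non-null as well. *)
Lemma adapted_extend j b s sd : (j < d)%N -> adapted j b s sd ->
  exists x e f, adapted j.+1 (fun i => if i == j then x else b i)
    (fun i => if i == j then e else s i) (fun i => if i == j then f else sd i).
Proof.
move=> jd ab; have [bb bS] := ab.
pose C x := forall i, (i < j)%N -> inner t x (b i) = 0.
pose A : 'M[R]_(d, j) := gram t *m (\matrix_(i < j) b i)^T.
have [y y0 yC] : exists2 y, y != 0 & C y.
  have : kermx A != 0.
    by rewrite kermx_eq0 /row_free neq_ltn (leq_ltn_trans (rank_leq_col A)).
  case/rowV0Pn => y /sub_kermxP yA y0; exists y => // i ij.
  have := congr1 (fun M : 'rV_j => M 0 (Ordinal ij)) yA.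
  rewrite /A mulmxA mxE [RHS]mxE inner_gram mxE => yA0; rewrite -[RHS]yA0.
  by apply: eq_bigr => k _; rewrite !mxE.
have [z yz] : exists z, inner t y z != 0.
  apply: contrapT => h; move/eqP: y0; apply; apply: (inner_nondeg (t := t)) => z.
  by apply/eqP; apply: contrapT => yz; apply: h; exists z; apply/negP.
pose z' := z - \sum_(i < j) ((-1) ^+ s i * inner t z (b i)) *: b i.
have z'C : C z'.
  move=> i ij; rewrite innerBl inner_suml (bigD1 (Ordinal ij))//= big1.
    rewrite addr0 innerZl bb// eqxx mulr1n mulrAC -signr_addb addbb mul1r.
    by rewrite subrr.
  move=> k kij; rewrite innerZl bb//.
  have /negbTE -> : (k : nat) != i by apply: contra kij => /eqP ki; apply/eqP/val_inj.
  by rewrite mulr0.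
have yz' : inner t y z' = inner t y z.
  rewrite innerBr inner_sumr big1 ?subr0// => i _.
  by rewrite innerZr yC ?mulr0.
clearbody z'.
(* Polarisation: if [y] and [z'] are both null, the square norm of [y + z'] is twice their product,
   which is nonzero. *)
have [x xx xC] : exists2 x, inner t x x != 0 & C x.
  have [yy|yy] := eqVneq (inner t y y) 0; last by exists y.
  have [zz|zz] := eqVneq (inner t z' z') 0; last by exists z'.
  exists (y + z'); last by move=> i ij; rewrite innerDl yC ?z'C ?addr0.
  rewrite !innerDl !innerDr yy zz [inner t z' y]innerC yz' add0r addr0 -mulr2n.
  by rewrite mulrn_eq0.
have x1x2 : inner t (x *m S) (x - x *m S) = 0.
  by rewrite Sadj mulmxBl -mulmxA SS subrr inner0r.
have x1C : C (x *m S).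
  by move=> i ij; rewrite Sadj bS// innerZr xC ?mulr0.
have [x1|x1] := eqVneq (inner t (x *m S) (x *m S)) 0; last first.
  have [|x' [e h]] := adapted_normalize (f := true) ab x1 x1C.
    by rewrite -mulmxA SS scale1r.
  by exists x', e, true.
have x2 : inner t (x - x *m S) (x - x *m S) != 0.
  have x3 : inner t x (x *m S) = 0 by rewrite -{1}SS mulmxA -Sadj.
  by rewrite innerBl x1x2 subr0 innerBr x3 subr0.
have x2C : C (x - x *m S) by move=> i ij; rewrite innerBl xC ?x1C ?subr0.
have [|x' [e h]] := adapted_normalize (f := false) ab x2 x2C.
  by rewrite mulmxBl -mulmxA SS subrr scale0r.
by exists x', e, false.
Qed.

Lemma adapted_full j b s sd : (j <= d)%N -> adapted j b s sd ->
  exists b' s' sd', adapted d b' s' sd' /\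
    forall i, (i < j)%N -> [/\ b' i = b i, s' i = s i & sd' i = sd i].
Proof.
move=> jd; move: {2}(d - j)%N (erefl (d - j)%N) => n.
elim: n j b s sd jd => [|n IH] j b s sd jd E ab.
  have jE : j = d by lia.
  by exists b, s, sd; split=> //; move: ab; rewrite {1}jE.
have jd' : (j < d)%N by lia.
have [x [e [f h]]] := adapted_extend jd' ab.
have [|b' [s' [sd' [h' bE]]]] := IH _ _ _ _ jd' _ h; first by lia.
exists b', s', sd'; split=> // i ij; have [|-> -> ->] := bE i; first exact: leqW.
by rewrite (ltn_eqF ij).
Qed.

End AdaptedBases.

(** * Sylvester's law of inertia *)

Section Inertia.
Context {R : realType} {d : nat}.
Implicit Types (s r : 'I_d -> bool) (B : 'M[R]_d).

Definition sign_mx s : 'M[R]_d := diag_mx (\row_i (-1) ^+ s i).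

Lemma sign_mx_form s (x : 'rV[R]_d) :
  (x *m sign_mx s *m x^T) 0 0 = \sum_i (-1) ^+ s i * x 0 i ^+ 2.
Proof.
rewrite mxE; apply: eq_bigr => i _.
by rewrite mul_mx_diag !mxE mulrAC expr2 mulrC mulrA.
Qed.

(** If [r] had more minus signs than [s], there would be fewer conditions than unknowns for a
    nonzero [z], supported where [r] holds, such that [z *m B] vanishes where [s] holds. The common
    value of the two forms would be negative by the signs [r] and nonnegative by the signs [s]. *)
Lemma inertia_le s r B : B *m sign_mx s *m B^T = sign_mx r ->
  (#|[pred i | r i]| <= #|[pred i | s i]|)%N.
Proof.
move=> BB; rewrite leqNgt; apply/negP => lt.
pose ir (i : 'I_#|[pred i | r i]|) : 'I_d := enum_val i.
pose is_ (i : 'I_#|[pred i | s i]|) : 'I_d := enum_val i.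
have irP i : r (ir i) by exact: (enum_valP i).
pose A : 'M[R]_(_, _) := \matrix_(i, j) B (ir i) (is_ j).
have : kermx A != 0.
  by rewrite kermx_eq0 /row_free neq_ltn (leq_ltn_trans (rank_leq_col A)).
case/rowV0Pn => y /sub_kermxP yA y0.
pose z : 'rV[R]_d := \sum_i y 0 i *: delta_mx 0 (ir i).
have zE i : z 0 (ir i) = y 0 i.
  rewrite summxE (bigD1 i)//= big1.
    by rewrite !mxE !eqxx mulr1 addr0.
  move=> k ki; rewrite !mxE eqxx/= (inj_eq enum_val_inj) eq_sym (negbTE ki).
  by rewrite mulr0.
have z0 k : ~~ r k -> z 0 k = 0.
  move=> rk; rewrite summxE big1// => i _; rewrite !mxE eqxx/=.
  by case: eqP => [E|]; [move: rk; rewrite E irP|rewrite mulr0].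
have zB k : s k -> (z *m B) 0 k = 0.
  move=> sk; have sk' : k \in [pred i | s i] by [].
  have := congr1 (fun M : 'rV_ _ => M 0 (enum_rank_in sk' k)) yA.
  rewrite mxE [RHS]mxE => E; rewrite /z mulmx_suml summxE -[RHS]E.
  apply: eq_bigr => i _; rewrite -scalemxAl -rowE !mxE; congr (_ * B _ _).
  by rewrite /is_ enum_rankK_in.
have : (z *m B *m sign_mx s *m (z *m B)^T) 0 0 = (z *m sign_mx r *m z^T) 0 0.
  by rewrite -BB trmx_mul !mulmxA.
rewrite !sign_mx_form => E.
have ge0 : 0 <= \sum_i (-1) ^+ s i * (z *m B) 0 i ^+ 2.
  apply: sumr_ge0 => i _; have [/zB->|_] := boolP (s i); first by rewrite expr0n mulr0.
  by rewrite mul1r sqr_ge0.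
have : \sum_i z 0 i ^+ 2 <= 0.
  rewrite -oppr_ge0 -sumrN; apply: (le_trans ge0); rewrite E.
  rewrite le_eqVlt; apply/orP; left; apply/eqP/eq_bigr => i _.
  by have [_|/z0->] := boolP (r i); rewrite ?expr1 ?mulN1r// expr0n mulr0 oppr0.
rewrite le_eqVlt ltNge sumr_ge0 ?orbF; last by move=> i _; exact: sqr_ge0.
move=> /eqP/psumr_eq0P Z; move/eqP: y0; apply; apply/rowP => i.
rewrite [RHS]mxE -zE; apply/eqP; rewrite -sqrf_eq0; apply/eqP/Z => // k _.
exact: sqr_ge0.
Qed.

Lemma sign_mxK s : sign_mx s *m sign_mx s = 1%:M.
Proof.
rewrite mulmx_diag -diag_const_mx; congr diag_mx; apply/rowP => i.
by rewrite !mxE -signr_addb addbb.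
Qed.

Lemma inertia s r B : B *m sign_mx s *m B^T = sign_mx r ->
  #|[pred i | r i]| = #|[pred i | s i]|.
Proof.
move=> BB; apply/eqP; rewrite eqn_leq (inertia_le BB) /=.
have uB : B \in unitmx.
  have := mulmx1_unit (sign_mxK r); rewrite -{1}BB => -[+ _].
  by rewrite -mulmxA unitmx_mul => /andP[].
apply: (@inertia_le _ _ (invmx B)).
by rewrite -BB trmx_inv !mulmxA mulVmx// mul1mx mulmxK// unitmx_tr.
Qed.

End Inertia.

Section Counting.

Lemma card_ord_interval d a b (P : pred 'I_d) : (a <= b <= d)%N ->
  (forall i : 'I_d, P i = (a <= i < b)%N) -> #|P| = (b - a)%N.
Proof.
move=> /andP[ab bd] PE; rewrite -sum1_card.
rewrite (eq_bigl (fun i : 'I_d => (a <= i < b)%N)); last by move=> i; rewrite -PE.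
rewrite -(big_mkord (fun i => (a <= i < b)%N) (fun=> 1%N)) /=.
rewrite (@big_cat_nat _ _ _ a)/= ?(leq_trans ab)//.
rewrite big_nat_cond big1 ?add0n; last by move=> i; lia.
rewrite (@big_cat_nat _ _ _ b)//=.
have -> : (\sum_(b <= i < d | (a <= i < b)%N) 1 = 0)%N.
  by rewrite big_nat_cond big1// => i; lia.
rewrite addn0 -[RHS]muln1 -sum_nat_const_nat big_nat_cond [RHS]big_nat_cond.
by apply: eq_bigl => i; case: (a <= i < b)%N.
Qed.

(** Equal colour counts make the two tuples of colours permutations of each other, and [tuple_permP]
    provides the permutation of the indices. *)
Lemma matching_perm d (T : finType) (f g : 'I_d -> T) :
  (forall x, #|[pred i | f i == x]| = #|[pred i | g i == x]|) ->
  exists p : {perm 'I_d}, forall i, f (p i) = g i.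
Proof.
move=> fg; have cE (h : 'I_d -> T) x :
    count_mem x [tuple h i | i < d] = #|[pred i | h i == x]|.
  by rewrite /= count_map cardE size_filter enumT.
have : perm_eq [tuple g i | i < d] [tuple f i | i < d].
  by apply/allP => x _ /=; apply/eqP; rewrite !cE fg.
case/tuple_permP => p E; exists p => i.
have := congr1 (fun s => nth (g i) s i) E.
rewrite -[LHS](tnth_nth _ [tuple g i | i < d]) tnth_mktuple => ->.
by rewrite -[RHS](tnth_nth _ [tuple tnth _ (p i) | i < d]) !tnth_mktuple.
Qed.

End Counting.

(** * Coordinates in which the projection takes the form of the model *)

Section TorusFrame.
Context {R : realType}.

Lemma adapted_card_split d (f g : 'I_d -> bool) c :
  (#|[pred i | (f i, g i) == (c, true)]| + #|[pred i | (f i, g i) == (c, false)]| =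
   #|[pred i | f i == c]|)%N.
Proof.
rewrite -(cardID [pred i | g i] [pred i | f i == c]); congr (_ + _)%N;
  by apply: eq_card => i; rewrite !inE xpair_eqE; case: (g i); rewrite ?andbT ?andbF.
Qed.

Lemma adapted_card_split' d (f g : 'I_d -> bool) c :
  (#|[pred i | (f i, g i) == (true, c)]| + #|[pred i | (f i, g i) == (false, c)]| =
   #|[pred i | g i == c]|)%N.
Proof.
rewrite -(adapted_card_split g f); congr (_ + _)%N;
  by apply: eq_card => i; rewrite !inE !xpair_eqE andbC.
Qed.

(** A basis of eigenvectors of [S] is reordered as in the model: vectors of the kernel take the
    positions below [l] and from [t] to [t + k - l], those of the image the others, the time-like
    ones before [t]. The trace of [S] and the law of inertia express the four block sizes by [l].
    The space-like [x1] in the kernel forces [l <= k], the space-like [b0] in the image forces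
    [t - l <= m - k]. *)
Lemma torus_frame m t k (S : 'M[R]_(m.+2)) b0 x1 :
  (k <= m)%N -> (t <= m.+2)%N -> S *m S = S ->
  (forall x y : 'rV_m.+2, inner t (x *m S) y = inner t x (y *m S)) ->
  \tr S = (m - k + 1)%:R -> b0 *m S = b0 -> inner t b0 b0 = 1 ->
  x1 *m S = 0 -> 0 < inner t x1 x1 ->
  exists l (A : 'M[R]_(m.+2)),
  [/\ (l <= k)%N, (l <= t)%N, (t - l <= m - k)%N & A *m gram t *m A^T = gram t] /\
  forall x : 'rV_m.+2, let y := x *m A in
  [/\ inner t (x - x *m S) (x - x *m S) =
        - (\sum_(i < m.+2 | (i < l)%N) y 0 i ^+ 2)
        + \sum_(i < m.+2 | (t <= i < t + k - l + 1)%N) y 0 i ^+ 2,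
      inner t (x *m S) (x *m S) =
        - (\sum_(i < m.+2 | (l <= i < t)%N) y 0 i ^+ 2)
        + \sum_(i < m.+2 | (t + k - l + 1 <= i)%N) y 0 i ^+ 2
    & k = m -> y 0 ord_max = inner t x b0].
Proof.
move=> km tm SS Sadj trS b0S b01 x1S x1x1.
have [||b [s [sd [[bb bS] /(_ 0%N isT)[b0E s0E sd0E]]]]] :=
  @adapted_full R m.+2 t S SS Sadj 1 (fun=> b0) (fun=> false) (fun=> true).
- by [].
- split=> [i k'|i]; last by rewrite b0S scale1r.
  by rewrite !ltnS !leqn0 => /eqP-> /eqP->; rewrite b01.
pose s_ (i : 'I_m.+2) := s i; pose sd_ (i : 'I_m.+2) := sd i.
pose B0 : 'M[R]_(m.+2) := \matrix_i b i.
have gE : gram t = sign_mx (fun i : 'I_m.+2 => (i < t)%N) :> 'M[R]__ by [].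
have B0B0 : B0 *m gram t *m B0^T = sign_mx s_.
  apply/matrixP => i j; rewrite -[i in LHS]/i.
  have -> : (B0 *m gram t *m B0^T) i j = inner t (b i) (b j).
    rewrite inner_gram -!mulmxA 2!mxE; apply: eq_bigr => k' _; rewrite !mxE.
    by congr (_ * _); apply: eq_bigr => k'' _; rewrite !mxE.
  by rewrite bb// !mxE.
have uB0 : B0 \in unitmx.
  have := mulmx1_unit (@sign_mxK R _ s_); rewrite -{1}B0B0 => -[+ _].
  by rewrite -mulmxA unitmx_mul => /andP[].
have B0S : B0 *m S = diag_mx (\row_i (sd_ i)%:R) *m B0.
  apply/row_matrixP => i; rewrite !row_mul rowK bS// row_diag_mx -scalemxAl -rowE.
  by rewrite mxE rowK.
have cs : #|[pred i | s_ i == true]| = t.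
  transitivity #|[pred i : 'I_m.+2 | (i < t)%N]|; last first.
    by rewrite -[RHS]subn0; apply: card_ord_interval.
  rewrite -(@inertia R _ (fun i : 'I_m.+2 => (i < t)%N) s_ B0)//.
  by apply: eq_card => i; rewrite !inE eqb_id.
have csd : #|[pred i | sd_ i == true]| = (m - k + 1)%N.
  apply/eqP; rewrite -(eqr_nat R) -trS; apply/eqP.
  have -> : S = invmx B0 *m (diag_mx (\row_i (sd_ i)%:R) *m B0).
    by rewrite -B0S mulKmx.
  rewrite mulmxA mxtrace_mulC mulKVmx// mxtrace_diag.
  under eq_bigr do rewrite mxE.
  rewrite -natr_sum -sum1_card; congr _%:R.
  by rewrite [LHS]big_mkcond /=; apply: eq_bigr => i _; rewrite inE; case: (sd_ i).
pose N f g := #|[pred i | (sd_ i, s_ i) == (f, g)]|.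
have N1 c : (N c true + N c false)%N = #|[pred i | sd_ i == c]|.
  exact: adapted_card_split.
have N2 c : (N true c + N false c)%N = #|[pred i | s_ i == c]|.
  exact: adapted_card_split'.
have N3 : (N true true + N true false + (N false true + N false false) = m.+2)%N.
  rewrite !N1 -[m.+2 in RHS]card_ord -(cardC [pred i | sd_ i]); congr (_ + _)%N.
    by apply: eq_card => i; rewrite !inE eqb_id.
  by apply: eq_card => i; rewrite !inE eqbF_neg.
have N4 : (0 < N true false)%N.
  by apply/card_gt0P; exists ord0; rewrite inE /sd_ /s_ /= sd0E s0E.
have formB (c : 'rV[R]_m.+2) :
    inner t (c *m B0) (c *m B0) = \sum_i (-1) ^+ s_ i * c 0 i ^+ 2.
  by rewrite inner_mulmx B0B0 sign_mx_form.
(* If all basis vectors of the kernel were time-like, no vector of the kernel could have positive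
   square norm. *)
have N5 : (0 < N false false)%N.
  rewrite lt0n; apply/eqP => N0.
  have N0' i : ~~ sd_ i -> s_ i.
    move=> sdi; apply: contraT => si; have := card0_eq N0 i.
    by rewrite inE xpair_eqE (negbTE sdi) (negbTE si) !eqxx.
  move: x1x1; pose c := x1 *m invmx B0; have x1E : x1 = c *m B0 by rewrite mulmxKV.
  rewrite x1E formB; apply/negP; rewrite -leNgt -oppr_ge0 -sumrN.
  apply: sumr_ge0 => i _; have [sdi|/N0' ->] := boolP (sd_ i); last first.
    by rewrite expr1 mulN1r opprK sqr_ge0.
  suff -> : c 0 i = 0 by rewrite expr0n mulr0 oppr0.
  have : c *m diag_mx (\row_i (sd_ i)%:R) = 0.
    apply: (can_inj (mulmxK uB0)); rewrite mul0mx -mulmxA -B0S mulmxA -x1E.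
    by rewrite x1S.
  move/rowP/(_ i); rewrite mul_mx_diag !mxE sdi mulr1 => ->.
  by [].
pose l := N false true.
have [lk lt_ tl] : [/\ (l <= k)%N, (l <= t)%N & (t - l <= m - k)%N].
  by have := N1 true; have := N2 true; rewrite cs csd /l; split; lia.
pose sd0 (i : 'I_m.+2) := ~~ ((i < l)%N || (t <= i < t + k - l + 1)%N).
pose s0 (i : 'I_m.+2) := (i < t)%N.
have [x|p pE] := @matching_perm m.+2 _ (fun i => (sd_ i, s_ i)) (fun i => (sd0 i, s0 i)).
  have := N1 true; have := N2 true; rewrite cs csd => N1t N2t.
  case: x => [[] []].
  - rewrite (@card_ord_interval _ l t [pred i | (sd0 i, s0 i) == (true, true)]).
    + by rewrite -/(N true true) /l; lia.
    + by apply/andP; split; lia.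
    + by move=> i; rewrite inE xpair_eqE /sd0 /s0 !eqb_id; lia.
  - rewrite (@card_ord_interval _ (t + k - l + 1) m.+2 [pred i | (sd0 i, s0 i) == (true, false)]).
    + by rewrite -/(N true false) /l; lia.
    + by apply/andP; split; lia.
    + by move=> i; have := ltn_ord i; rewrite inE xpair_eqE /sd0 /s0 eqb_id eqbF_neg; lia.
  - rewrite (@card_ord_interval _ 0 l [pred i | (sd0 i, s0 i) == (false, true)]).
    + by rewrite -/(N false true) /l; lia.
    + by apply/andP; split; lia.
    + by move=> i; rewrite inE xpair_eqE /sd0 /s0 eqb_id eqbF_neg; lia.
  - rewrite (@card_ord_interval _ t (t + k - l + 1) [pred i | (sd0 i, s0 i) == (false, false)]).
    + by rewrite -/(N false false) /l; lia.
    + by apply/andP; split; lia.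
    + by move=> i; rewrite inE xpair_eqE /sd0 /s0 !eqbF_neg; lia.
pose B : 'M[R]_(m.+2) := \matrix_i b (p i).
have BB : B *m gram t *m B^T = gram t.
  apply/matrixP => i j.
  have -> : (B *m gram t *m B^T) i j = (B0 *m gram t *m B0^T) (p i) (p j).
    rewrite -!mulmxA [LHS]mxE [RHS]mxE; apply: eq_bigr => k' _; congr (_ * _); rewrite ?mxE//.
    by apply: eq_bigr => k'' _; rewrite !mxE.
  have [_ sE] := pE i.
  by rewrite B0B0 !mxE sE (inj_eq perm_inj).
have uB : B \in unitmx.
  have := mulmx1_unit (@gramK R m.+2 t); rewrite -{1}BB => -[+ _].
  by rewrite -mulmxA unitmx_mul => /andP[].
have BS : B *m S = diag_mx (\row_i (sd0 i)%:R) *m B.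
  apply/row_matrixP => i; rewrite !row_mul rowK bS// row_diag_mx -scalemxAl -rowE.
  by have [sE _] := pE i; rewrite mxE rowK -sE.
(* With this isometry [y] is the row of coordinates of [x] in the reordered basis. *)
exists l, (invmx B); split.
  split=> //; rewrite -{1}BB trmx_inv !mulmxA mulVmx// mul1mx mulmxK// unitmx_tr//.
move=> x y; have xE : x = y *m B by rewrite /y mulmxKV.
clearbody y.
have formS (f : 'I_m.+2 -> bool) :
    inner t (y *m diag_mx (\row_i (f i)%:R) *m B) (y *m diag_mx (\row_i (f i)%:R) *m B) =
    - (\sum_(i < m.+2 | f i && (i < t)%N) y 0 i ^+ 2)
    + \sum_(i < m.+2 | f i && (t <= i)%N) y 0 i ^+ 2.
  rewrite inner_mulmx BB gE sign_mx_form.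
  rewrite (bigID (fun i : 'I_m.+2 => (i < t)%N)) /= -sumrN; congr (_ + _).
    rewrite [RHS]big_mkcond [LHS]big_mkcond; apply: eq_bigr => i _.
    rewrite mul_mx_diag !mxE; case: (i < t)%N; rewrite ?andbF//.
    by case: (f i); rewrite ?mulr1 ?mulr0 ?mulN1r// expr0n oppr0.
  rewrite [RHS]big_mkcond [LHS]big_mkcond; apply: eq_bigr => i _.
  rewrite mul_mx_diag !mxE [(t <= i)%N]leqNgt; case: (i < t)%N; rewrite ?andbF//= andbT.
  by case: (f i); rewrite ?mulr1 ?mulr0 ?mul1r// expr0n.
have xS : x *m S = y *m diag_mx (\row_i (sd0 i)%:R) *m B.
  by rewrite xE -mulmxA BS mulmxA.
have xS' : x - x *m S = y *m diag_mx (\row_i (~~ sd0 i)%:R) *m B.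
  rewrite xS {1}xE -mulmxBl; congr (_ *m _); apply/rowP => i.
  by rewrite !mul_mx_diag !mxE; case: (sd0 i); rewrite ?mulr1 ?mulr0 ?subrr ?subr0.
split.
- rewrite xS' formS; congr (- _ + _); apply: eq_bigl => i; rewrite /sd0; lia.
- rewrite xS formS; congr (- _ + _); apply: eq_bigl => i; rewrite /sd0; lia.
(* For [k = m] the image of [S] is a line; its only basis vector is [b0], which therefore occupies
   the last position. *)
- move=> kmE; have pmax : p ord_max = ord0.
    have [sdE sE] := pE ord_max.
    have sd1 : sd_ (p ord_max) by rewrite sdE /sd0 /=; lia.
    have : (#|[pred i | sd_ i == true]| <= 1)%N by rewrite csd kmE subnn.
    move=> /card_le1_eqP; apply; rewrite inE ?sd1// /sd_ /= sd0E//.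
  have -> : b0 = delta_mx 0 ord_max *m B by rewrite -rowE rowK pmax /= b0E.
  rewrite xE inner_mulmx BB trmx_delta -colE mxE mul_mx_diag !mxE /=.
  by have [_] := pE ord_max; rewrite pmax /s_ /s0 /= s0E => <-; rewrite mulr1.
Qed.

End TorusFrame.

(** * Directional derivatives *)

(* [dder v f] is ['D_v f] behind an opaque proof: comparing two different
   directional derivatives up to conversion would otherwise unfold limits. *)
Section SealedDerivative.
Context {R : realType}.

Lemma dder_sig (V W : normedModType R) :
  {D : V -> (V -> W) -> V -> W | D = fun v f u => 'D_v f u}.
Proof. by exists (fun v f u => 'D_v f u). Qed.

Definition dder {V W : normedModType R} : V -> (V -> W) -> V -> W :=
  sval (dder_sig V W).

Context {V W : normedModType R}.

Lemma dderE v (f : V -> W) u : dder v f u = 'D_v f u.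
Proof. by rewrite /dder (svalP (dder_sig V W)). Qed.

Lemma dder_fun v (f : V -> W) : (fun u => 'D_v f u) = dder v f.
Proof. by apply/funext => u; rewrite dderE. Qed.

Lemma smooth_dder (O : set V) (f : V -> W) v :
  smooth_on O f -> smooth_on O (dder v f).
Proof. by rewrite -dder_fun; exact: smooth_derive. Qed.

Lemma differentiable_dder (O : set V) (f : V -> W) u v :
  smooth_on O f -> O u -> differentiable (dder v f) u.
Proof. by move=> sf Ou; exact: smooth_differentiable (smooth_dder v sf) Ou. Qed.

Lemma dder_eq_on (O : set V) (f g : V -> W) u v :
  open O -> O u -> (forall y, O y -> f y = g y) -> dder v f u = dder v g u.
Proof. by rewrite !dderE; exact: derive_eq_on. Qed.

Lemma dder_cst (k : W) (u v : V) : dder v (fun=> k) u = 0.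
Proof. by rewrite dderE; exact: derive_cst. Qed.

Lemma dder_dirD (f : V -> W) u v w : differentiable f u ->
  dder (v + w) f u = dder v f u + dder w f u.
Proof. by move=> df; rewrite !dderE !deriveE// linearD. Qed.

Lemma dder_dirZ (f : V -> W) u a v : differentiable f u ->
  dder (a *: v) f u = a *: dder v f u.
Proof. by move=> df; rewrite !dderE !deriveE// linearZ. Qed.

Lemma dder_dir0 (f : V -> W) u : dder 0 f u = 0.
Proof. by rewrite dderE derive0. Qed.

Lemma dder_dirN (f : V -> W) u v : differentiable f u ->
  dder (- v) f u = - dder v f u.
Proof. by move=> df; rewrite -scaleN1r dder_dirZ// scaleN1r. Qed.

Lemma dder_dir_sum (I : Type) (s : seq I) (F : I -> V) (f : V -> W) u :
  differentiable f u ->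
  dder (\sum_(i <- s) F i) f u = \sum_(i <- s) dder (F i) f u.
Proof.
move=> df; rewrite dderE deriveE// linear_sum.
by apply: eq_bigr => i _; rewrite dderE deriveE.
Qed.

Lemma dder_sum n (h : 'I_n -> V -> W) u v :
  (forall i, differentiable (h i) u) ->
  dder v (fun y => \sum_i h i y) u = \sum_i dder v (h i) u.
Proof.
by move=> dh; rewrite dderE derive_sumE//; apply: eq_bigr => i _; rewrite dderE.
Qed.

End SealedDerivative.

Section SealedMatrix.
Context {R : realType} {V : normedModType R}.

Lemma dder_entry m n (f : V -> 'M[R]_(m, n)) u v i j : differentiable f u ->
  dder v (fun y => f y i j) u = dder v f u i j.
Proof. by move=> df; rewrite !dderE derive_coord. Qed.

Lemma dder_mulmx m n p (f : V -> 'M[R]_(m, n)) (g : V -> 'M[R]_(n, p)) u v :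
  differentiable f u -> differentiable g u ->
  dder v (fun y => f y *m g y) u = dder v f u *m g u + f u *m dder v g u.
Proof. by move=> df dg; rewrite !dderE derive_mulmx. Qed.

Lemma dder_scale m n (a : V -> R) (f : V -> 'M[R]_(m, n)) u v :
  differentiable a u -> differentiable f u ->
  dder v (fun y => a y *: f y) u = dder v a u *: f u + a u *: dder v f u.
Proof. by move=> da df; rewrite !dderE derive_scale. Qed.

Lemma dderZ m n a (f : V -> 'M[R]_(m, n)) u v : differentiable f u ->
  dder v (fun y => a *: f y) u = a *: dder v f u.
Proof. by move=> df; rewrite dder_scale// dder_cst scale0r add0r. Qed.

Lemma dder_mulr_cst (a : R) (g : V -> R) u v : differentiable g u ->
  dder v (fun y => a * g y) u = a * dder v g u.
Proof.
move=> dg; rewrite !dderE -[RHS]/(a *: _) -deriveZ//; exact/diff_derivable.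
Qed.

Lemma dder_inner d t (f g : V -> 'rV[R]_d) u v :
  differentiable f u -> differentiable g u ->
  dder v (fun y => inner t (f y) (g y)) u =
  inner t (dder v f u) (g u) + inner t (f u) (dder v g u).
Proof. by move=> df dg; rewrite !dderE derive_inner. Qed.

Lemma dder_inner_cst d t (O : set V) (f g : V -> 'rV[R]_d) k u v :
  open O -> O u -> differentiable f u -> differentiable g u ->
  (forall y, O y -> inner t (f y) (g y) = k) ->
  inner t (dder v f u) (g u) = - inner t (f u) (dder v g u).
Proof.
move=> oO Ou df dg fg; apply/eqP; rewrite -addr_eq0 -dder_inner//; apply/eqP.
by rewrite (dder_eq_on (g := fun=> k) _ oO Ou)// dder_cst.
Qed.

Lemma dder_schwarz d (O : set V) (f : V -> 'rV[R]_d) u v w :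
  open O -> O u -> smooth_on O f -> dder w (dder v f) u = dder v (dder w f) u.
Proof. by move=> oO Ou sf; rewrite !dderE -!dder_fun; exact: schwarz oO Ou sf. Qed.

Lemma dder_lincomb d (O : set V) (f g : V -> 'rV[R]_d) a u v :
  smooth_on O f -> smooth_on O g -> O u ->
  dder v (fun y => f y + a *: g y) u = dder v f u + a *: dder v g u.
Proof. by move=> sf sg Ou; rewrite !dderE (derive_lincomb a v sf sg). Qed.

Lemma dder_constant m n (f : V -> 'M[R]_(m, n)) x r :
  (forall y, ball x r y -> differentiable f y) ->
  (forall y, ball x r y -> forall v, dder v f y = 0) ->
  forall y, ball x r y -> f y = f x.
Proof.
by move=> df f0; apply: constant_mx_on_ball => // y xy v; rewrite -dderE f0.
Qed.

End SealedMatrix.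

Section SealedDirections.
Context {R : realType} {m d : nat} (O : set 'rV[R]_m) (f : 'rV[R]_m -> 'rV[R]_d).
Hypotheses (oO : open O) (sf : smooth_on O f).
Implicit Types (X : 'rV[R]_m -> 'rV[R]_m).

Lemma dder_jacobian u v : O u -> dder v f u = v *m jacobian f u.
Proof. by move=> Ou; rewrite dderE deriveEjacobian//; exact: smooth_differentiable sf Ou. Qed.

Lemma differentiable_dder_dir X u : O u -> differentiable X u ->
  differentiable (fun y => dder (X y) f y) u.
Proof.
move=> Ou dX; have -> : (fun y => dder (X y) f y) = (fun y => 'D_(X y) f y).
  by apply/funext => y; rewrite dderE.
exact: (differentiable_dir oO sf).
Qed.

Lemma dder_dir X u v : O u -> differentiable X u ->
  dder v (fun y => dder (X y) f y) u =
  dder (dder v X u) f u + dder v (dder (X u) f) u.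
Proof.
move=> Ou dX; have -> : (fun y => dder (X y) f y) = (fun y => 'D_(X y) f y).
  by apply/funext => y; rewrite dderE.
by rewrite !dderE -dder_fun; exact: (derive_dir oO sf).
Qed.

End SealedDirections.

(** * Hypersurfaces *)

Lemma bool_mulr0 (R : pzSemiRingType) (b : bool) (x : R) :
  (b -> x = 0) -> b%:R * x = 0.
Proof. by case: b => [/(_ isT)->|_]; rewrite ?mulr0 ?mul0r. Qed.

Lemma natr_true (R : pzSemiRingType) (b : bool) : b -> b%:R = 1 :> R.
Proof. by move=> ->. Qed.

(** * Structure equations of a hypersurface patch *)

Section Patch.
Context {R : realType} (c0 : bool) (t m : nat).
Context (Phi : 'rV[R]_m -> 'rV[R]_(c0 + m.+1)) (O : set 'rV[R]_m).
Context (eps : R) (eta : 'rV[R]_m -> 'rV[R]_(c0 + m.+1)).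

Record hypersurface_patch : Prop := HypersurfacePatch {
  patch_open : open O;
  patch_smooth : smooth_on O Phi;
  patch_sphere : forall u, O u -> c0 -> inner t (Phi u) (Phi u) = 1;
  patch_metric : forall u, O u -> metric t Phi u \in unitmx;
  patch_normal : unit_normal t Phi O eps eta }.

Hypothesis HP : hypersurface_patch.
Let oO := patch_open HP.
Let sPhi := patch_smooth HP.

Lemma patch_smooth_normal : smooth_on O eta.
Proof. by have [] := patch_normal HP. Qed.
Let seta := patch_smooth_normal.

Let dPhi u : O u -> differentiable Phi u.
Proof. exact: smooth_differentiable. Qed.
Let deta u : O u -> differentiable eta u.
Proof. exact: smooth_differentiable. Qed.
Let ddPhi u v : O u -> differentiable (dder v Phi) u.
Proof. exact: differentiable_dder. Qed.
Let ddeta u v : O u -> differentiable (dder v eta) u.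
Proof. exact: differentiable_dder. Qed.

Lemma patch_eps2 : eps * eps = 1.
Proof. by have [[->|->] _ _] := patch_normal HP; rewrite ?mulr1 ?mulrNN ?mulr1. Qed.

Lemma patch_eps_neq0 : eps != 0.
Proof. by apply: contra_eq_neq patch_eps2 => ->; rewrite mulr0 eq_sym oner_eq0. Qed.

Lemma normal_norm u : O u -> inner t (eta u) (eta u) = eps.
Proof. by move=> Ou; have [_ _ /(_ _ Ou)[]] := patch_normal HP. Qed.

Lemma dPhi_normal u v : O u -> inner t (dder v Phi u) (eta u) = 0.
Proof. by move=> Ou; have [_ _ /(_ _ Ou)[_ h _]] := patch_normal HP; rewrite dderE h. Qed.

Lemma position_normal u : O u -> c0 -> inner t (Phi u) (eta u) = 0.
Proof. by move=> Ou; have [_ _ /(_ _ Ou)[h _ _]] := patch_normal HP; exact: h. Qed.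

Lemma dPhi_position u v : O u -> c0 -> inner t (dder v Phi u) (Phi u) = 0.
Proof.
move=> Ou c.
have := dder_inner_cst v oO Ou (dPhi Ou) (dPhi Ou) (fun y Oy => patch_sphere HP Oy c).
by rewrite [in RHS]innerC; lra.
Qed.

Lemma deta_normal u v : O u -> inner t (dder v eta u) (eta u) = 0.
Proof.
move=> Ou; have := dder_inner_cst v oO Ou (deta Ou) (deta Ou) normal_norm.
by rewrite [in RHS]innerC; lra.
Qed.

Lemma deta_position u v : O u -> c0 -> inner t (dder v eta u) (Phi u) = 0.
Proof.
move=> Ou c.
have := dder_inner_cst v oO Ou (dPhi Ou) (deta Ou) (fun y Oy => position_normal Oy c).
by rewrite dPhi_normal// [in RHS]innerC => /eqP; rewrite eq_sym oppr_eq0 => /eqP.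
Qed.

Lemma deta_dPhi u v w : O u ->
  inner t (dder v eta u) (dder w Phi u) = - inner t (eta u) (dder v (dder w Phi) u).
Proof.
move=> Ou; apply: (dder_inner_cst (k := 0) v oO Ou (deta Ou) (ddPhi w Ou)).
by move=> y Oy; rewrite innerC dPhi_normal.
Qed.

(** Both sides are, up to the same sign, the normal component of a mixed second derivative of
    [Phi]. *)
Lemma deta_dPhiC u v w : O u ->
  inner t (dder v eta u) (dder w Phi u) = inner t (dder w eta u) (dder v Phi u).
Proof. by move=> Ou; rewrite !deta_dPhi// (dder_schwarz v w oO Ou sPhi). Qed.

Lemma dPhiE u v : O u -> dder v Phi u = v *m jacobian Phi u.
Proof. exact: dder_jacobian. Qed.

Lemma detaE u v : O u -> dder v eta u = v *m jacobian eta u.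
Proof. exact: dder_jacobian. Qed.

Lemma metricE u : O u ->
  metric t Phi u = jacobian Phi u *m gram t *m (jacobian Phi u)^T.
Proof.
move=> Ou; apply/matrixP => i j.
by rewrite mxE -!dderE !dPhiE// inner_mulmx -rowE trmx_delta -colE !mxE.
Qed.

(** Vector identities on a patch are proved by testing them against this moving basis: the position
    (on the sphere), the normal and the tangent vectors. *)
Lemma ambient_eq0 u W : O u -> (c0 -> inner t W (Phi u) = 0) ->
  inner t W (eta u) = 0 -> (forall v, inner t W (dder v Phi u) = 0) -> W = 0.
Proof.
move=> Ou WP We Wd; apply: (adapted_basis_eq0 (t := t) (p := Phi u) (n := eta u)
   (J := jacobian Phi u)) => //.
- exact: patch_sphere.
- by rewrite normal_norm// patch_eps_neq0.
- exact: position_normal.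
- by move=> v c; rewrite -dPhiE// innerC dPhi_position.
- by move=> v; rewrite -dPhiE// innerC dPhi_normal.
- by rewrite -metricE// patch_metric.
- by move=> v; rewrite -dPhiE.
Qed.

Lemma tangentP u W : O u -> (c0 -> inner t W (Phi u) = 0) ->
  inner t W (eta u) = 0 -> exists x, W = dder x Phi u.
Proof.
move=> Ou WP We; set J := jacobian Phi u.
(* Coordinates of the tangential projection of [W]: its products with the coordinate vectors, raised
   by the inverse metric. *)
exists (W *m gram t *m J^T *m invmx (metric t Phi u)).
apply/eqP; rewrite -subr_eq0; apply/eqP/(ambient_eq0 Ou).
- by move=> c; rewrite innerBl WP// dPhi_position ?subr0.
- by rewrite innerBl We dPhi_normal ?subr0.
- move=> v; rewrite innerBl !dPhiE// inner_mulmx -metricE//.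
  by rewrite mulmxKV ?patch_metric// inner_gram trmx_mul !mulmxA subrr.
Qed.

Lemma jacobian_free u : O u -> forall v, dder v Phi u = 0 -> v = 0.
Proof.
move=> Ou v v0; rewrite -[v](mulmxK (patch_metric HP Ou)) metricE//.
by rewrite !mulmxA -dPhiE// v0 !mul0mx.
Qed.

Lemma cov_eta u X : O u -> cov t Phi X eta u = dder (X u) eta u.
Proof.
move=> Ou; rewrite /cov -dderE bool_mulr0 ?scale0r ?subr0// => c.
exact: deta_position.
Qed.

Local Notation A := (shape_operator t Phi eta).

(** The pseudo-inverse in [shape_operator] acts as an inverse because every derivative of [eta] is
    tangent, hence in the row space of the Jacobian of [Phi]. *)
Lemma shapeE u v : O u -> dder v eta u = - dder (v *m A u) Phi u.
Proof.
move=> Ou; rewrite dPhiE// -mulmxA /shape_operator.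
have -> : (\matrix_(i < m) cov t Phi (fun=> 'e_i) eta u) = jacobian eta u.
  by apply/row_matrixP => i; rewrite rowK cov_eta// detaE// -rowE.
rewrite (detaE _ Ou) mulNmx mulNmx mulmxN opprK mulmxKpV; first by [].
apply/row_subP => i; rewrite rowE -detaE//.
have [c||x ->] := @tangentP u (dder ('e_i) eta u) Ou.
- by rewrite deta_position.
- by rewrite deta_normal.
- by rewrite dPhiE// submxMl.
Qed.

Lemma shape_adjoint u v w : O u ->
  inner t (dder (v *m A u) Phi u) (dder w Phi u) =
  inner t (dder v Phi u) (dder (w *m A u) Phi u).
Proof.
move=> Ou; have := deta_dPhiC v w Ou.
by rewrite !shapeE// !innerNl [X in _ = - X]innerC => /oppr_inj.
Qed.

Lemma shape_metric u : O u -> A u *m metric t Phi u = metric t Phi u *m (A u)^T.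
Proof.
move=> Ou; apply/eqP; rewrite -subr_eq0; apply/eqP/bilin_eq0 => v w.
rewrite mulmxBr mulmxBl mxE [X in _ + X]mxE.
have := shape_adjoint v w Ou; rewrite !dPhiE// !inner_mulmx -metricE//.
by rewrite !trmx_mul !mulmxA => ->; rewrite subrr.
Qed.

Lemma pushE X : push Phi X = fun y => dder (X y) Phi y.
Proof. by apply/funext => y; rewrite dderE. Qed.

Let H u i j := dder 'e_i (dder 'e_j Phi) u.

Lemma dmetric u i j l : O u -> dder 'e_i (metric t Phi) u j l =
  inner t (H u i j) (dder 'e_l Phi u) + inner t (dder 'e_j Phi u) (H u i l).
Proof.
move=> Ou.
have gE p q : (fun y => metric t Phi y p q) =
    fun y => inner t (dder 'e_p Phi y) (dder 'e_q Phi y).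
  by apply/funext => y; rewrite mxE !dderE.
have dg : differentiable (metric t Phi) u.
  apply: differentiable_mx => p q; rewrite gE.
  by apply: differentiable_inner; exact: (ddPhi _ Ou).
rewrite -dder_entry// gE dder_inner//; exact: (ddPhi _ Ou).
Qed.

(** In the combination of derivatives of the metric everything cancels but twice the product of
    [H u i j] with the [l]-th coordinate vector. *)
Lemma christoffelE u k i j : O u -> christoffel t Phi u k i j =
  \sum_l invmx (metric t Phi u) k l * inner t (H u i j) (dder 'e_l Phi u).
Proof.
move=> Ou; rewrite /christoffel mulr_sumr; apply: eq_bigr => l _.
have HC p q : H u p q = H u q p by exact: dder_schwarz oO Ou sPhi.
rewrite mulrCA -!dderE !dmetric//; congr (_ * _); rewrite (HC j i) (HC l i) (HC l j).
by rewrite (innerC _ (dder 'e_j Phi u)); field.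
Qed.

Lemma metric_dual u w l : O u ->
  \sum_k invmx (metric t Phi u) k l * inner t (dder 'e_k Phi u) (dder w Phi u) = w 0 l.
Proof.
move=> Ou; have ug := patch_metric HP Ou.
have gT : (invmx (metric t Phi u))^T = invmx (metric t Phi u).
  by rewrite trmx_inv metricE// !trmx_mul trmxK tr_gram mulmxA.
have -> : w 0 l = ((invmx (metric t Phi u))^T *m (metric t Phi u *m w^T)) l 0.
  by rewrite gT mulKmx// mxE.
rewrite [RHS]mxE; apply: eq_bigr => k _; rewrite [in RHS]mxE; congr (_ * _).
by rewrite !dPhiE// inner_mulmx -metricE// -mulmxA -rowE [LHS]mxE.
Qed.

(** Expanding in the coordinate basis reduces the claim to [christoffelE]; the inverse metric is
    contracted by [metric_dual]. This links the intrinsic connection to the flat derivative of the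
    ambient space. *)
Lemma levi_civitaE u (X Y : 'rV[R]_m -> 'rV[R]_m) w : O u -> differentiable Y u ->
  inner t (dder (X u) (push Phi Y) u) (dder w Phi u) =
  inner t (dder (levi_civita t Phi X Y u) Phi u) (dder w Phi u).
Proof.
move=> Ou dY; rewrite pushE (dder_dir oO sPhi)// /levi_civita -dderE dder_dirD//; last exact: (dPhi Ou).
rewrite !innerDl; congr (_ + _).
have -> : dder (X u) (dder (Y u) Phi) u = \sum_i \sum_j (X u 0 i * Y u 0 j) *: H u i j.
  rewrite {1}[X u]row_sum_delta dder_dir_sum; last exact: (ddPhi _ Ou).
  apply: eq_bigr => i _; rewrite dder_dirZ; last exact: (ddPhi _ Ou).
  rewrite (dder_eq_on (g := fun y => \sum_j Y u 0 j *: dder 'e_j Phi y) _ oO Ou); last first.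
    move=> y Oy; rewrite {1}[Y u]row_sum_delta dder_dir_sum; last exact: (dPhi Oy).
    by apply: eq_bigr => j _; rewrite dder_dirZ//; exact: (dPhi Oy).
  rewrite dder_sum; last by move=> j; apply: differentiableZ; exact: (ddPhi _ Ou).
  rewrite scaler_sumr; apply: eq_bigr => j _; rewrite dderZ ?scalerA//.
  exact: (ddPhi _ Ou).
set r := \row_k _.
rewrite {1}[r]row_sum_delta dder_dir_sum; last exact: (dPhi Ou).
rewrite [RHS]inner_suml.
under [RHS]eq_bigr => k _.
  rewrite dder_dirZ; last exact: (dPhi Ou).
  rewrite innerZl mxE mulr_suml.
  under eq_bigr => i _.
    rewrite mulr_suml.
    under eq_bigr => j _ do rewrite christoffelE// !mulr_suml.
    over.
  over.
rewrite [RHS]exchange_big inner_suml; apply: eq_bigr => i _ /=.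
rewrite [RHS]exchange_big inner_suml; apply: eq_bigr => j _ /=.
rewrite [RHS]exchange_big innerZl.
rewrite {1}[w]row_sum_delta dder_dir_sum; last exact: (dPhi Ou).
rewrite inner_sumr mulr_sumr; apply: eq_bigr => l _ /=.
rewrite dder_dirZ; last exact: (dPhi Ou).
rewrite innerZr -(metric_dual w l Ou) mulr_suml mulr_sumr; apply: eq_bigr => k _; ring.
Qed.

(** Gauss formula. By [levi_civitaE] the difference has no tangential part, [cov] has removed the
    part along [Phi], and the normal coefficient comes from differentiating the orthogonality of
    [push Phi Y] and [eta]. *)
Lemma second_fundamental_form u (X Y : 'rV[R]_m -> 'rV[R]_m) : O u ->
  differentiable Y u ->
  cov t Phi X (push Phi Y) u - push Phi (levi_civita t Phi X Y) u =
  (- eps * inner t (dder (Y u) Phi u) (dder (X u) eta u)) *: eta u.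
Proof.
move=> Ou dY; have dp : differentiable (push Phi Y) u.
  by rewrite pushE; exact: (differentiable_dder_dir oO sPhi).
have De : inner t (dder (X u) (push Phi Y) u) (eta u) =
    - inner t (dder (Y u) Phi u) (dder (X u) eta u).
  rewrite (dder_inner_cst (k := 0) (X u) oO Ou dp (deta Ou)); first by rewrite pushE.
  by move=> y Oy; rewrite pushE dPhi_normal.
rewrite [push Phi (levi_civita t Phi X Y)]pushE /cov -dderE.
apply/eqP; rewrite -subr_eq0; apply/eqP/(ambient_eq0 Ou).
- move=> c; rewrite !innerBl !innerZl dPhi_position// patch_sphere//.
  by rewrite (innerC _ (eta u)) position_normal// natr_true// mul1r mulr1 mulr0 subrr !subr0.
- rewrite !innerBl !innerZl dPhi_normal// normal_norm// De.
  have -> : c0%:R * inner t (dder (X u) (push Phi Y) u) (Phi u) * inner t (Phi u) (eta u) = 0.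
    by rewrite mulrAC bool_mulr0 ?mul0r// => c; exact: position_normal.
  transitivity ((eps * eps - 1) * inner t (dder (Y u) Phi u) (dder (X u) eta u)); first by ring.
  by rewrite patch_eps2 subrr mul0r.
- move=> v; rewrite !innerBl !innerZl levi_civitaE//.
  rewrite (innerC _ (eta u)) dPhi_normal// mulr0 subr0.
  have -> : c0%:R * inner t (dder (X u) (push Phi Y) u) (Phi u) * inner t (Phi u) (dder v Phi u) = 0.
    by rewrite mulrAC bool_mulr0 ?mul0r// => c; rewrite innerC dPhi_position.
  by rewrite subr0 subrr.
Qed.

(** * Traces in an orthonormal frame, rough Laplacian and polytension field *)

Section WithFrame.
Context (epsi : 'I_m -> R) (e : 'I_m -> 'rV[R]_m -> 'rV[R]_m).
Hypothesis He : orthonormal_frame t Phi O epsi e.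

Let f i u := dder (e i u) Phi u.
Let Z i u := dder (e i u) eta u.

Lemma frame_eps2 i : epsi i * epsi i = 1.
Proof. by have [/(_ i)[->|->] _ _] := He; rewrite ?mulr1 ?mulrNN ?mulr1. Qed.

Lemma differentiable_frame i u : O u -> differentiable (e i) u.
Proof. by have [_ /(_ i) se _] := He; exact: smooth_differentiable. Qed.
Let de := differentiable_frame.

Lemma frame_inner u i j : O u -> inner t (f i u) (f j u) = epsi i *+ (i == j).
Proof. by move=> Ou; have [_ _ /(_ _ Ou)] := He; rewrite /f !dderE; apply. Qed.

Let df i u : O u -> differentiable (f i) u.
Proof. by move=> Ou; apply: (differentiable_dder_dir oO) => //; exact: (de _ Ou). Qed.
Let dZ i u : O u -> differentiable (Z i) u.
Proof. by move=> Ou; apply: (differentiable_dder_dir oO) => //; exact: (de _ Ou). Qed.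

Definition frame_mx u : 'M[R]_m := \matrix_i e i u.

Lemma frame_entry u (X : 'M[R]_m) i j :
  (frame_mx u *m X *m (frame_mx u)^T) i j = (e i u *m X *m (e j u)^T) 0 0.
Proof.
rewrite [LHS]mxE [RHS]mxE; apply: eq_bigr => k _; rewrite !mxE; congr (_ * _).
by apply: eq_bigr => l _; rewrite !mxE.
Qed.

Lemma frame_metric u : O u ->
  frame_mx u *m metric t Phi u *m (frame_mx u)^T = diag_mx (\row_i epsi i).
Proof.
move=> Ou; apply/matrixP => i j; rewrite frame_entry; have := frame_inner i j Ou.
by rewrite /f !dPhiE// inner_mulmx -metricE// !mxE.
Qed.

Lemma frame_diagK : diag_mx (\row_i epsi i) *m diag_mx (\row_i epsi i) = 1%:M.
Proof.
rewrite mulmx_diag -diag_const_mx; congr diag_mx; apply/rowP => i.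
by rewrite !mxE frame_eps2.
Qed.

Lemma frame_unit u : O u -> frame_mx u \in unitmx.
Proof.
move=> Ou; have := mulmx1_unit frame_diagK; rewrite -{1}(frame_metric Ou) => -[+ _].
by rewrite -mulmxA unitmx_mul => /andP[].
Qed.

Lemma invmx_metric u : O u -> invmx (metric t Phi u) =
  (frame_mx u)^T *m diag_mx (\row_i epsi i) *m frame_mx u.
Proof.
move=> Ou; have ug := patch_metric HP Ou; have uE := frame_unit Ou.
have gE : metric t Phi u *m (frame_mx u)^T =
    invmx (frame_mx u) *m diag_mx (\row_i epsi i).
  by rewrite -(frame_metric Ou) -!mulmxA mulKmx.
apply: (can_inj (mulKmx ug)); rewrite mulmxV// !mulmxA gE -(mulmxA (invmx _) (diag_mx _) (diag_mx _)).
by rewrite frame_diagK mulmx1 mulVmx.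
Qed.

(** By [invmx_metric] the inverse metric is the signed sum of the squares of the frame vectors,
    which turns a sum over the frame into a trace that does not involve the frame. *)
Lemma frame_trace u (X Y : 'M[R]_m) : O u ->
  \sum_i epsi i * inner t (dder (e i u *m X) Phi u) (dder (e i u *m Y) Phi u) =
  \tr (X *m metric t Phi u *m Y^T *m invmx (metric t Phi u)).
Proof.
move=> Ou; rewrite invmx_metric// mulmxA [RHS]mxtrace_mulC !mulmxA.
apply: eq_bigr => i _; rewrite mul_mx_diag mxE [(\row__ _) 0 i]mxE mulrC.
congr (_ * _); rewrite !dPhiE// inner_mulmx -metricE// trmx_mul.
have -> : frame_mx u *m X *m metric t Phi u *m Y^T *m (frame_mx u)^T =
  frame_mx u *m (X *m metric t Phi u *m Y^T) *m (frame_mx u)^T by rewrite !mulmxA.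
by rewrite frame_entry !mulmxA.
Qed.

Lemma frame_trace_shape u : O u ->
  \sum_i epsi i * inner t (f i u) (Z i u) = - \tr (A u).
Proof.
move=> Ou; rewrite -[A u in RHS](mulmxK (patch_metric HP Ou)).
have := @frame_trace u (A u) 1%:M Ou; rewrite trmx1 mulmx1 => <-.
rewrite -sumrN; apply: eq_bigr => i _; rewrite /Z shapeE// innerNr mulrN.
by rewrite mulmx1 innerC.
Qed.

Lemma frame_trace_shape2 u : O u ->
  \sum_i epsi i * inner t (Z i u) (Z i u) = \tr (A u *m A u).
Proof.
move=> Ou; have := @frame_trace u (A u) (A u) Ou.
rewrite -(mulmxA (A u)) -shape_metric// mulmxA mulmxK ?patch_metric// => <-.
by apply: eq_bigr => i _; rewrite /Z shapeE// innerNl innerNr opprK.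
Qed.

Lemma frame_expand u W : O u -> (c0 -> inner t W (Phi u) = 0) ->
  inner t W (eta u) = 0 -> W = \sum_i (epsi i * inner t W (f i u)) *: f i u.
Proof.
move=> Ou WP We; apply/eqP; rewrite -subr_eq0; apply/eqP/(ambient_eq0 Ou).
- move=> c; rewrite innerBl WP// inner_suml big1 ?subr0// => i _.
  by rewrite innerZl dPhi_position ?mulr0.
- rewrite innerBl We inner_suml big1 ?subr0// => i _.
  by rewrite innerZl dPhi_normal ?mulr0.
move=> v; have -> : v = \sum_j (v *m invmx (frame_mx u)) 0 j *: e j u.
  rewrite -{1}[v](mulmxKV (frame_unit Ou)) mulmx_sum_row.
  by apply: eq_bigr => j _; rewrite rowK.
rewrite dder_dir_sum ?inner_sumr; last exact: (dPhi Ou).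
rewrite big1// => j _; rewrite dder_dirZ ?innerZr; last exact: (dPhi Ou).
rewrite -/(f j u) innerBl inner_suml (bigD1 j)//= big1.
  rewrite addr0 innerZl frame_inner// eqxx mulr1n mulrAC frame_eps2 mul1r subrr.
  by rewrite mulr0.
by move=> i ij; rewrite innerZl frame_inner// (negbTE ij) mulr0.
Qed.

(* Differentiating the trace of the shape operator in the moving frame, the
   terms coming from the motion of the frame cancel: they pair a symmetric
   with a skew-symmetric matrix. *)
Lemma frame_codazzi u v T : O u -> (forall y, O y -> \tr (A y) = T) ->
  \sum_i epsi i * (inner t (f i u) (dder v (dder (e i u) eta) u) -
                   inner t (Z i u) (dder v (dder (e i u) Phi) u)) = 0.
Proof.
move=> Ou AT.
pose w i := dder v (e i) u.
have dfE i : dder v (f i) u = dder (w i) Phi u + dder v (dder (e i u) Phi) u.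
  by rewrite -(dder_dir oO sPhi) //; exact: (de _ Ou).
have dZE i : dder v (Z i) u = dder (w i) eta u + dder v (dder (e i u) eta) u.
  by rewrite -(dder_dir oO seta) //; exact: (de _ Ou).
have dT : \sum_i epsi i * (inner t (dder v (f i) u) (Z i u) +
                          inner t (f i u) (dder v (Z i) u)) = 0.
  have : dder v (fun y => \sum_i epsi i * inner t (f i y) (Z i y)) u = 0.
    by rewrite (dder_eq_on (g := fun=> - T) _ oO Ou) ?dder_cst// => y Oy; rewrite frame_trace_shape ?AT.
  have dfZ i : differentiable (fun y => inner t (f i y) (Z i y)) u.
    by apply: differentiable_inner; [exact: (df _ Ou)|exact: (dZ _ Ou)].
  rewrite dder_sum; last by move=> i; exact: differentiableM.
  move=> H0; rewrite -[RHS]H0; apply: eq_bigr => i _; rewrite dder_mulr_cst//.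
  by rewrite dder_inner//; [exact: (df _ Ou)|exact: (dZ _ Ou)].
have S0 : \sum_i epsi i * inner t (dder v (f i) u) (Z i u) = 0.
  pose h i j := inner t (Z i u) (f j u).
  pose k i j := inner t (dder v (f i) u) (f j u).
  have ZE i : Z i u = \sum_j (epsi j * h i j) *: f j u.
    by apply: frame_expand => //; [exact: deta_position|exact: deta_normal].
  have E : \sum_i epsi i * inner t (dder v (f i) u) (Z i u) =
      \sum_i \sum_j epsi i * epsi j * h i j * k i j.
    apply: eq_bigr => i _; rewrite {1}ZE inner_sumr mulr_sumr.
    by apply: eq_bigr => j _; rewrite innerZr !mulrA.
  have hC i j : h i j = h j i by exact: deta_dPhiC.
  have kC i j : k i j = - k j i.
    have := dder_inner_cst v oO Ou (@df i _ Ou) (@df j _ Ou)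
      (fun y Oy => frame_inner i j Oy).
    by rewrite [in RHS]innerC.
  suff : \sum_i \sum_j epsi i * epsi j * h i j * k i j =
      - \sum_i \sum_j epsi i * epsi j * h i j * k i j by rewrite E; lra.
  rewrite {1}exchange_big -sumrN; apply: eq_bigr => i _; rewrite -sumrN.
  by apply: eq_bigr => j _; rewrite (hC j i) (kC j i); ring.
transitivity (\sum_i epsi i * (inner t (dder v (f i) u) (Z i u) +
                               inner t (f i u) (dder v (Z i) u)) -
              2 * \sum_i epsi i * inner t (dder v (f i) u) (Z i u)); last first.
  by rewrite dT S0 mulr0 subrr.
rewrite mulr_sumr -sumrB.
apply: eq_bigr => i _; rewrite dfE dZE !innerDl !innerDr.
rewrite (innerC _ (dder v (dder (e i u) Phi) u)).
have -> : inner t (f i u) (dder (w i) eta u) = inner t (dder (w i) Phi u) (Z i u).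
  by rewrite innerC [RHS]innerC; exact: deta_dPhiC.
ring.
Qed.

Lemma tensionE u : O u ->
  tension t Phi epsi e u = (eps * \tr (A u)) *: eta u.
Proof.
move=> Ou; rewrite /tension.
under eq_bigr => i _ do rewrite (second_fundamental_form (e i) Ou (de i Ou)) scalerA.
rewrite -scaler_suml; congr (_ *: _).
rewrite -[\tr _]opprK -frame_trace_shape// mulrN mulr_sumr -sumrN.
by apply: eq_bigr => i _; rewrite /f /Z; ring.
Qed.

Lemma cov_scaled V k X y : O y -> (forall y, O y -> V y = k *: eta y) ->
  cov t Phi X V y = k *: dder (X y) eta y.
Proof.
move=> Oy VE; rewrite /cov -dderE (dder_eq_on (g := fun y => k *: eta y) _ oO Oy)//.
rewrite dderZ; last exact: (deta Oy).
rewrite bool_mulr0 ?scale0r ?subr0// => c.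
by rewrite innerZl deta_position ?mulr0.
Qed.

(** Three components are tested. The one along [Phi] is removed by [cov]. The normal one comes from
    differentiating [inner t (Z i y) (eta y) = 0], which produces the square norms of the [Z i] and
    so the trace of the squared shape operator. The tangential one is the sum that vanishes by
    [frame_codazzi]; there the constancy of the trace enters. *)
Lemma rough_laplacianE u V k T : O u -> (forall y, O y -> \tr (A y) = T) ->
  (forall y, O y -> V y = k *: eta y) ->
  rough_laplacian t Phi epsi e V u = (eps * \tr (A u *m A u) * k) *: eta u.
Proof.
move=> Ou AT VE.
have covV X y (Oy : O y) := cov_scaled X Oy VE.
have dcov i : dder (e i u) (cov t Phi (e i) V) u = k *: dder (e i u) (Z i) u.
  rewrite (dder_eq_on (g := fun y => k *: Z i y) _ oO Ou); last first.
    by move=> y Oy; rewrite covV.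
  by rewrite dderZ//; exact: (dZ _ Ou).
have Zeta i : inner t (dder (e i u) (Z i) u) (eta u) = - inner t (Z i u) (Z i u).
  apply: (dder_inner_cst (k := 0) _ oO Ou (dZ i Ou) (deta Ou)).
  by move=> y Oy; exact: deta_normal.
pose L i := levi_civita t Phi (e i) (e i) u.
have Zd i v : inner t (dder (e i u) (Z i) u) (dder v Phi u) =
    inner t (dder (L i) eta u) (dder v Phi u) +
    (inner t (f i u) (dder v (dder (e i u) eta) u) -
     inner t (Z i u) (dder v (dder (e i u) Phi) u)).
  have dZv : differentiable (fun y => inner t (Z i y) (dder v Phi y)) u.
    by apply: differentiable_inner; [exact: (dZ _ Ou)|exact: (ddPhi _ Ou)].
  have E1 : dder (e i u) (fun y => inner t (Z i y) (dder v Phi y)) u =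
      inner t (dder (e i u) (Z i) u) (dder v Phi u) +
      inner t (Z i u) (dder (e i u) (dder v Phi) u).
    by apply: dder_inner; [exact: (dZ _ Ou)|exact: (ddPhi _ Ou)].
  have E2 : dder (e i u) (fun y => inner t (Z i y) (dder v Phi y)) u =
      inner t (dder (e i u) (f i) u) (dder v eta u) +
      inner t (f i u) (dder (e i u) (dder v eta) u).
    rewrite -dder_inner; [|exact: (df _ Ou)|exact: (ddeta _ Ou)].
    apply: (dder_eq_on _ oO Ou) => y Oy.
    by rewrite [RHS]innerC; exact: deta_dPhiC.
  (* As [dder v eta u] is tangent, only the tangential part of the derivative of [f i] counts, that
     is the image of [L i] under the differential of [Phi]. *)
  have E3 : inner t (dder (e i u) (f i) u) (dder v eta u) =
      inner t (dder (L i) eta u) (dder v Phi u).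
    have := @levi_civitaE u (e i) (e i); rewrite pushE => LC.
    have [c||x xE] := @tangentP u (dder v eta u) Ou; [exact: deta_position|exact: deta_normal|].
    rewrite xE LC//; last exact: (de _ Ou).
    by rewrite -xE innerC [RHS]deta_dPhiC.
  rewrite (dder_schwarz v (e i u) oO Ou sPhi) in E1.
  rewrite (dder_schwarz v (e i u) oO Ou seta) in E2.
  by rewrite -E3; lra.
rewrite /rough_laplacian.
under eq_bigr => i _ do rewrite covV// -/(L i) {1}/cov -dderE dcov.
apply/eqP; rewrite -subr_eq0; apply/eqP/(ambient_eq0 Ou).
- move=> c; rewrite innerBl innerNl inner_suml innerZl (innerC _ (eta u)) position_normal// mulr0 subr0.
  rewrite big1 ?oppr0// => i _; rewrite innerZl !innerBl !innerZl deta_position//.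
  by rewrite patch_sphere// natr_true// mul1r mulr1 subrr mulr0 subr0 mulr0.
- rewrite innerBl innerNl inner_suml innerZl normal_norm//.
  rewrite (eq_bigr (fun i => - k * (epsi i * inner t (Z i u) (Z i u)))); last first.
    move=> i _; rewrite innerZl !innerBl !innerZl Zeta deta_normal//.
    have -> : c0%:R * (k * inner t (dder (e i u) (Z i) u) (Phi u)) * inner t (Phi u) (eta u) = 0.
      by rewrite mulrAC bool_mulr0 ?mul0r// => c; exact: position_normal.
    by ring.
  rewrite -mulr_sumr frame_trace_shape2//.
  transitivity ((1 - eps * eps) * (\tr (A u *m A u) * k)); first by ring.
  by rewrite patch_eps2 subrr mul0r.
- move=> v; rewrite innerBl innerNl inner_suml innerZl (innerC _ (eta u)) dPhi_normal// mulr0 subr0.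
  rewrite (eq_bigr (fun i => k * (epsi i * (inner t (f i u) (dder v (dder (e i u) eta) u) -
     inner t (Z i u) (dder v (dder (e i u) Phi) u))))); last first.
    move=> i _; rewrite innerZl !innerBl !innerZl Zd.
    have -> : c0%:R * (k * inner t (dder (e i u) (Z i) u) (Phi u)) * inner t (Phi u) (dder v Phi u) = 0.
      by rewrite mulrAC bool_mulr0 ?mul0r// => c; rewrite innerC dPhi_position.
    by ring.
  by rewrite -mulr_sumr (frame_codazzi v Ou AT) mulr0 oppr0.
Qed.

Lemma iter_laplacianE u T a n : O u -> (forall y, O y -> \tr (A y) = T) ->
  (forall y, O y -> \tr (A y *m A y) = a) ->
  iter n (rough_laplacian t Phi epsi e) (tension t Phi epsi e) u =
  ((eps * a) ^+ n * (eps * T)) *: eta u.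
Proof.
move=> + AT Aa; elim: n u => [|n IH] u Ou /=.
  by rewrite tensionE// AT// expr0 mul1r.
rewrite (@rough_laplacianE u _ ((eps * a) ^+ n * (eps * T)) T)//.
by rewrite Aa// exprS mulrA.
Qed.

Section CurvatureTerms.
Context (u : 'rV[R]_m) (Ou : O u).

Lemma frame_ricci k :
  \sum_i epsi i *: curvature t (k *: eta u) (push Phi (e i) u) (push Phi (e i) u) =
  (c0%:R * m%:R * k) *: eta u.
Proof.
rewrite (eq_bigr (fun=> (c0%:R * k) *: eta u)).
  by rewrite sumr_const card_ord -scaler_nat scalerA; congr (_ *: _); ring.
move=> i _; rewrite /curvature pushE innerZl (innerC _ (eta u)) dPhi_normal// mulr0.
rewrite scale0r subr0 -/(f i u) frame_inner// eqxx mulr1n !scalerA.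
congr (_ *: _); transitivity ((epsi i * epsi i) * (c0%:R * k)); first by ring.
by rewrite frame_eps2 mul1r.
Qed.

(** Since [eta] is orthogonal to the frame, only the products of [W i] with the frame survive, and
    they sum up to the trace of the shape operator. With the normal in the other slot the sign
    changes, so that the two sums subtracted in the polytension reinforce each other. *)
Lemma frame_curvature_l k k' (W : 'I_m -> 'rV[R]_(c0 + m.+1)) :
  (forall i, W i = k *: Z i u) ->
  \sum_i epsi i *: curvature t (W i) (k' *: eta u) (push Phi (e i) u) =
  (c0%:R * (k * k') * \tr (A u)) *: eta u.
Proof.
move=> WE; rewrite -[\tr _]opprK -frame_trace_shape// mulrN -mulNr mulr_sumr scaler_suml.
apply: eq_bigr => i _; rewrite /curvature pushE WE !innerZl (innerC _ (eta u)) dPhi_normal// mulr0.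
rewrite scale0r sub0r -scaleNr !scalerA; congr (_ *: _).
by rewrite (innerC _ (Z i u)) /f; ring.
Qed.

Lemma frame_curvature_r k k' (W : 'I_m -> 'rV[R]_(c0 + m.+1)) :
  (forall i, W i = k' *: Z i u) ->
  \sum_i epsi i *: curvature t (k *: eta u) (W i) (push Phi (e i) u) =
  - ((c0%:R * (k * k') * \tr (A u)) *: eta u).
Proof.
move=> WE; rewrite -scaleNr -[\tr _]opprK -frame_trace_shape// mulrN opprK mulr_sumr scaler_suml.
apply: eq_bigr => i _; rewrite /curvature pushE WE !innerZl (innerC _ (eta u)) dPhi_normal// mulr0.
rewrite scale0r subr0 !scalerA; congr (_ *: _).
by rewrite (innerC _ (Z i u)) /f; ring.
Qed.

End CurvatureTerms.

Section Polytension.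
Context (u : 'rV[R]_m) (T a : R) (Ou : O u).
Hypotheses (AT : forall y, O y -> \tr (A y) = T)
  (Aa : forall y, O y -> \tr (A y *m A y) = a).

Let Lap n := iter n (rough_laplacian t Phi epsi e) (tension t Phi epsi e).
Let k n := (eps * a) ^+ n * (eps * T).

Let LapE n y : O y -> Lap n y = k n *: eta y.
Proof. by move=> Oy; exact: iter_laplacianE. Qed.

Let covLap n i : cov t Phi (e i) (Lap n) u = k n *: Z i u.
Proof. by apply: cov_scaled => // y Oy; exact: LapE. Qed.

Let kk p q n : (p + q = n)%N -> k p * k q = (eps * a) ^+ n * (T * T).
Proof.
move=> <-; rewrite /k exprD.
transitivity (((eps * a) ^+ p * (eps * a) ^+ q) * ((eps * eps) * (T * T))); first by ring.
by rewrite patch_eps2 mul1r.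
Qed.

Let pair_term p q n : (p + q = n)%N ->
  \sum_i epsi i *: curvature t (cov t Phi (e i) (Lap p) u) (Lap q u) (push Phi (e i) u) =
  (c0%:R * ((eps * a) ^+ n * (T * T)) * T) *: eta u.
Proof.
move=> pqn; rewrite LapE// (@frame_curvature_l u Ou (k p) (k q))//.
by rewrite (kk pqn) AT.
Qed.

Let pair_term' p q n : (p + q = n)%N ->
  \sum_i epsi i *: curvature t (Lap p u) (cov t Phi (e i) (Lap q) u) (push Phi (e i) u) =
  - ((c0%:R * ((eps * a) ^+ n * (T * T)) * T) *: eta u).
Proof.
move=> pqn; rewrite LapE// (@frame_curvature_r u Ou (k p) (k q))//.
by rewrite (kk pqn) AT.
Qed.

(** In each pair of curvature terms the exponents of [eps * a] add up to [r - 3] whatever [l] is, so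
    the sum over [l] consists of equal terms. Together with the last term of the odd case this makes
    [r - 2] copies for both parities. *)
Lemma polytensionE r : (3 <= r)%N -> polytension t Phi epsi e r u =
  ((eps * a) ^+ (r - 3) * T * eps *
   ((eps * a) ^+ 2 - c0%:R * m%:R * (eps * a) - c0%:R * (r - 2)%:R * eps * T ^+ 2))
   *: eta u.
Proof.
move=> r3; rewrite /polytension; set b := eps * a.
have eE : eps * eps = 1 by exact: patch_eps2.
have [s sE] : exists s, r = (odd r + s.*2)%N by exists r./2; rewrite odd_double_half.
have -> : r./2 = s by rewrite sE half_bit_double.
case: ifP sE => _ /= sE.
- rewrite /polytension_odd -/(Lap (2 * s)) -/(Lap (2 * s - 1)).
  rewrite (eq_big_nat _ _ (F2 := fun=> (2 * (c0%:R * (b ^+ (2 * s - 2) * (T * T)) * T)) *: eta u)).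
    rewrite (@pair_term (s - 1) (s - 1) (2 * s - 2)); last by lia.
    rewrite LapE// (LapE (2 * s - 1) Ou) frame_ricci// sumr_const_nat -[_ *: eta u *+ _]scaler_nat scalerA.
    rewrite -!(scalerBl _ _ (eta u)); congr (_ *: _).
    have [s' E] : exists s', s = s'.+1 by exists s.-1; lia.
    rewrite /k sE E (_ : (2 * s'.+1 = s'.*2.+2)%N); last by lia.
    rewrite (_ : (s'.*2.+2 - 1 = s'.*2.+1)%N); last by lia.
    rewrite (_ : (s'.*2.+2 - 2 = s'.*2)%N); last by lia.
    rewrite (_ : (1 + s'.+1.*2 - 3 = s'.*2)%N); last by lia.
    rewrite (_ : (1 + s'.+1.*2 - 2 = s'.*2.+1)%N); last by lia.
    rewrite (_ : (s'.+1 - 1 = s')%N); last by lia.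
    rewrite -[s'.*2.+1%:R]natr1 -mul2n natrM -/b !exprS; set B := b ^+ (2 * s').
    transitivity (B * T * eps * (b * b) - B * T * eps * (c0%:R * m%:R * b)
       - B * T * (eps * eps) * (c0%:R * (2 * s'%:R + 1) * T ^+ 2)); last by ring.
    by rewrite eE; ring.
  move=> l ls; rewrite (@pair_term _ _ (2 * s - 2)); last by lia.
  rewrite (@pair_term' _ _ (2 * s - 2)); last by lia.
  by rewrite opprK -scalerDl; congr (_ *: _); ring.
- rewrite /polytension_even -/(Lap (2 * s - 1)) -/(Lap (2 * s - 2)).
  rewrite (eq_big_nat _ _ (F2 := fun=> (2 * (c0%:R * (b ^+ (2 * s - 3) * (T * T)) * T)) *: eta u)).
    rewrite LapE// (LapE (2 * s - 2) Ou) frame_ricci// sumr_const_nat -[_ *: eta u *+ _]scaler_nat scalerA.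
    rewrite -!(scalerBl _ _ (eta u)); congr (_ *: _).
    have [s' E] : exists s', s = s'.+2 by exists s.-2; lia.
    rewrite /k sE E.
    rewrite (_ : (2 * s'.+2 - 1 = s'.*2.+3)%N); last by lia.
    rewrite (_ : (2 * s'.+2 - 2 = s'.*2.+2)%N); last by lia.
    rewrite (_ : (2 * s'.+2 - 3 = s'.*2.+1)%N); last by lia.
    rewrite (_ : (0 + s'.+2.*2 - 3 = s'.*2.+1)%N); last by lia.
    rewrite (_ : (0 + s'.+2.*2 - 2 = s'.+1.*2)%N); last by lia.
    rewrite (_ : (s'.+2 - 1 = s'.+1)%N); last by lia.
    rewrite -[s'.+1.*2]mul2n natrM -/b !exprS; set B := b ^+ s'.*2.
    transitivity (b * B * T * eps * (b * b) - b * B * T * eps * (c0%:R * m%:R * b)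
       - b * B * T * (eps * eps) * (c0%:R * (2 * s'.+1%:R) * T ^+ 2)); last by ring.
    by rewrite eE; ring.
  move=> l ls; rewrite (@pair_term _ _ (2 * s - 3)); last by lia.
  rewrite (@pair_term' _ _ (2 * s - 3)); last by lia.
  by rewrite opprK -scalerDl; congr (_ *: _); ring.
Qed.

End Polytension.

End WithFrame.
End Patch.

(** * Focal maps *)

Section TwoCurvatures.
Context {R : realType} (t m : nat).
Context (Phi : 'rV[R]_m -> 'rV[R]_(true + m.+1)) (O : set 'rV[R]_m).
Context (eta : 'rV[R]_m -> 'rV[R]_(true + m.+1)) (la mu : R).
Hypothesis HP : hypersurface_patch t Phi O 1 eta.
Hypothesis lamu : la != mu.

Local Notation A := (shape_operator t Phi eta).
Hypothesis Apoly : forall u, O u -> (la%:M - A u) *m (mu%:M - A u) = 0.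

Let oO := patch_open HP.
Let sPhi := patch_smooth HP.
Let seta := patch_smooth_normal HP.

(** Up to normalisation, a parallel map of the hypersurface in the sphere, with [k] the cotangent of
    the distance. By [dfocal] its differential vanishes exactly on the eigenspace of [k]. *)
Definition focal (k : R) u := eta u + k *: Phi u.
Let P := focal la.
Let Q := focal mu.

Let dlm : la - mu != 0. Proof. by rewrite subr_eq0. Qed.

Let sF k : smooth_on O (focal k).
Proof. exact: smooth_lincomb. Qed.

Let dPhi u : O u -> differentiable Phi u.
Proof. exact: smooth_differentiable. Qed.
Let dF k u : O u -> differentiable (focal k) u.
Proof. exact: smooth_differentiable. Qed.
Let ddF k u v : O u -> differentiable (dder v (focal k)) u.
Proof. exact: differentiable_dder. Qed.

Let PhiPhi u : O u -> inner t (Phi u) (Phi u) = 1.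
Proof. by move=> Ou; exact: (patch_sphere HP Ou). Qed.
Let etaPhi u : O u -> inner t (eta u) (Phi u) = 0.
Proof. by move=> Ou; rewrite innerC; exact: (position_normal HP Ou). Qed.
Let etaeta u : O u -> inner t (eta u) (eta u) = 1.
Proof. by move=> Ou; exact: (normal_norm HP Ou). Qed.

Lemma focal_inner k k' u : O u -> inner t (focal k u) (focal k' u) = 1 + k * k'.
Proof.
move=> Ou; rewrite /focal !innerDl !innerDr !innerZl !innerZr etaeta// PhiPhi//.
by rewrite (innerC _ (Phi u)) etaPhi//; ring.
Qed.

Lemma dfocal k u v : O u -> dder v (focal k) u = dder (v *m (k%:M - A u)) Phi u.
Proof.
move=> Ou; rewrite (dder_lincomb k v seta sPhi Ou) (shapeE HP)// mulmxBr mul_mx_scalar.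
rewrite dder_dirD ?dder_dirZ ?dder_dirN; try exact: (dPhi Ou).
by rewrite addrC.
Qed.

Lemma dfocal_focal k k' u v : O u -> inner t (dder v (focal k) u) (focal k' u) = 0.
Proof.
move=> Ou; rewrite dfocal// /focal innerDr innerZr (dPhi_normal HP)//.
by rewrite (dPhi_position HP _ Ou)// mulr0 addr0.
Qed.

Lemma shape_adjoint_shift k u v w : O u ->
  inner t (dder (v *m (k%:M - A u)) Phi u) (dder w Phi u) =
  inner t (dder v Phi u) (dder (w *m (k%:M - A u)) Phi u).
Proof.
move=> Ou; rewrite !mulmxBr !mul_mx_scalar !dder_dirD ?dder_dirZ ?dder_dirN; try exact: (dPhi Ou).
rewrite !innerDl !innerDr !innerZl !innerZr !innerNl !innerNr.
by rewrite (shape_adjoint HP v w Ou).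
Qed.

Lemma Apoly' u : O u -> (mu%:M - A u) *m (la%:M - A u) = 0.
Proof.
move=> /Apoly; rewrite !mulmxBl !mulmxBr -!scalar_mxM !mul_mx_scalar !mul_scalar_mx.
by rewrite mulrC => <-; rewrite !opprB !addrA addrAC [RHS]addrAC; congr (_ + _); exact: addrAC.
Qed.

(** The operators [la - A] and [mu - A] are self-adjoint and their product is zero. *)
Lemma dPdQ u v w : O u -> inner t (dder v P u) (dder w Q u) = 0.
Proof.
move=> Ou; rewrite !dfocal// -shape_adjoint_shift// -mulmxA Apoly//.
by rewrite mulmx0 dder_dir0 inner0l.
Qed.

Let Q0 u x : O u -> dder (x *m (la%:M - A u)) Q u = 0.
Proof. by move=> Ou; rewrite dfocal// -mulmxA Apoly// mulmx0 dder_dir0. Qed.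
Let P0 u x : O u -> dder (x *m (mu%:M - A u)) P u = 0.
Proof. by move=> Ou; rewrite dfocal// -mulmxA Apoly'// mulmx0 dder_dir0. Qed.

Let dirE (f : 'rV[R]_m -> 'rV[R]_(true + m.+1)) u w : differentiable f u -> (la - mu) *: dder w f u =
  dder (w *m (la%:M - A u)) f u - dder (w *m (mu%:M - A u)) f u.
Proof.
move=> df; have E : (la - mu) *: w = w *m (la%:M - A u) - w *m (mu%:M - A u).
  by rewrite -mulmxBr opprB addrA subrK -raddfB /= mul_mx_scalar.
by rewrite -dder_dirZ// E dder_dirD// dder_dirN.
Qed.

Lemma dPhi_PQ u v : O u -> (la - mu) *: dder v Phi u = dder v P u - dder v Q u.
Proof. by move=> Ou; rewrite !dfocal// dirE//; exact: (dPhi Ou). Qed.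

Lemma PhiE u : (la - mu) *: Phi u = P u - Q u.
Proof. by rewrite /P /Q /focal opprD addrACA subrr add0r scalerBl. Qed.

Lemma ddPdQ_swap u z v w : O u ->
  inner t (dder z (dder v P) u) (dder w Q u) = - inner t (dder v P u) (dder z (dder w Q) u).
Proof.
move=> Ou; apply: (dder_inner_cst (k := 0) z oO Ou (ddF _ _ Ou) (ddF _ _ Ou)).
by move=> y Oy; exact: dPdQ.
Qed.

(* Subscripts are derivatives. <P_zv, Q_w> = - <P_v, Q_zw> is symmetric in all three arguments, and it
   vanishes as soon as one of them lies in one of the two eigenspaces. *)
Lemma ddPdQ u z v w : O u -> inner t (dder z (dder v P) u) (dder w Q u) = 0.
Proof.
move=> Ou; pose C z v w := inner t (dder z (dder v P) u) (dder w Q u).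
have C12 a b c : C a b c = C b a c by rewrite /C (dder_schwarz b a oO Ou (sF la)).
have C13 a b c : C a b c = C c b a.
  by rewrite /C !ddPdQ_swap// (dder_schwarz c a oO Ou (sF mu)).
have : (la - mu) * C z v w = 0.
  rewrite /C -innerZr dirE; last exact: (dF _ Ou).
  rewrite Q0// sub0r innerNr -/(C z v _) C13 C12 /C ddPdQ_swap// P0//.
  by rewrite inner0l !oppr0.
by move=> /eqP; rewrite mulf_eq0 (negbTE dlm) => /eqP.
Qed.

Lemma dPddQ u z v w : O u -> inner t (dder v P u) (dder z (dder w Q) u) = 0.
Proof. by move=> Ou; apply/eqP; rewrite -oppr_eq0 -ddPdQ_swap// ddPdQ. Qed.

Lemma dd_focal k k' u z v : O u ->
  inner t (dder z (dder v (focal k)) u) (focal k' u) =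
  - inner t (dder v (focal k) u) (dder z (focal k') u).
Proof.
move=> Ou; apply: (dder_inner_cst (k := 0) z oO Ou (ddF _ _ Ou) (dF _ Ou)).
by move=> y Oy; exact: dfocal_focal.
Qed.

Lemma focal_eq0 u W : O u -> inner t W (P u) = 0 -> inner t W (Q u) = 0 ->
  (forall v, inner t W (dder v Phi u) = 0) -> W = 0.
Proof.
move=> Ou WP WQ Wd.
have WPhi : inner t W (Phi u) = 0.
  apply: (mulfI dlm); rewrite -innerZr PhiE innerBr WP WQ subr0 mulr0//.
apply: (ambient_eq0 HP Ou) => //.
by rewrite -[eta u](addrK (la *: Phi u)) -/(P u) innerBr WP innerZr WPhi mulr0 subr0.
Qed.

Lemma focal_tangent u W : O u -> inner t W (P u) = 0 -> inner t W (Q u) = 0 ->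
  exists x, W = dder x Phi u.
Proof.
move=> Ou WP WQ.
have WPhi : inner t W (Phi u) = 0.
  apply: (mulfI dlm); rewrite -innerZr PhiE innerBr WP WQ subr0 mulr0//.
apply: (tangentP HP Ou) => //.
by rewrite -[eta u](addrK (la *: Phi u)) -/(P u) innerBr WP innerZr WPhi mulr0 subr0.
Qed.

Lemma dfocal_eq0 k u x : O u ->
  (forall w, inner t (dder x Phi u) (dder w (focal k) u) = 0) -> dder x (focal k) u = 0.
Proof.
move=> Ou h; apply: (focal_eq0 Ou); rewrite ?dfocal_focal// => v.
by rewrite dfocal// shape_adjoint_shift// -dfocal.
Qed.

(** [xi] is the vector in the span of [P] and [Q] with the same products with them as [W],
    everything scaled by their Gram determinant [(la - mu) ^+ 2]. The remainder is tangent and, by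
    [ddPdQ], [Q] has zero derivative along it; hence it is a multiple of a derivative of [P] and
    orthogonal to [W'] by [dPddQ]. Only [xi] contributes. *)
Lemma ddP_ddQ u z v y w : O u ->
  (la - mu) ^+ 2 * inner t (dder z (dder v P) u) (dder y (dder w Q) u) =
  - (1 + la * mu) * (inner t (dder v P u) (dder z P u) * inner t (dder w Q u) (dder y Q u)).
Proof.
move=> Ou; set W := dder z (dder v P) u; set W' := dder y (dder w Q) u.
set al := inner t (dder v P u) (dder z P u); set be := inner t (dder w Q u) _.
have WP : inner t W (P u) = - al by exact: dd_focal.
have WQ : inner t W (Q u) = 0 by rewrite dd_focal// dPdQ ?oppr0.
have W'Q : inner t W' (Q u) = - be by exact: dd_focal.
have W'P : inner t W' (P u) = 0 by rewrite dd_focal// innerC dPdQ ?oppr0.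
pose xi := - al *: ((1 + mu * mu) *: P u - (1 + la * mu) *: Q u).
have [||x xE] := @focal_tangent u ((la - mu) ^+ 2 *: W - xi) Ou.
- rewrite innerBl !innerZl innerBl !innerZl WP !focal_inner//; ring.
- rewrite innerBl !innerZl innerBl !innerZl WQ !focal_inner//; ring.
have Qx : dder x Q u = 0.
  apply: (dfocal_eq0 Ou) => w'; rewrite -xE innerBl !innerZl innerBl !innerZl ddPdQ//.
  by rewrite !(innerC _ (focal _ u)) !dfocal_focal//; ring.
have : inner t (dder x Phi u) W' = 0.
  apply: (mulfI dlm); rewrite -innerZl dPhi_PQ// Qx subr0 mulr0.
  exact: dPddQ.
rewrite -xE innerBl !innerZl innerBl !innerZl !(innerC _ (focal _ u)) -/(P u) -/(Q u) W'P W'Q.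
lra.
Qed.

(** The images of the two differentials are orthogonal and together span the tangent space, so the
    product stays nondegenerate on each of them. *)
Lemma nondegenerate_dfocal k k' u x : O u -> k != k' ->
  (forall v w, inner t (dder v (focal k) u) (dder w (focal k') u) = 0) ->
  dder x (focal k) u != 0 ->
  exists w, inner t (dder x (focal k) u) (dder w (focal k) u) != 0.
Proof.
move=> Ou kk' kk'0 x0; apply: contrapT => h; move/eqP: x0; apply.
apply: (focal_eq0 Ou); rewrite ?dfocal_focal// => v.
have dk : k - k' != 0 by rewrite subr_eq0.
apply: (mulfI dk); rewrite -innerZr mulr0.
have -> : (k - k') *: dder v Phi u = dder v (focal k) u - dder v (focal k') u.
  rewrite !(dder_lincomb _ _ seta sPhi Ou) opprD addrACA subrr add0r.
  by rewrite scalerBl.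
rewrite innerBr kk'0 subr0; apply/eqP; apply: contrapT => hv; apply: h.
by exists v; apply/negP.
Qed.

(* Differentiating <P_zv, Q_w> = 0 shows that <P_zv, Q_yw> is symmetric in z and
   y, whereas the right-hand side of [ddP_ddQ] vanishes after the
   exchange if Q_z = 0. *)
Lemma gauss_equation u : O u -> A u != la%:M -> A u != mu%:M -> 1 + la * mu = 0.
Proof.
move=> Ou Ala Amu.
have ex k : A u != k%:M -> exists x, dder x (focal k) u != 0.
  move=> Ak; apply: contrapT => h; move/eqP: Ak; apply.
  apply/eqP; rewrite eq_sym -subr_eq0; apply/eqP/row_matrixP => i.
  rewrite row0 rowE; apply: (jacobian_free HP Ou); rewrite -dfocal//.
  by apply/eqP; apply: contrapT => hi; apply: h; exists ('e_i); apply/negP.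
have [x Px] := ex la Ala; have [y Qy] := ex mu Amu.
(* This direction lies in the eigenspace of [mu]: along it [Q] is stationary, while [P] moves as
   along [x], up to the factor [la - mu]. *)
pose z := x *m (la%:M - A u).
have Pz : dder z P u = (la - mu) *: dder x P u.
  by rewrite (dirE x (dF la Ou)) P0// subr0.
have [v Pzv] : exists v, inner t (dder z P u) (dder v P u) != 0.
  apply: (nondegenerate_dfocal Ou lamu); first by move=> *; exact: dPdQ.
  by rewrite -/P Pz scaler_eq0 (negbTE dlm).
have [w Qyw] : exists w, inner t (dder y Q u) (dder w Q u) != 0.
  apply: (nondegenerate_dfocal (k' := la) Ou); first by rewrite eq_sym.
    by move=> *; rewrite innerC; exact: dPdQ.
  exact: Qy.
have sym : inner t (dder z (dder v P) u) (dder y (dder w Q) u) =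
           inner t (dder y (dder v P) u) (dder z (dder w Q) u).
  have E a b : inner t (dder b (dder a (dder v P)) u) (dder w Q u) =
      - inner t (dder a (dder v P) u) (dder b (dder w Q) u).
    apply: (dder_inner_cst (k := 0) b oO Ou _ (ddF mu w Ou)).
      exact: (differentiable_dder a (smooth_dder v (sF la)) Ou).
    by move=> y' Oy'; exact: ddPdQ.
  apply: oppr_inj; rewrite -!E; congr inner.
  exact: (dder_schwarz _ _ oO Ou (smooth_dder v (sF la))).
have := ddP_ddQ z v y w Ou; rewrite sym ddP_ddQ// Q0// inner0r !mulr0.
move/eqP; rewrite eq_sym mulf_eq0 oppr_eq0 => /orP[/eqP//|].
by rewrite mulf_eq0 innerC (negbTE Pzv) innerC (negbTE Qyw).
Qed.

(** * The projection attached to a pair of focal maps *)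

Section Projection.
Hypothesis lamu1 : 1 + la * mu = 0.

Let PQ0 u : O u -> inner t (P u) (Q u) = 0.
Proof. by move=> Ou; rewrite focal_inner. Qed.

Lemma focal_norm_gt0 k : 0 < 1 + k * k :> R.
Proof. by rewrite ltr_wpDr// -expr2 sqr_ge0. Qed.
Let pn0 k : 1 + k * k != 0 :> R. Proof. by rewrite gt_eqF// focal_norm_gt0. Qed.

(* When 1 + la * mu = 0, such an S is the orthogonal projection onto the span of
   P u and the image of dP; it turns out to be locally constant. *)
Definition proj_spec u (S : 'M[R]_(true + m.+1)) : Prop :=
  [/\ forall v, dder v Phi u *m S = (la - mu)^-1 *: dder v P u,
      P u *m S = P u & Q u *m S = 0].

(** [P] and [Q] are now orthogonal and of positive square norm, so the components along them can be
    split off; what is left is orthogonal to both and therefore tangent. *)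
Lemma focal_decomposition u x : O u ->
  exists v a b, x = dder v Phi u + a *: P u + b *: Q u.
Proof.
move=> Ou; pose a := inner t x (P u) / (1 + la * la).
pose b := inner t x (Q u) / (1 + mu * mu).
have [||v vE] := @focal_tangent u (x - a *: P u - b *: Q u) Ou.
- rewrite !innerBl !innerZl !focal_inner// (mulrC mu) lamu1 mulr0 subr0.
  by rewrite divfK ?subrr.
- rewrite !innerBl !innerZl !focal_inner// lamu1 mulr0 subr0.
  by rewrite divfK ?subrr.
by exists v, a, b; rewrite -vE addrAC subrK subrK.
Qed.

Section Spec.
Context (u : 'rV[R]_m) (Ou : O u) (S : 'M[R]_(true + m.+1)) (HS : proj_spec u S).

Let SPhi v : dder v Phi u *m S = (la - mu)^-1 *: dder v P u.
Proof. by have [] := HS. Qed.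
Let SP : P u *m S = P u. Proof. by have [] := HS. Qed.
Let SQ : Q u *m S = 0. Proof. by have [] := HS. Qed.

Lemma proj_dP v : dder v P u *m S = dder v P u.
Proof.
rewrite [X in X *m S]dfocal// SPhi; apply: (scalerI dlm).
by rewrite scalerA mulfV// scale1r (dirE v (dF la Ou)) P0// subr0.
Qed.

Lemma proj_dQ v : dder v Q u *m S = 0.
Proof. by rewrite [X in X *m S]dfocal// SPhi P0// scaler0. Qed.

(** After removal of its component along [P], such a [W] is tangent, in a direction along which [Q]
    is stationary; so it is a multiple of a derivative of [P]. [proj_kill] is the mirror image. *)
Lemma proj_fix W : inner t W (Q u) = 0 ->
  (forall w, inner t W (dder w Q u) = 0) -> W *m S = W.
Proof.
move=> WQ WdQ; pose a := inner t W (P u) / (1 + la * la).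
have [||x xE] := @focal_tangent u (W - a *: P u) Ou.
- by rewrite innerBl innerZl focal_inner// divfK ?subrr.
- by rewrite innerBl innerZl WQ PQ0// mulr0 subr0.
have Qx : dder x Q u = 0.
  apply: (dfocal_eq0 Ou) => w; rewrite -xE innerBl WdQ innerZl.
  by rewrite (innerC _ (P u)) dfocal_focal// mulr0 subr0.
have -> : W = dder x Phi u + a *: P u by rewrite -xE subrK.
rewrite mulmxDl -scalemxAl SP SPhi; congr (_ + _); apply: (scalerI dlm).
by rewrite scalerA mulfV// scale1r dPhi_PQ// Qx subr0.
Qed.

Lemma proj_kill W : inner t W (P u) = 0 ->
  (forall w, inner t W (dder w P u) = 0) -> W *m S = 0.
Proof.
move=> WP WdP; pose a := inner t W (Q u) / (1 + mu * mu).
have [||x xE] := @focal_tangent u (W - a *: Q u) Ou.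
- by rewrite innerBl innerZl WP (innerC _ (Q u)) PQ0// mulr0 subr0.
- by rewrite innerBl innerZl focal_inner// divfK ?subrr.
have Px : dder x P u = 0.
  apply: (dfocal_eq0 Ou) => w; rewrite -xE innerBl WdP innerZl.
  by rewrite (innerC _ (Q u)) dfocal_focal// mulr0 subr0.
have -> : W = dder x Phi u + a *: Q u by rewrite -xE subrK.
by rewrite mulmxDl -scalemxAl SQ SPhi Px !scaler0 addr0.
Qed.

Lemma proj_spec_eq0 (D : 'M[R]_(true + m.+1)) :
  (forall v, dder v Phi u *m D = 0) -> P u *m D = 0 -> Q u *m D = 0 -> D = 0.
Proof.
move=> D1 D2 D3; apply/row_matrixP => i; rewrite row0 rowE.
have [v [a [b ->]]] := focal_decomposition 'e_i Ou.
by rewrite !mulmxDl -!scalemxAl D1 D2 D3 !scaler0 !addr0.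
Qed.

Lemma proj_idem : S *m S = S.
Proof.
apply/eqP; rewrite -subr_eq0; apply/eqP/proj_spec_eq0; first move=> v;
  rewrite mulmxBr mulmxA.
- by rewrite SPhi -scalemxAl proj_dP subrr.
- by rewrite !SP subrr.
- by rewrite !SQ mul0mx subrr.
Qed.

Lemma proj_adjoint x y : inner t (x *m S) y = inner t x (y *m S).
Proof.
have [v [a [b ->]]] := focal_decomposition x Ou.
have [w [a' [b' ->]]] := focal_decomposition y Ou.
rewrite !mulmxDl -!scalemxAl !SPhi !SP !SQ !scaler0 !addr0.
rewrite !innerDl !innerDr !innerZl !innerZr.
rewrite !(innerC _ (focal _ u) (dder _ _ _)) !dfocal_focal//.
have dPF z k : inner t (dder z Phi u) (focal k u) = 0.
  rewrite /focal innerDr innerZr (dPhi_normal HP)//.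
  by rewrite (dPhi_position HP _ Ou)// mulr0 addr0.
rewrite (innerC _ (Q u) (P u)) !PQ0// !dPF.
have -> : inner t (dder v P u) (dder w Phi u) = inner t (dder v Phi u) (dder w P u).
  by rewrite !dfocal// shape_adjoint_shift.
by ring.
Qed.

End Spec.

Lemma proj_spec_unique u S S' : O u -> proj_spec u S -> proj_spec u S' -> S = S'.
Proof.
move=> Ou [a b c] [a' b' c']; apply/eqP; rewrite -subr_eq0; apply/eqP.
apply: (proj_spec_eq0 Ou); first (by move=> v; rewrite mulmxBr a a' subrr);
  by rewrite mulmxBr ?b ?b' ?c ?c' subrr.
Qed.

Section ProjectionFrame.
Context (epsi : 'I_m -> R) (e : 'I_m -> 'rV[R]_m -> 'rV[R]_m).
Hypothesis He : orthonormal_frame t Phi O epsi e.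

(** A sum of dyads over the moving frame. As [proj_spec] determines the matrix, the choice of frame
    does not matter; the formula makes the differentiability in [u] visible. *)
Definition focal_proj u : 'M[R]_(true + m.+1) :=
  \sum_i (epsi i / (la - mu)) *:
    (gram t *m (dder (e i u) Phi u)^T *m dder (e i u) P u)
  + (1 + la * la)^-1 *: (gram t *m (P u)^T *m P u).

Lemma mulmx_dyad d (x y z : 'rV[R]_d) :
  x *m (gram t *m y^T *m z) = inner t x y *: z.
Proof. by rewrite !mulmxA [x *m _ *m _]mx11_scalar mul_scalar_mx inner_gram. Qed.

Lemma focal_projE u : O u -> proj_spec u (focal_proj u).
Proof.
move=> Ou; have xS x : x *m focal_proj u = \sum_i (epsi i / (la - mu) *
    inner t x (dder (e i u) Phi u)) *: dder (e i u) P u +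
    ((1 + la * la)^-1 * inner t x (P u)) *: P u.
  rewrite mulmxDr mulmx_sumr -scalemxAr mulmx_dyad scalerA; congr (_ + _).
  by apply: eq_bigr => i _; rewrite -scalemxAr mulmx_dyad scalerA.
have dPF z k : inner t (dder z Phi u) (focal k u) = 0.
  rewrite /focal innerDr innerZr (dPhi_normal HP)//.
  by rewrite (dPhi_position HP _ Ou)// mulr0 addr0.
have kill k : \sum_i (epsi i / (la - mu) * inner t (focal k u) (dder (e i u) Phi u)) *:
    dder (e i u) P u = 0.
  by rewrite big1// => i _; rewrite innerC dPF mulr0 scale0r.
split=> [v||]; rewrite xS.
- rewrite dPF mulr0 scale0r addr0.
  have vE : v = \sum_i (epsi i * inner t (dder v Phi u) (dder (e i u) Phi u)) *: e i u.
    apply/eqP; rewrite -subr_eq0; apply/eqP/(jacobian_free HP Ou).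
    rewrite dder_dirD ?dder_dirN; try exact: (dPhi Ou).
    rewrite dder_dir_sum; last exact: (dPhi Ou).
    rewrite [X in X - _](frame_expand HP He Ou) ?(dPhi_normal HP)//; last by move=> _; exact: (dPhi_position HP).
    apply/eqP; rewrite subr_eq0; apply/eqP; apply: eq_bigr => i _.
    by rewrite dder_dirZ//; exact: (dPhi Ou).
  rewrite {2}vE dder_dir_sum; last exact: (dF _ Ou).
  rewrite scaler_sumr; apply: eq_bigr => i _.
  rewrite dder_dirZ; last exact: (dF _ Ou).
  by rewrite scalerA; congr (_ *: _); ring.
- by rewrite kill add0r focal_inner// mulVf// scale1r.
- by rewrite kill add0r (innerC _ (Q u)) PQ0// mulr0 scale0r.
Qed.

Let df i u : O u -> differentiable (fun y => dder (e i y) Phi y) u.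
Proof. by move=> Ou; apply: (differentiable_dder_dir oO sPhi Ou); exact: (differentiable_frame He i Ou). Qed.

Lemma differentiable_proj u : O u -> differentiable focal_proj u.
Proof.
move=> Ou; apply: differentiableD.
  apply: differentiable_sumE => i; apply: differentiableZ.
  apply: differentiable_mulmx.
    by apply: differentiable_mulmx => //; apply: differentiable_trmx; exact: (df i Ou).
  by apply: (differentiable_dder_dir oO (sF la) Ou); exact: (differentiable_frame He i Ou).
apply: differentiableZ; apply: differentiable_mulmx; last exact: (dF la Ou).
by apply: differentiable_mulmx => //; apply: differentiable_trmx; exact: (dF la Ou).
Qed.

(** Each equation [g *m focal_proj = h] of [proj_spec] is differentiated. Second derivatives occur
    only for [g = dder v Phi], whose derivative is the difference of those of [dder v P] and
    [dder v Q] divided by [la - mu]; by [ddPdQ] and [dPddQ] the projection fixes the first and kills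
    the second. *)
Lemma dder_proj u z : O u -> dder z focal_proj u = 0.
Proof.
move=> Ou; have dS := differentiable_proj Ou.
have Hu := focal_projE Ou.
have prodE (g h : 'rV[R]_m -> 'rV[R]_(true + m.+1)) : differentiable g u ->
    (forall y, O y -> g y *m focal_proj y = h y) -> dder z g u *m focal_proj u = dder z h u ->
    g u *m dder z focal_proj u = 0.
  move=> dg gh E; have := dder_mulmx z dg dS.
  rewrite (dder_eq_on z oO Ou gh) E => /eqP.
  by rewrite -subr_eq0 opprD addNKr oppr_eq0 => /eqP.
apply: (proj_spec_eq0 Ou).
- move=> v; apply: (prodE (dder v Phi) (fun y => (la - mu)^-1 *: dder v P y)).
  + exact: (differentiable_dder v sPhi Ou).
  + by move=> y Oy; have [] := focal_projE Oy.
  rewrite dderZ; last exact: (ddF la v Ou).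
  have -> : dder z (dder v Phi) u =
      (la - mu)^-1 *: (dder z (dder v P) u - dder z (dder v Q) u).
    have dd : dder z (fun y => (la - mu) *: dder v Phi y) u =
        dder z (dder v P) u - dder z (dder v Q) u.
      rewrite (dder_eq_on (g := fun y => dder v P y + -1 *: dder v Q y) z oO Ou); last first.
        by move=> y Oy; rewrite dPhi_PQ// scaleN1r.
      by rewrite (dder_lincomb (-1) z (smooth_dder v (sF la)) (smooth_dder v (sF mu)) Ou) scaleN1r.
    rewrite -dd dderZ ?scalerA ?mulVf ?scale1r//.
    exact: (differentiable_dder v sPhi Ou).
  rewrite -scalemxAl mulmxBl (proj_fix Ou Hu) ?(proj_kill Ou Hu) ?subr0//.
  + by rewrite dd_focal// innerC dPdQ ?oppr0.
  + by move=> w; rewrite innerC dPddQ.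
  + by rewrite dd_focal// dPdQ ?oppr0.
  + by move=> w; exact: ddPdQ.
- apply: (prodE P P (dF la Ou)); first by move=> y Oy; have [] := focal_projE Oy.
  exact: (proj_dP Ou Hu).
- apply: (prodE Q (fun=> 0) (dF mu Ou)); first by move=> y Oy; have [] := focal_projE Oy.
  by rewrite (proj_dQ Ou Hu) dder_cst.
Qed.

(** The sum over the frame is the trace of [la - A] divided by [la - mu]; the summand 1 comes from
    the line of [P]. *)
Lemma trace_proj u : O u -> \tr (focal_proj u) = (m%:R * la - \tr (A u)) / (la - mu) + 1.
Proof.
move=> Ou; rewrite raddfD /= raddf_sum /=; congr (_ + _).
  have := frame_trace HP He (la%:M - A u) 1%:M Ou.
  rewrite trmx1 mulmx1 mulmxK ?(patch_metric HP)// raddfB /= mxtrace_scalar mulr_natl => <-.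
  rewrite mulr_suml; apply: eq_bigr => i _.
  rewrite mxtraceZ mxtrace_mulC mulmx1 -dfocal// -/P trace_mx11 mulmxA -inner_gram; ring.
by rewrite mxtraceZ mxtrace_mulC mulmxA trace_mx11 -inner_gram focal_inner// mulVf.
Qed.

End ProjectionFrame.
End Projection.

End TwoCurvatures.

(** * Local image *)

Section Isometries.
Context {R : realType}.

Lemma smooth_cst {V W : normedModType R} (O : set V) (c : W) : smooth_on O (fun=> c).
Proof.
move=> k; elim: k c => [|k IH] c /=; first by move=> u _; exact: cst_continuous.
split=> [u _|v]; first exact: differentiable_cst.
by rewrite (_ : (fun u => 'D_v (fun=> c) u) = fun=> 0) //; apply/funext => u; exact: derive_cst.
Qed.

Lemma smooth_mulmxr n p (O : set 'rV[R]_n) (A : 'M[R]_(n, p)) :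
  smooth_on O (fun x : 'rV[R]_n => x *m A).
Proof.
case=> [|k] /=.
  by move=> u _; exact/differentiable_continuous/differentiable_mulmxr.
split=> [u _|v]; first exact: differentiable_mulmxr.
rewrite (_ : (fun u => _) = fun=> v *m A); first exact: smooth_cst.
by apply/funext => u; exact: derive_mulmxr.
Qed.

Lemma gram_unit d t (A : 'M[R]_d) : A *m gram t *m A^T = gram t -> A \in unitmx.
Proof.
move=> AA; have [_ ug] := mulmx1_unit (@gramK R d t).
by move: ug; rewrite -{1}AA -mulmxA unitmx_mul => /andP[].
Qed.

Lemma inner_isometry d t (A : 'M[R]_d) x y : A *m gram t *m A^T = gram t ->
  inner t (x *m A) (y *m A) = inner t x y.
Proof. by move=> AA; rewrite inner_mulmx AA inner_gram. Qed.

Lemma linear_isometry (c0 : bool) n t (A : 'M[R]_(c0 + n)) : A *m gram t *m A^T = gram t ->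
  space_form_isometry t (fun x => x *m A).
Proof.
move=> AA; have uA := gram_unit AA; split.
- split.
  + by move=> x xS c; rewrite inner_isometry//; exact: xS.
  + by move=> x y _ _; exact: (can_inj (mulmxK uA)).
  + move=> y yS; exists (y *m invmx A); last exact: mulmxKV.
    by move=> c; rewrite -(inner_isometry _ _ AA) mulmxKV//; exact: yS.
- exists setT; split=> //; first exact: openT.
  exact: smooth_mulmxr.
- by move=> p _ v w _ _; rewrite !derive_mulmxr inner_isometry.
Qed.

Lemma open_image_unitmx n (A : 'M[R]_n) (O : set 'rV[R]_n) : A \in unitmx -> open O ->
  open ((fun x => x *m A) @` O).
Proof.
move=> uA oO; apply: open_map => // x _; split; first exact: differentiable_mulmxr.
by move=> v; rewrite derive_mulmxr => /(canRL (mulmxK uA)); rewrite mul0mx.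
Qed.

Lemma dder_comp {U V W : normedModType R} (g : U -> V) (f : V -> W) x h :
  differentiable g x -> differentiable f (g x) ->
  differentiable (fun y => f (g y)) x /\
  dder h (fun y => f (g y)) x = dder (dder h g x) f (g x).
Proof.
move=> dg df; have dfg : differentiable (f \o g) x by exact: differentiable_comp.
by split=> //; rewrite !dderE !deriveE// diff_comp.
Qed.

End Isometries.

Section ChartNeighbourhoods.
Context {R : realType} (M : topologicalType) (m : nat) (x : chart R M m).
Hypothesis Hx : is_chart x.

Lemma chart_invK p : chart_dom x p -> chart_inv x (chart_map x p) = p.
Proof. by move=> xp; apply: (chart_mapK Hx); rewrite inE. Qed.

Lemma chart_preimage_open (B : set 'rV[R]_m) : open B ->
  open (chart_dom x `&` chart_map x @^-1` B).
Proof.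
move=> oB; rewrite openE => p [xp Bp]; apply: filterI.
  by apply: open_nbhs_nbhs; split=> //; exact: (chart_dom_open Hx).
exact: (chart_map_continuous Hx xp) (open_nbhs_nbhs (conj oB Bp)).
Qed.

Lemma chart_preimage_image (T : Type) (phi : M -> T) (B : set 'rV[R]_m) :
  B `<=` chart_img x ->
  phi @` (chart_dom x `&` chart_map x @^-1` B) = (phi \o chart_inv x) @` B.
Proof.
move=> Bx; apply/seteqP; split=> [_ [p [xp Bp] <-]|_ [u Bu <-]].
  by exists (chart_map x p) => //=; rewrite chart_invK.
have [p xp pu] := Bx _ Bu; exists p; last by rewrite /= -pu chart_invK.
by split=> //=; rewrite pu.
Qed.

End ChartNeighbourhoods.

Section LocalImage.
Context {R : realType} (t m : nat).
Context (Phi : 'rV[R]_m -> 'rV[R]_(true + m.+1)) (O : set 'rV[R]_m).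
Context (eta : 'rV[R]_m -> 'rV[R]_(true + m.+1)) (la mu : R).
Hypothesis HP : hypersurface_patch t Phi O 1 eta.
Hypothesis lamu : la != mu.
Hypothesis Apoly : forall u, O u ->
  (la%:M - shape_operator t Phi eta u) *m (mu%:M - shape_operator t Phi eta u) = 0.
Hypothesis lamu1 : 1 + la * mu = 0.
Context (S : 'M[R]_(true + m.+1)) (B : set 'rV[R]_m).
Hypotheses (oB : open B) (BO : B `<=` O).
Hypothesis HS : forall u, B u -> proj_spec Phi eta la mu u S.

Let P := focal Phi eta la.
Let Q := focal Phi eta mu.
Let dlm : la - mu != 0. Proof. by rewrite subr_eq0. Qed.
Let d := (la - mu)^-1.
Let dn0 : d != 0. Proof. by rewrite invr_eq0. Qed.

Definition product_quadric : set 'rV[R]_(true + m.+1) :=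
  [set x | inner t (x - x *m S) (x - x *m S) = (1 + mu * mu) / (la - mu) ^+ 2 /\
           inner t (x *m S) (x *m S) = (1 + la * la) / (la - mu) ^+ 2].

(* The cone over the hypersurface with the two factors rescaled separately. *)
Let ca : 'M[R]_(1 + (1 + m), 1) := col_mx 1%:M 0.
Let cb : 'M[R]_(1 + (1 + m), 1) := col_mx 0 (col_mx 1%:M 0).
Let cu : 'M[R]_(1 + (1 + m), m) := col_mx 0 (col_mx 0 1%:M).
Let Theta (x : 'rV[R]_(m.+2)) : 'rV[R]_(m.+2) :=
  (x *m ca) 0 0 *: (- d *: Q (x *m cu)) + (x *m cb) 0 0 *: (d *: P (x *m cu)).

Let coordE (a b : R) (u : 'rV[R]_m) :
  let x : 'rV[R]_(1 + (1 + m)) := row_mx a%:M (row_mx b%:M u) in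
  [/\ (x *m ca) 0 0 = a, (x *m cb) 0 0 = b & x *m cu = u].
Proof.
rewrite /ca /cb /cu !mul_row_col !mulmx1 !mulmx0 !addr0 !add0r.
by rewrite !mxE eqxx !mulr1n.
Qed.

Let coord_eq0 (x : 'rV[R]_(1 + (1 + m))) :
  (x *m ca) 0 0 = 0 -> (x *m cb) 0 0 = 0 -> x *m cu = 0 -> x = 0.
Proof.
rewrite -[x]hsubmxK -[rsubmx x]hsubmxK.
rewrite [lsubmx x]mx11_scalar [lsubmx (rsubmx x)]mx11_scalar.
have [-> -> ->] := coordE (lsubmx x 0 0) (lsubmx (rsubmx x) 0 0) (rsubmx (rsubmx x)).
by move=> -> -> ->; rewrite raddf0 !row_mx0.
Qed.

Let Dom : set 'rV[R]_(m.+2) :=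
  [set x | [/\ 0 < (x *m ca) 0 0, 0 < (x *m cb) 0 0 & B (x *m cu)]].

Let Dom_open : open Dom.
Proof.
have cl p (c : 'M[R]_(1 + (1 + m), p)) : continuous (fun x : 'rV[R]_(1 + (1 + m)) => x *m c).
  by move=> x; exact/differentiable_continuous/differentiable_mulmxr.
have ce (c : 'M[R]_(1 + (1 + m), 1)) : continuous (fun x : 'rV[R]_(1 + (1 + m)) => (x *m c) 0 0).
  move=> x; apply: differentiable_continuous; apply: differentiable_entry.
  exact: differentiable_mulmxr.
have -> : Dom = (fun x : 'rV[R]_(1 + (1 + m)) => (x *m ca) 0 0) @^-1` [set a | 0 < a] `&`
   ((fun x : 'rV[R]_(1 + (1 + m)) => (x *m cb) 0 0) @^-1` [set a | 0 < a] `&`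
    (fun x : 'rV[R]_(1 + (1 + m)) => x *m cu) @^-1` B).
  by apply/seteqP; split=> [x [? ? ?]|x [? [? ?]]].
apply: openI; [|apply: openI].
- by apply: open_comp => [x _|]; [exact: ce|exact: open_gt].
- by apply: open_comp => [x _|]; [exact: ce|exact: open_gt].
- by apply: open_comp => [x _|//]; exact: cl.
Qed.

Let sF k : smooth_on O (focal Phi eta k).
Proof. exact: (smooth_lincomb _ (patch_open HP) (patch_smooth_normal HP) (patch_smooth HP)). Qed.

Let dTheta x h : Dom x -> differentiable Theta x /\ dder h Theta x =
  ((h *m ca) 0 0 *: (- d *: Q (x *m cu)) + (x *m ca) 0 0 *: (- d *: dder (h *m cu) Q (x *m cu))) +
  ((h *m cb) 0 0 *: (d *: P (x *m cu)) + (x *m cb) 0 0 *: (d *: dder (h *m cu) P (x *m cu))).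
Proof.
move=> [_ _ Bx]; have Ox := BO Bx.
have dl p (c : 'M[R]_(1 + (1 + m), p)) : differentiable (fun x : 'rV[R]_(1 + (1 + m)) => x *m c) x.
  exact: differentiable_mulmxr.
have el p (c : 'M[R]_(1 + (1 + m), p)) : dder h (fun x : 'rV[R]_(1 + (1 + m)) => x *m c) x = h *m c.
  by rewrite dderE derive_mulmxr.
have dF k : differentiable (focal Phi eta k) (x *m cu).
  exact: smooth_differentiable (sF k) Ox.
have [dPc ePc] := dder_comp h (dl _ cu) (dF la).
have [dQc eQc] := dder_comp h (dl _ cu) (dF mu).
have da (c : 'M[R]_(1 + (1 + m), 1)) : differentiable (fun x : 'rV[R]_(1 + (1 + m)) => (x *m c) 0 0) x.
  exact: differentiable_entry.
have ea (c : 'M[R]_(1 + (1 + m), 1)) :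
    dder h (fun x : 'rV[R]_(1 + (1 + m)) => (x *m c) 0 0) x = (h *m c) 0 0.
  by rewrite dder_entry// el.
have term (c : 'M[R]_(1 + (1 + m), 1)) k (g : 'rV[R]_(1 + (1 + m)) -> 'rV[R]_(true + m.+1)) :
   differentiable g x ->
   differentiable (fun x => (x *m c) 0 0 *: (k *: g x)) x /\
   dder h (fun x => (x *m c) 0 0 *: (k *: g x)) x =
     (h *m c) 0 0 *: (k *: g x) + (x *m c) 0 0 *: (k *: dder h g x).
  move=> dg; have dkg : differentiable (fun x => k *: g x) x by exact: differentiableZ.
  by rewrite dder_scale// ea dderZ//; split=> //; exact: differentiable_scale.
have [d1 e1] := term ca (- d) _ dQc; have [d2 e2] := term cb d _ dPc.
split; first exact: differentiableD.
rewrite dderE deriveD; [|exact/diff_derivable..].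
by rewrite -!dderE e1 e2 ePc eQc el.
Qed.

(** Scaling the two factors by independent positive numbers makes [Theta] a map between spaces of
    equal dimension [m + 2] with injective differential, hence open. The two equations of the
    quadric force both scales to be 1, and what remains is the image of [Phi]. *)
Lemma local_image : exists2 O' : set 'rV[R]_(true + m.+1), open O' &
  Phi @` B = O' `&` product_quadric.
Proof.
exists (Theta @` Dom).
  apply: (@open_map R m.+2 Theta Dom Dom_open) => x Dx; split.
    by have [] := dTheta 0 Dx.
  move=> h; rewrite -dderE; have [_ ->] := dTheta h Dx.
  have [xa xb Bx] := Dx; have Ox := BO Bx; set u := x *m cu in Bx Ox *.
  have PQ : inner t (P u) (Q u) = 0 by rewrite (focal_inner HP).
  have dFF z k k' : inner t (dder z (focal Phi eta k) u) (focal Phi eta k' u) = 0.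
    exact: (dfocal_focal HP).
  move=> E.
  have ha : (h *m ca) 0 0 = 0.
    have := inner0l t (Q u); rewrite -E !innerDl !innerZl (focal_inner HP)// !dFF PQ.
    move/eqP; rewrite !mulr0 !addr0 mulf_eq0 mulf_eq0 oppr_eq0 (negbTE dn0) /=.
    by rewrite (gt_eqF (focal_norm_gt0 mu)) orbF => /eqP.
  have hb : (h *m cb) 0 0 = 0.
    have := inner0l t (P u); rewrite -E !innerDl !innerZl !(focal_inner HP)// !dFF (mulrC mu) lamu1.
    move/eqP; rewrite !mulr0 !addr0 add0r mulf_eq0 mulf_eq0 (negbTE dn0) /=.
    by rewrite (gt_eqF (focal_norm_gt0 la)) orbF => /eqP.
  move: E; rewrite ha hb !scale0r !add0r => E.
  (* Multiplication by [S] separates the two remaining terms: it fixes derivatives of [P] and kills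
     those of [Q]. *)
  have dP0 : dder (h *m cu) P u = 0.
    have := congr1 (mulmx^~ S) E.
    rewrite mulmxDl -!scalemxAl (proj_dQ HP Apoly Ox (HS Bx)).
    rewrite (proj_dP HP lamu Apoly Ox (HS Bx)) !scaler0 add0r mul0mx => /eqP.
    by rewrite !scaler_eq0 (gt_eqF xb) (negbTE dn0) /= => /eqP.
  have dQ0 : dder (h *m cu) Q u = 0.
    move: E; rewrite dP0 !scaler0 addr0 => /eqP.
    by rewrite !scaler_eq0 (gt_eqF xa) oppr_eq0 (negbTE dn0) /= => /eqP.
  apply: coord_eq0 => //; apply: (jacobian_free HP Ox).
  apply: (scalerI dlm); rewrite scaler0 (dPhi_PQ la mu HP)//.
  by rewrite -/P -/Q dP0 dQ0 subrr.
have ThetaS x : Dom x -> Theta x *m S = ((x *m cb) 0 0 * d) *: P (x *m cu) /\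
    Theta x - Theta x *m S = (- (x *m ca) 0 0 * d) *: Q (x *m cu).
  move=> [_ _ Bx]; have [_ SP SQ] := HS Bx.
  have E : Theta x *m S = ((x *m cb) 0 0 * d) *: P (x *m cu).
    by rewrite /Theta mulmxDl -!scalemxAl SP SQ !scaler0 add0r scalerA.
  split=> //; rewrite E /Theta -scalerA addrK scalerA; congr (_ *: _); ring.
have quadric x : Dom x -> product_quadric (Theta x) <->
    (x *m ca) 0 0 = 1 /\ (x *m cb) 0 0 = 1.
  move=> Dx; have [E1 E2] := ThetaS _ Dx; have [xa xb /BO Ox] := Dx.
  rewrite /product_quadric /= E2 E1 !innerZl !innerZr !(focal_inner HP)//.
  have one a k : 0 < a ->
      a * d * (a * d * (1 + k * k)) = (1 + k * k) / (la - mu) ^+ 2 -> a = 1.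
    move=> a0; rewrite -exprVn -/d => h.
    have : (a ^+ 2) * (d ^+ 2 * (1 + k * k)) = 1 * (d ^+ 2 * (1 + k * k)).
      by rewrite mul1r [RHS]mulrC -h; ring.
    move/(mulIf (mulf_neq0 (expf_neq0 2 dn0) (lt0r_neq0 (focal_norm_gt0 k)))).
    move=> /eqP; rewrite sqrf_eq1 => /orP[/eqP//|/eqP a1].
    by move: a0; rewrite a1 oppr_gt0 ltr10.
  split=> [[h1 h2]|[-> ->]].
    by split; [apply: (one _ mu xa); rewrite -h1; ring|apply: (one _ la xb)].
  by rewrite -exprVn -/d; split; ring.
apply/seteqP; split=> [_ [u Bu <-]|_ [[x Dx <-] /(quadric _ Dx)[xa xb]]].
  have [ea eb eu] := coordE 1 1 u.
  pose x : 'rV[R]_(m.+2) := row_mx 1%:M (row_mx 1%:M u).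
  have Dx : Dom x by rewrite /Dom /= ea eb eu.
  have <- : Theta x = Phi u.
    rewrite /Theta ea eb eu !scale1r; apply: (scalerI dlm).
    by rewrite (PhiE Phi eta) scalerDr !scalerA mulrN mulfV// scaleN1r scale1r addrC.
  by split; [exists x|apply/quadric].
have [_ _ Bx] := Dx; exists (x *m cu) => //.
apply: (scalerI dlm); rewrite (PhiE Phi eta) /Theta xa xb !scale1r scalerDr !scalerA.
by rewrite mulrN mulfV// scaleN1r scale1r addrC.
Qed.

End LocalImage.

(** * Principal curvatures on the manifold *)

Section Pointwise.
Context {R : realType}.

Lemma sum_if_card n (b : 'I_n -> bool) (x y : R) :
  \sum_i (if b i then x else y) =
  #|[pred i | b i]|%:R * x + (n - #|[pred i | b i]|)%:R * y.
Proof.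
rewrite (bigID b) /=; congr (_ + _).
  rewrite (eq_bigr (fun=> x)); last by move=> i ->.
  by rewrite sumr_const mulr_natl.
rewrite (eq_bigr (fun=> y)); last by move=> i /negbTE ->.
rewrite sumr_const mulr_natl; congr (_ *+ _).
have := cardC [pred i | b i]; rewrite card_ord => nE.
transitivity #|predC [pred i | b i]|; first by apply: eq_card => i; rewrite !inE.
exact: (canRL (addKn _) nE).
Qed.

(** [k] is the number of diagonal entries equal to [la]; for [la = mu] all of them count, whence the
    convention [k = n]. *)
Lemma diagonalizable_two_eigenvalues n (A : 'M[R]_n) la mu : diagonalizable A ->
  (forall a, eigenvalue A a -> a = la \/ a = mu) ->
  exists k, [/\ (k <= n)%N, (la%:M - A) *m (mu%:M - A) = 0,
    \tr A = k%:R * la + (n - k)%:R * mu,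
    \tr (A *m A) = k%:R * la ^+ 2 + (n - k)%:R * mu ^+ 2 &
    [/\ k = n -> A = la%:M, k = 0%N -> A = mu%:M & la = mu -> k = n]].
Proof.
case=> P uP /(similar_diagLR uP)[D]; rewrite conjumx ?unitmx_inv// invmxK => AE ev.
have DE i : D 0 i = la \/ D 0 i = mu.
  apply: ev; apply/eigenvalueP; exists (row i P).
    rewrite -row_mul AE -!mulmxA (mulmxA P) mulmxV// mul1mx row_mul row_diag_mx.
    by rewrite -scalemxAl -rowE.
  apply/negP => /eqP Pi0; have := oner_neq0 R; move/eqP; apply.
  have := congr1 (fun z : 'rV_n => (z *m invmx P) 0 i) Pi0.
  by rewrite -row_mul mulmxV// mul0mx !mxE eqxx.
have D2 i : D 0 i = if D 0 i == la then la else mu.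
  by case: eqP => [//|]; case: (DE i).
have trP (X : 'M[R]_n) : \tr (invmx P *m X *m P) = \tr X.
  by rewrite mxtrace_mulC mulmxA mulmxV// mul1mx.
have cP (c : R) : c%:M = invmx P *m c%:M *m P.
  by rewrite -mulmxA -scalar_mxC mulmxA mulVmx// mul1mx.
have D3 c c' : c%:M - A = invmx P *m (c%:M - diag_mx D) *m P /\
    (c%:M - A) *m (c'%:M - A) =
    invmx P *m ((c%:M - diag_mx D) *m (c'%:M - diag_mx D)) *m P.
  have E b : b%:M - A = invmx P *m (b%:M - diag_mx D) *m P.
    by rewrite AE {1}(cP b) mulmxBr mulmxBl.
  split=> //; rewrite !E -!mulmxA; congr (_ *m (_ *m _)).
  by rewrite (mulmxA P) mulmxV// mul1mx.
exists #|[pred i | D 0 i == la]|; split.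
- by rewrite -[n in (_ <= n)%N]card_ord; exact: max_card.
- have [_ ->] := D3 la mu.
  have -> : (la%:M - diag_mx D) *m (mu%:M - diag_mx D) = 0.
    rewrite -!diag_const_mx -!raddfB /= mulmx_diag -[RHS](raddf0 (@diag_mx R n)).
    congr diag_mx; apply/rowP => i; rewrite !mxE; apply/eqP.
    rewrite mulf_eq0 !subr_eq0 ![_ == D 0 i]eq_sym.
    by have [->|->] := DE i; rewrite eqxx ?orbT.
  by rewrite mulmx0 mul0mx.
- rewrite AE trP mxtrace_diag -sum_if_card; apply: eq_bigr => i _; exact: D2.
- have -> : A *m A = invmx P *m (diag_mx D *m diag_mx D) *m P.
    by rewrite AE -!mulmxA (mulmxA P) mulmxV// mul1mx.
  rewrite trP.
  rewrite mulmx_diag mxtrace_diag -sum_if_card; apply: eq_bigr => i _.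
  by rewrite mxE -expr2 {1}[D 0 i]D2; case: ifP.
- split.
  + move=> cn; have [+ _] := D3 la la; rewrite (_ : la%:M - diag_mx D = 0); last first.
      rewrite -diag_const_mx -raddfB /= -[RHS](raddf0 (@diag_mx R n)).
      congr diag_mx; apply/rowP => i; rewrite !mxE; apply/eqP; rewrite subr_eq0 eq_sym.
      have /subset_cardP/(_ (subset_predT _)) := etrans cn (esym (card_ord n)).
      by move/(_ i); rewrite !inE.
    by rewrite mulmx0 mul0mx => /eqP; rewrite subr_eq0 eq_sym => /eqP.
  + move=> /card0_eq c0; have [+ _] := D3 mu mu; rewrite (_ : mu%:M - diag_mx D = 0); last first.
      rewrite -diag_const_mx -raddfB /= -[RHS](raddf0 (@diag_mx R n)).
      congr diag_mx; apply/rowP => i; rewrite !mxE; apply/eqP; rewrite subr_eq0 D2.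
      by have := c0 i; rewrite inE => ->.
    by rewrite mulmx0 mul0mx => /eqP; rewrite subr_eq0 eq_sym => /eqP.
  + move=> lm; rewrite -[RHS]card_ord; apply: eq_card => i; rewrite !inE.
    by have [->|->] := DE i; rewrite ?lm eqxx.
Qed.

(** Continuity removes from the list, one after the other, the values different from [g u]. *)
Lemma locally_constant_finite {V : normedModType R} (g : V -> R) (u : V) (s : seq R) :
  {for u, continuous g} -> (\forall y \near u, g y \in s) -> \forall y \near u, g y = g u.
Proof.
move=> cg gs; have : \forall y \near u, g y = g u \/ g y \in s.
  by apply: filterS gs => y; right.
elim: s {gs} => [|a s IH] gs; first by apply: filterS gs => y [].
apply: IH; have [ga|ga] := eqVneq (g u) a.
  apply: filterS gs => y [|]; first by left.
  by rewrite in_cons ga => /orP[/eqP|]; [left|right].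
have d0 : 0 < `|g u - a| by rewrite normr_gt0 subr_eq0.
move/cvgrPdist_lt : cg => /(_ _ d0) cg.
apply: filterS2 gs cg => y [|]; first by left.
by rewrite in_cons => /orP[/eqP ->|]; [rewrite ltxx|right].
Qed.

End Pointwise.

(** The property and its negation both hold on open sets. *)
Lemma connected_propagation (M : topologicalType) (C : M -> Prop) :
  connected [set: M] ->
  (forall p, exists U, [/\ open U, U p & forall q, U q -> (C q <-> C p)]) ->
  forall p0, C p0 -> forall p, C p.
Proof.
move=> cM loc p0 Cp0 p.
have oC (D : M -> Prop) : (forall p, exists U, [/\ open U, U p & forall q, U q -> (D q <-> D p)]) ->
    open [set q | D q].
  move=> locD; rewrite openE => q Dq; have [U [oU Uq UC]] := locD q.
  by apply: filterS (open_nbhs_nbhs (conj oU Uq)) => z /UC[_]; apply.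
have CT : [set q | C q] = [set: M].
  apply: cM; first by exists p0.
    by exists [set q | C q]; rewrite ?setTI//; exact: oC.
  exists [set q | C q]; rewrite ?setTI//.
  rewrite -[X in closed X]setCK closedC; apply: (oC (fun q => ~ C q)) => q.
  have [U [oU Uq UC]] := loc q; exists U; split=> // z /UC zq.
  by split=> h1 h2; apply: h1; apply/zq.
by have : [set q | C q] p by rewrite CT.
Qed.

(** * Change of chart and of unit normal *)

Section Comparison.
Context {R : realType} (c0 : bool) (t m : nat).

(** Both normals are orthogonal to the same position and tangent vectors, so one is [al] times the
    other. Square norms give [al * al = 1] and equal [eps]; being continuous, [al] is constant near
    [w], and the relation can be differentiated with [al] as a constant. *)
Lemma normal_comparison
    (Phix Phiy etax etay : 'rV[R]_m -> 'rV[R]_(c0 + m.+1))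
    (Ox Oy W : set 'rV[R]_m) (epsx epsy : R) (psi : 'rV[R]_m -> 'rV[R]_m) w :
  hypersurface_patch t Phix Ox epsx etax ->
  hypersurface_patch t Phiy Oy epsy etay ->
  open W -> W w -> W `<=` Oy ->
  (forall z, W z -> [/\ differentiable psi z, Ox (psi z) & Phiy z = Phix (psi z)]) ->
  exists (C : 'M[R]_m) (s : R), [/\ C \in unitmx, s = 1 \/ s = -1, epsx = epsy,
    etay w = s *: etax (psi w) &
    forall v, dder v Phiy w = dder (v *m C) Phix (psi w) /\
              dder v etay w = s *: dder (v *m C) etax (psi w)].
Proof.
move=> Hx Hy oW Ww WOy HW.
have dpsi z v : W z -> dder v psi z = v *m jacobian psi z.
  by move=> /HW[dz _ _]; rewrite dderE deriveEjacobian.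
have dc (f : 'rV[R]_m -> 'rV[R]_(c0 + m.+1)) z v : smooth_on Ox f -> W z ->
    differentiable (fun y => f (psi y)) z /\
    dder v (fun y => f (psi y)) z = dder (v *m jacobian psi z) f (psi z).
  move=> sf Wz; have [dz Oz _] := HW _ Wz.
  have [d e] := dder_comp v dz (smooth_differentiable sf Oz).
  by split=> //; rewrite e dpsi.
have dPhiE z v : W z -> dder v Phiy z = dder (v *m jacobian psi z) Phix (psi z).
  move=> Wz; have [_ <-] := dc Phix z v (patch_smooth Hx) Wz.
  by apply: dder_eq_on oW Wz _ => y /HW[].
have uC z : W z -> jacobian psi z \in unitmx.
  move=> Wz; rewrite -row_free_unit -kermx_eq0; apply/rowV0P => v /sub_kermxP vC.
  by apply: (jacobian_free Hy (WOy _ Wz)); rewrite dPhiE// vC dder_dir0.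
pose al z := epsx * inner t (etay z) (etax (psi z)).
have etaE z : W z -> etay z = al z *: etax (psi z).
  move=> Wz; have [_ Oz Phiz] := HW _ Wz; have Oyz := WOy _ Wz.
  apply/eqP; rewrite -subr_eq0; apply/eqP/(ambient_eq0 Hx Oz).
  - move=> c; rewrite innerBl innerZl -Phiz innerC (position_normal Hy Oyz c) Phiz.
    by rewrite innerC (position_normal Hx Oz c) mulr0 subr0.
  - by rewrite innerBl innerZl (normal_norm Hx Oz) /al mulrAC (patch_eps2 Hx) mul1r subrr.
  - move=> v; rewrite innerBl innerZl (innerC _ (etax _)) (dPhi_normal Hx _ Oz) mulr0 subr0.
    by rewrite innerC -[v](mulmxKV (uC z Wz)) -dPhiE// (dPhi_normal Hy _ Oyz).
have alE z : W z -> epsy = al z * al z * epsx.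
  move=> Wz; have [_ Oz _] := HW _ Wz.
  rewrite -(normal_norm Hy (WOy _ Wz)) {1 2}etaE// innerZl innerZr.
  by rewrite (normal_norm Hx Oz) mulrA.
have epsE : epsx = epsy.
  have := alE w Ww; have : 0 <= al w * al w by rewrite -expr2 sqr_ge0.
  have [[->|->] _ _] := patch_normal Hx; have [[->|->] _ _] := patch_normal Hy; lra.
have al1 z : W z -> al z = 1 \/ al z = -1.
  move=> Wz; have := alE z Wz; rewrite -epsE -[LHS]mul1r.
  move/(mulIf (patch_eps_neq0 Hx))/esym/eqP; rewrite -expr2 sqrf_eq1.
  by case/orP => /eqP; [left|right].
have dal : differentiable al w.
  apply: differentiableM => //; apply: differentiable_inner.
    exact: smooth_differentiable (patch_smooth_normal Hy) (WOy _ Ww).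
  by have [] := dc etax w 0 (patch_smooth_normal Hx) Ww.
have nal : \forall z \near w, al z = al w.
  apply: (@locally_constant_finite _ _ al w [:: 1; -1]).
    exact: differentiable_continuous.
  apply: near_open oW Ww _ => z /al1[]->; by rewrite !inE eqxx ?orbT.
exists (jacobian psi w), (al w); split; [exact: uC|exact: al1|by []|exact: etaE|].
move=> v; split; first exact: dPhiE.
have [de <-] := dc etax w v (patch_smooth_normal Hx) Ww.
rewrite -dderZ// !dderE; apply: near_eq_derive.
have nW : \forall z \near w, W z by exact: open_nbhs_nbhs.
by apply: filterS2 nal nW => z <- Wz; exact: etaE.
Qed.

Lemma shape_comparison (Phix Phiy etax etay : 'rV[R]_m -> 'rV[R]_(c0 + m.+1))
    (Ox Oy : set 'rV[R]_m) (epsx epsy : R) u w (C : 'M[R]_m) (s : R) :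
  hypersurface_patch t Phix Ox epsx etax -> hypersurface_patch t Phiy Oy epsy etay ->
  Ox u -> Oy w -> C \in unitmx ->
  (forall v, dder v Phiy w = dder (v *m C) Phix u /\
             dder v etay w = s *: dder (v *m C) etax u) ->
  shape_operator t Phiy etay w = s *: (C *m shape_operator t Phix etax u *m invmx C).
Proof.
move=> Hx Hy Ou Ow uC E.
have Ex v := shapeE Hx v Ou; have Ey v := shapeE Hy v Ow.
move: (shape_operator t Phix etax u) (shape_operator t Phiy etay w) Ex Ey => Ax Ay Ex Ey.
have dPx := smooth_differentiable (patch_smooth Hx) Ou.
suff AyC : Ay *m C = s *: (C *m Ax) by rewrite -[Ay](mulmxK uC) AyC -scalemxAl.
apply/row_matrixP => i; rewrite !rowE; apply/eqP; rewrite -subr_eq0; apply/eqP.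
apply: (jacobian_free Hx Ou); rewrite dder_dirD// dder_dirN//.
have [_ e] := E 'e_i; have [e' _] := E ('e_i *m Ay); move: e.
rewrite Ey e' Ex scalerN => /oppr_inj.
by rewrite -!mulmxA -dder_dirZ// scalemxAr => ->; rewrite subrr.
Qed.

End Comparison.

Section Restriction.
Context {R : realType} (c0 : bool) (t m : nat).
Context (Phi : 'rV[R]_m -> 'rV[R]_(c0 + m.+1)).

Lemma sub_patch (O B : set 'rV[R]_m) eps eta : open B -> B `<=` O ->
  hypersurface_patch t Phi O eps eta -> hypersurface_patch t Phi B eps eta.
Proof.
move=> oB BO [oO sP sph met [e2 se no]]; split=> //.
- exact: smooth_subset BO sP.
- by move=> u /BO; exact: sph.
- by move=> u /BO; exact: met.
- by split=> //; [exact: smooth_subset BO se|move=> u /BO; exact: no].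
Qed.

Lemma sub_frame (O B : set 'rV[R]_m) epsi e : B `<=` O ->
  orthonormal_frame t Phi O epsi e -> orthonormal_frame t Phi B epsi e.
Proof.
move=> BO [h1 h2 h3]; split=> //; last by move=> u /BO; exact: h3.
by move=> i; exact: smooth_subset BO (h2 i).
Qed.

End Restriction.

Lemma multiplicity_unique {R : realType} (la mu : R) m k k' :
  (k <= m)%N -> (k' <= m)%N -> la != mu ->
  k%:R * la + (m - k)%:R * mu = k'%:R * la + (m - k')%:R * mu -> k = k'.
Proof.
move=> km km' lm; rewrite !natrB// => E.
have : (k%:R - k'%:R) * (la - mu) = 0 :> R by lra.
by move=> /eqP; rewrite mulf_eq0 !subr_eq0 (negbTE lm) orbF eqr_nat => /eqP.
Qed.

(** * Local constancy of the multiplicities and the r-harmonic equation *)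

Section Global.
Context {R : realType} (r m t t' : nat) (c0 : bool) (M : topologicalType).
Context (atlas : set (chart R M m)) (phi : M -> 'rV[R]_(c0 + m.+1)) (la mu : R).
Local Notation Phi x := (phi \o chart_inv x).
Hypothesis Hman : smooth_manifold atlas.
Hypothesis Hhyp : pseudo_hypersurface t atlas phi t'.

Let chartP x : atlas x -> is_chart x.
Proof. exact: atlas_chart Hman x. Qed.

Lemma atlas_patch x O eps eta : atlas x -> open O -> O `<=` chart_img x ->
  unit_normal t (Phi x) O eps eta -> hypersurface_patch t (Phi x) O eps eta.
Proof.
move=> ax oO Ox un; have [sph /(_ _ ax)[sP imm]] := Hhyp.
split=> //; first exact: smooth_subset Ox sP.
- by move=> u _; exact: sph.
- by move=> u /Ox /imm[].
Qed.

Lemma chart_comparison p x y Ox Oy epsx epsy etax etay :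
  atlas x -> atlas y -> chart_dom x p -> chart_dom y p ->
  hypersurface_patch t (Phi x) Ox epsx etax ->
  hypersurface_patch t (Phi y) Oy epsy etay ->
  Oy `<=` chart_img y -> Ox (chart_map x p) -> Oy (chart_map y p) ->
  let u := chart_map x p in let w := chart_map y p in
  exists (C : 'M[R]_m) (s : R), [/\ C \in unitmx, s = 1 \/ s = -1, epsx = epsy,
    etay w = s *: etax u &
    forall v, dder v (Phi y) w = dder (v *m C) (Phi x) u /\
              dder v etay w = s *: dder (v *m C) etax u].
Proof.
move=> ax ay xp yp Hx Hy Oyi Oxp Oyp u w.
have cx := chartP ax; have cy := chartP ay.
pose D := chart_dom x `&` chart_map x @^-1` Ox.
have oD : open D by exact: chart_preimage_open cx _ (patch_open Hx).
pose W := Oy `&` chart_inv y @^-1` D.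
have psiw : (chart_map x \o chart_inv y) w = u by rewrite /= /w chart_invK.
have := @normal_comparison R c0 t m (Phi x) (Phi y) etax etay Ox Oy W epsx epsy
  (chart_map x \o chart_inv y) w Hx Hy.
rewrite psiw; apply.
- rewrite openE => z [Oz Dz]; apply: filterI.
    by apply: open_nbhs_nbhs; split=> //; exact: patch_open Hy.
  exact: (chart_inv_continuous cy (Oyi _ Oz)) (open_nbhs_nbhs (conj oD Dz)).
- by split=> //; rewrite /D /= chart_invK.
- by move=> z [].
- move=> z [Oz [xz Oxz]]; split=> //; last by rewrite /= chart_invK.
  have sm := atlas_compatible Hman ay ax.
  apply: (smooth_differentiable sm).
  have [q yq qz] := Oyi _ Oz; exists q => //; split=> //.
  by move: xz; rewrite -qz chart_invK.
Qed.

Hypothesis Hdiag : diagonalizable_shape_operator t atlas phi.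
Hypothesis H2 : forall x, atlas x -> forall u, chart_img x u ->
  exists O eps eta, [/\ open O, O u, O `<=` chart_img x,
    unit_normal t (Phi x) O eps eta
  & forall v, O v -> forall a,
    eigenvalue (shape_operator t (Phi x) eta v) a -> a = la \/ a = mu].
Hypothesis Hpoly : polyharmonic t atlas phi r.

(* k is the multiplicity of la on the ball B. *)
Record local_data p x B eps eta epsi e k : Prop := LocalData {
  data_atlas : atlas x;
  data_dom : chart_dom x p;
  data_ball : exists2 rho : R, 0 < rho & B = ball (chart_map x p) rho;
  data_sub : B `<=` chart_img x;
  data_patch : hypersurface_patch t (Phi x) B eps eta;
  data_frame : orthonormal_frame t (Phi x) B epsi e;
  data_poly : forall y, B y -> polytension t (Phi x) epsi e r y = 0;
  data_le : (k <= m)%N;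
  data_shape : forall y, B y -> let A := shape_operator t (Phi x) eta y in
    [/\ (la%:M - A) *m (mu%:M - A) = 0,
        \tr A = k%:R * la + (m - k)%:R * mu,
        \tr (A *m A) = k%:R * la ^+ 2 + (m - k)%:R * mu ^+ 2,
        k = m -> A = la%:M & k = 0%N -> A = mu%:M];
  data_eq : la = mu -> k = m }.

(** As the multiplicities are integers, the continuous trace has finitely many possible values and
    is constant on a ball; for [la != mu] it determines the multiplicity, and for [la = mu] the
    convention [k = m] does. *)
Lemma local_data_exists p : exists x B eps eta epsi e k, local_data p x B eps eta epsi e k.
Proof.
have [x ax xp] := atlas_cover Hman p.
have xu : chart_img x (chart_map x p) by exists p.
set u := chart_map x p in xu *.
have [U1 [eps [eta [oU1 U1u U1x un ev]]]] := H2 ax xu.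
have [U2 [epsi [e [oU2 U2u U2x fr pt]]]] := Hpoly ax xu.
have H1 := atlas_patch ax oU1 U1x un.
pose O := U1 `&` U2.
have oO : open O by exact: openI.
have Ou : O u by [].
have U1sub : O `<=` U1 by move=> ? [].
have U2sub : O `<=` U2 by move=> ? [].
have HO := sub_patch oO U1sub H1; have FO := sub_frame U2sub fr.
have pw y : U1 y -> let A := shape_operator t (Phi x) eta y in
  exists k, [/\ (k <= m)%N, (la%:M - A) *m (mu%:M - A) = 0,
    \tr A = k%:R * la + (m - k)%:R * mu,
    \tr (A *m A) = k%:R * la ^+ 2 + (m - k)%:R * mu ^+ 2 &
    [/\ k = m -> A = la%:M, k = 0%N -> A = mu%:M & la = mu -> k = m]] :=
  fun Oy => diagonalizable_two_eigenvalues (Hdiag ax oU1 U1x un Oy) (ev _ Oy).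
(* In the frame the trace is a sum of products of differentiable functions. *)
have dT : differentiable (fun y => \tr (shape_operator t (Phi x) eta y)) u.
  apply: (differentiable_eq_on (g := fun y => - \sum_i epsi i *
     inner t (dder (e i y) (Phi x) y) (dder (e i y) eta y)) oO Ou).
    by move=> y Oy; rewrite (frame_trace_shape HO FO Oy) opprK.
  apply: differentiableN; apply: differentiable_sumE => i; apply: differentiableM => //.
  have de := differentiable_frame FO i Ou.
  apply: differentiable_inner.
    exact: (differentiable_dder_dir oO (patch_smooth HO) Ou de).
  exact: (differentiable_dder_dir oO (patch_smooth_normal HO) Ou de).
have nT : \forall y \near u, \tr (shape_operator t (Phi x) eta y) =
                             \tr (shape_operator t (Phi x) eta u).
  apply: (locally_constant_finite
    (s := [seq k%:R * la + (m - k)%:R * mu | k <- iota 0 m.+1])).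
    exact: differentiable_continuous.
  apply: near_open oO Ou _ => y [/pw[k [km _ -> _ _]] _].
  by apply/mapP; exists k => //; rewrite mem_iota.
have : \forall y \near u, O y /\ \tr (shape_operator t (Phi x) eta y) =
                             \tr (shape_operator t (Phi x) eta u).
  have nO : nbhs u O by exact: open_nbhs_nbhs.
  exact: (filterI nO nT).
move=> /nbhs_ballP[rho /= rho0 rhoP].
have [k [km _ Tu _ [_ _ keq]]] := pw u U1u.
pose B := ball u rho.
have oB : open B by exact: ball_open.
have BO : B `<=` O by move=> y /rhoP[].
exists x, B, eps, eta, epsi, e, k; split.
- exact: ax.
- exact: xp.
- by exists rho.
- by move=> y /BO/U1sub/U1x.
- exact: sub_patch oB BO HO.
- exact: sub_frame BO FO.
- by move=> y /BO/U2sub/pt.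
- exact: km.
- move=> y By; have [Oy Ty] := rhoP _ By.
  have [k' [km' pol Ty' Ay' [h1 h2 h3]]] := pw y (U1sub _ Oy).
  suff kk : k' = k.
    rewrite kk in pol Ty' Ay' h1 h2.
    by split; [exact: pol|exact: Ty'|exact: Ay'|exact: h1|exact: h2].
  have [lm|lm] := eqVneq la mu; first by rewrite (h3 lm) (keq lm).
  exact: (multiplicity_unique km' km lm (etrans (esym Ty') (etrans Ty Tu))).
- exact: keq.
Qed.

Lemma data_center p x B eps eta epsi e k :
  local_data p x B eps eta epsi e k -> B (chart_map x p).
Proof. by case=> _ _ [rho rho0 ->] *; exact: ballxx. Qed.

Lemma data_open p x B eps eta epsi e k :
  local_data p x B eps eta epsi e k ->
  open (chart_dom x `&` chart_map x @^-1` B).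
Proof.
move=> D; apply: chart_preimage_open; first exact: chartP (data_atlas D).
exact: patch_open (data_patch D).
Qed.

(** Only the vanishing of the trace is recorded, since its sign changes with the unit normal. *)
Definition trace_at p (z : bool) := exists x O eps eta,
  [/\ atlas x, chart_dom x p, O (chart_map x p), O `<=` chart_img x &
    hypersurface_patch t (Phi x) O eps eta /\
    (\tr (shape_operator t (Phi x) eta (chart_map x p)) == 0) = z].

Lemma trace_at_unique p z z' : trace_at p z -> trace_at p z' -> z = z'.
Proof.
move=> [x [U [eps [eta [ax xp Uu Ux [H <-]]]]]].
move=> [y [V [eps' [eta' [ay yp Vu Vy [H' <-]]]]]].
have [C [s [uC s1 _ _ E]]] := chart_comparison ax ay xp yp H H' Vy Uu Vu.
rewrite (shape_comparison H H' Uu Vu uC E); move: (shape_operator _ _ _ _) => A.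
rewrite mxtraceZ mxtrace_mulC mulmxA mulVmx// mul1mx.
by rewrite mulf_eq0; case: s1 => ->; rewrite ?oppr_eq0 oner_eq0.
Qed.

Lemma data_trace_at p x B eps eta epsi e k q :
  local_data p x B eps eta epsi e k -> (chart_dom x `&` chart_map x @^-1` B) q ->
  trace_at q (k%:R * la + (m - k)%:R * mu == 0).
Proof.
move=> D [xq Bq]; exists x, B, eps, eta; split=> //.
- exact: data_atlas D.
- exact: data_sub D.
- split; first exact: data_patch D.
  by have [_ -> _ _ _] := data_shape D Bq.
Qed.

Lemma nowhere_minimal : connected [set: M] -> ~ minimal t atlas phi ->
  forall p x B eps eta epsi e k, local_data p x B eps eta epsi e k ->
  k%:R * la + (m - k)%:R * mu != 0.
Proof.
move=> cM nmin.
have [p0 Tp0] : exists p, trace_at p false.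
  apply: contrapT => h; apply: nmin => x ax O eps eta oO Ox un u Ou.
  have [p xp pu] := Ox _ Ou.
  rewrite /mean_curvature; apply/eqP; rewrite mulf_eq0; apply/orP; right.
  apply: contrapT => /negP/negbTE tn; apply: h; exists p, x, O, eps, eta.
  rewrite pu; split; [exact: ax|exact: xp|exact: Ou|exact: Ox|].
  by split; [exact: atlas_patch|exact: tn].
have := @connected_propagation M (fun p => trace_at p false) cM.
move=> /(_ _ p0 Tp0) all p x B eps eta epsi e k D.
apply/negP => /eqP T0; have := @data_trace_at p x B eps eta epsi e k p D.
rewrite T0 eqxx => /(_ (conj (data_dom D) (data_center D))) Tp.
suff h : forall q, exists U : set M, [/\ open U, U q &
    forall q', U q' -> (trace_at q' false <-> trace_at q false)].
  by have := trace_at_unique Tp (all h p).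
move=> {Tp T0 p x B eps eta epsi e k D} p.
have [x [B [eps [eta [epsi [e [k D]]]]]]] := local_data_exists p.
exists (chart_dom x `&` chart_map x @^-1` B); split.
- exact: data_open D.
- by split; [exact: data_dom D|exact: data_center D].
- move=> q Uq; have Tq := data_trace_at D Uq.
  have Tp := data_trace_at D (conj (data_dom D) (data_center D)).
  by split=> Th; [rewrite (trace_at_unique Th Tq)|rewrite (trace_at_unique Th Tp)].
Qed.

(** Everything rests on [a > 0]: [a] is a sum of squares that vanishes only together with [T]. In
    flat space the equation would read [(eps * a) ^+ 2 = 0], and for [eps = -1] it would equate the
    positive [a ^+ 2] with a nonpositive number. *)
Lemma polyharmonic_equation p x B eps eta epsi e k : (3 <= r)%N ->
  local_data p x B eps eta epsi e k ->
  let T := k%:R * la + (m - k)%:R * mu in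
  let a := k%:R * la ^+ 2 + (m - k)%:R * mu ^+ 2 in
  T != 0 ->
  [/\ c0, eps = 1 & a ^+ 2 - m%:R * a - (r - 2)%:R * T ^+ 2 = 0].
Proof.
move=> r3 D T a Tn0; have Bp := data_center D; have HP := data_patch D.
have := polytensionE HP (data_frame D) Bp (T := T) (a := a) _ _ r3.
rewrite (data_poly D Bp) => /(_ _ _)/esym/eqP.
have AT y : B y -> \tr (shape_operator t (Phi x) eta y) = T.
  by move=> By; have [] := data_shape D By.
have Aa y : B y -> \tr (shape_operator t (Phi x) eta y *m shape_operator t (Phi x) eta y) = a.
  by move=> By; have [] := data_shape D By.
move=> /(_ AT Aa).
have eta0 : eta (chart_map x p) != 0.
  apply: contraNneq (patch_eps_neq0 HP) => e0.
  by rewrite -(normal_norm HP Bp) e0 inner0l.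
rewrite scaler_eq0 (negbTE eta0) orbF !mulf_eq0 (negbTE Tn0) (negbTE (patch_eps_neq0 HP)) !orbF.
have a0 : 0 < a.
  have k2 : 0 <= k%:R * la ^+ 2 :> R by rewrite mulr_ge0// sqr_ge0.
  have m2 : 0 <= (m - k)%:R * mu ^+ 2 :> R by rewrite mulr_ge0// sqr_ge0.
  rewrite lt_neqAle addr_ge0// andbT eq_sym paddr_eq0// !mulf_eq0 !orbb.
  apply: contra Tn0 => /andP[/orP[]/eqP h1 /orP[]/eqP h2];
    by rewrite /T h1 h2 ?mulr0 ?mul0r addr0.
have ea0 : eps * a != 0 by rewrite mulf_neq0 ?(patch_eps_neq0 HP)// gt_eqF.
case/orP => [|/eqP E].
  by rewrite expf_eq0 (negbTE ea0) andbF.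
have e2 := patch_eps2 HP.
have rpos : 0 <= (r - 2)%:R :> R by [].
have mpos : 0 <= m%:R :> R by [].
have T2 : 0 <= T ^+ 2 by rewrite sqr_ge0.
have rT : 0 <= (r - 2)%:R * T ^+ 2 by rewrite mulr_ge0.
have ma : 0 <= m%:R * a by rewrite mulr_ge0// ltW.
have aa : 0 < a ^+ 2 by rewrite exprn_gt0.
have c0T : c0.
  apply: contraT => /negbTE c0F; move: E; rewrite c0F !mul0r !subr0 => /eqP.
  by rewrite expf_eq0 (negbTE ea0) andbF.
have E' : a ^+ 2 = eps * (m%:R * a + (r - 2)%:R * T ^+ 2).
  have -> : a ^+ 2 = (eps * a) ^+ 2 by rewrite exprMn (expr2 eps) e2 mul1r.
  move: E; rewrite (natr_true R c0T); lra.
have eps1 : eps = 1.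
  have [[//|em] _ _] := patch_normal HP.
  by move: E'; rewrite em; lra.
by split=> //; rewrite E' eps1; ring.
Qed.

End Global.

(** * Congruence with the models *)

Section CurvatureAlgebra.
Context {R : realType}.
Implicit Types (K L N la mu : R).

Lemma gauss_curvatures la mu : 1 + la * mu = 0 -> la != 0 /\ mu = - la^-1.
Proof.
move=> E; have la0 : la != 0.
  by apply/eqP => l0; move: E; rewrite l0 mul0r addr0; apply/eqP; rewrite oner_eq0.
split=> //; apply: (mulfI la0); rewrite mulrN divff//; lra.
Qed.

(** With [mu = - la^-1] and [x = la ^+ 2], the identity [K x^2 + L - (K + L) x = (K x - L) (x - 1)]
    shows that [K x - L] divides the equation. This factor is [la] times the trace, so it can be
    cancelled. *)
Lemma two_curvatures_equation K L N la mu : 1 + la * mu = 0 ->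
  K * la + L * mu != 0 ->
  (K * la ^+ 2 + L * mu ^+ 2) ^+ 2 - (K + L) * (K * la ^+ 2 + L * mu ^+ 2)
    - N * (K * la + L * mu) ^+ 2 = 0 ->
  (K * (la ^+ 2) ^+ 2 + L) * (la ^+ 2 - 1) = N * la ^+ 2 * (K * la ^+ 2 - L).
Proof.
move=> /gauss_curvatures[la0 ->] T0 E.
have z : la * (K * la + L * - la^-1) != 0 by rewrite mulf_neq0.
apply: (mulfI z); apply/eqP; rewrite -subr_eq0; apply/eqP.
transitivity (la ^+ 4 * ((K * la ^+ 2 + L * (- la^-1) ^+ 2) ^+ 2
   - (K + L) * (K * la ^+ 2 + L * (- la^-1) ^+ 2)
   - N * (K * la + L * - la^-1) ^+ 2)); last by rewrite E mulr0.
by field.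
Qed.

(** In the application [K = k], [K + L = m] and [N + 2 = r]. *)
Lemma two_curvatures_cubic K L N la (c := 1 + la ^+ 2) :
  (K * (la ^+ 2) ^+ 2 + L) * (la ^+ 2 - 1) = N * la ^+ 2 * (K * la ^+ 2 - L) ->
  K * c ^+ 3 - K * (N + 2 + 2) * c ^+ 2
    + ((K + L) * (N + 2 - 1) + K * (N + 2 + 2)) * c - (K + L) * (N + 2) = 0.
Proof. by rewrite /c => E; move/eqP: E; rewrite -subr_eq0 => /eqP <-; ring. Qed.

Lemma umbilic_equation K N la : 0 < K -> la != 0 ->
  (K * la ^+ 2) ^+ 2 - K * (K * la ^+ 2) - N * (K * la) ^+ 2 = 0 ->
  la ^+ 2 = N + 1.
Proof.
move=> K0 la0 E; have z : K ^+ 2 * la ^+ 2 != 0.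
  by rewrite mulf_neq0 ?expf_neq0 ?(lt0r_neq0 K0).
apply: (mulfI z); apply/eqP; rewrite -subr_eq0; apply/eqP; rewrite -[RHS]E; ring.
Qed.

(** [N + 1] is the squared curvature of an umbilic ball. With [x = la ^+ 2], substitution leaves
    [N L (1 + x) = 0] in the first case, and [(1 - x) K (1 + x) = 0] with [x < 1] in the second. *)
Lemma two_curvatures_not_umbilic K L N la mu : 0 < K -> 0 < L -> 0 < N ->
  1 + la * mu = 0 ->
  (K * (la ^+ 2) ^+ 2 + L) * (la ^+ 2 - 1) = N * la ^+ 2 * (K * la ^+ 2 - L) ->
  la ^+ 2 <> N + 1 /\ mu ^+ 2 <> N + 1.
Proof.
move=> K0 L0 N0 /gauss_curvatures[la0 ->].
have : 0 < la ^+ 2 by rewrite exprn_even_gt0.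
rewrite sqrrN exprVn; move: (la ^+ 2) => x x0 E; split=> h.
  have : N * (L * (1 + x)) = 0 by move: E; rewrite h; lra.
  by apply/eqP; rewrite !mulf_neq0 ?gt_eqF// addr_gt0.
have NE : N = x^-1 - 1 by lra.
have : (1 - x) * (K * (1 + x)) = 0.
  have : x * ((K * x ^+ 2 + L) * (x - 1)) = x * (N * x * (K * x - L)) by rewrite E.
  have -> : x * (N * x * (K * x - L)) = x * (1 - x) * (K * x - L).
    by rewrite NE; field; rewrite gt_eqF.
  move=> E2; apply: (mulfI (lt0r_neq0 x0)); apply: (mulfI (lt0r_neq0 x0)); lra.
have x1 : x < 1.
  have Nx : 0 < N * x by rewrite mulr_gt0.
  have : x * (N + 1) = 1 by rewrite -h divff ?lt0r_neq0.
  lra.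
by apply/eqP; rewrite !mulf_neq0 ?lt0r_neq0 ?subr_gt0 ?addr_gt0.
Qed.

(** For fixed [m = K + L] the equation is affine in [K]: [K (x + 1) ((x - 1)^2 - N x) + m (x - 1 + N
    x) = 0], where [x = la ^+ 2]. Two solutions would make both coefficients vanish, so
    [N x = 1 - x] and [(N x)^2 = N x]; this gives [N x = 1] and [x = 0]. *)
Lemma two_curvatures_multiplicity K L K' L' N la : 0 < N -> la != 0 ->
  0 < K + L -> K + L = K' + L' ->
  (K * (la ^+ 2) ^+ 2 + L) * (la ^+ 2 - 1) = N * la ^+ 2 * (K * la ^+ 2 - L) ->
  (K' * (la ^+ 2) ^+ 2 + L') * (la ^+ 2 - 1) = N * la ^+ 2 * (K' * la ^+ 2 - L') ->
  K = K'.
Proof.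
move=> N0 la0 m0 Em; have : 0 < la ^+ 2 by rewrite exprn_even_gt0.
move: (la ^+ 2) => x x0 E E'; apply/eqP; rewrite -subr_eq0; apply: contraTT m0 => KK'.
have LE : L' = K + L - K' by lra.
have a0 : (x - 1) ^+ 2 = N * x.
  have x10 : x + 1 != 0 by rewrite gt_eqF// addr_gt0.
  apply: (mulfI KK'); apply: (mulfI x10); move: E'; rewrite LE => E'.
  by apply/eqP; rewrite -subr_eq0; apply/eqP; lra.
have : (K + L) * (x - 1 + N * x) = 0.
  suff : (K + L) * (x - 1 + N * x) = K * (x + 1) * (N * x - (x - 1) ^+ 2).
    by rewrite a0 subrr mulr0.
  by apply/eqP; rewrite -subr_eq0; apply/eqP; lra.
move/eqP; rewrite mulf_eq0 => /orP[/eqP->|/eqP b0]; first by rewrite ltxx.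
have : N * x * (N * x - 1) = 0.
  have -> : N * x * (N * x - 1) = (N * x) ^+ 2 - N * x by ring.
  have Nx1 : N * x = - (x - 1) by lra.
  by rewrite {1}Nx1 sqrrN a0 subrr.
have Nx : 0 < N * x by rewrite mulr_gt0.
move/eqP; rewrite mulf_eq0 (gt_eqF Nx) /= => /eqP Nx1; lra.
Qed.

End CurvatureAlgebra.

(** * Congruence of a single patch with the model *)

Section TorusModel.
Context {R : realType} (t m : nat).
Context (Phi eta : 'rV[R]_m -> 'rV[R]_(true + m.+1)) (O : set 'rV[R]_m) (la mu : R).
Hypothesis HP : hypersurface_patch t Phi O 1 eta.
Hypothesis lamu : la != mu.
Hypothesis Apoly : forall u, O u ->
  (la%:M - shape_operator t Phi eta u) *m (mu%:M - shape_operator t Phi eta u) = 0.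
Hypothesis lamu1 : 1 + la * mu = 0.

Lemma proj_constant epsi e u0 rho : 0 < rho -> O = ball u0 rho ->
  orthonormal_frame t Phi O epsi e ->
  forall u, O u -> proj_spec Phi eta la mu u (focal_proj t Phi eta la mu epsi e u0).
Proof.
move=> rho0 OE He u Ou.
suff <- : focal_proj t Phi eta la mu epsi e u = focal_proj t Phi eta la mu epsi e u0.
  exact: (focal_projE HP lamu1 He Ou).
apply: (dder_constant (r := rho)); rewrite -OE; last exact: Ou.
- by move=> y Oy; exact: (differentiable_proj la mu HP He Oy).
- by move=> y Oy v; exact: (dder_proj HP lamu Apoly lamu1 He v Oy).
Qed.

(** For [mu = - la^-1] the constants of [product_quadric] become [1 / c] and [(c - 1) / c] with
    [c = 1 + la ^+ 2]. The factor [b] normalises [P], whose square norm is [c]; its sign is left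
    open so that the last coordinate can be adjusted in the umbilic case. *)
Lemma torus_coordinates k u S b : (k <= m)%N -> (t <= m.+2)%N -> O u ->
  proj_spec Phi eta la mu u S -> \tr S = (m - k + 1)%:R ->
  b ^+ 2 * (1 + la ^+ 2) = 1 ->
  exists l (A : 'M[R]_(true + m.+1)),
  [/\ (l <= k)%N, (l <= t)%N, (t - l <= m - k)%N & A *m gram t *m A^T = gram t] /\
  [/\ forall x, product_quadric t la mu S x <->
        pseudo_clifford_torus (true + m.+1) t k l (1 + la ^+ 2) (x *m A)
    & k = m -> forall x, (x *m A) 0 ord_max = inner t x (b *: focal Phi eta la u)].
Proof.
move=> km tm Ou HS trS bE; have [la0 muE] := gauss_curvatures lamu1.
have Sid := proj_idem HP lamu Apoly lamu1 Ou HS.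
have Sad := proj_adjoint HP lamu lamu1 Ou HS.
have [_ PS QS] := HS.
have := @torus_frame R m t k S (b *: focal Phi eta la u) (focal Phi eta mu u)
  km tm Sid Sad trS.
rewrite -scalemxAl PS innerZl innerZr !(focal_inner HP)// mulrA -expr2 (expr2 la) in bE *.
rewrite bE => /(_ erefl erefl QS (focal_norm_gt0 mu))[l [A [[lk lt tl iA] h]]].
exists l, A; split=> //; split; last by move=> kM x; have [_ _ ->] := h x.
move=> x; have [h1 h2 _] := h x.
have la1 : 1 + la * la != 0 by rewrite lt0r_neq0// focal_norm_gt0.
rewrite /product_quadric /pseudo_clifford_torus /= h1 h2 inner_isometry//.
have -> : (1 + mu * mu) / (la - mu) ^+ 2 = (1 + la * la)^-1.
  by rewrite muE; field; rewrite la1 la0.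
have -> : (1 + la * la) / (la - mu) ^+ 2 = (1 + la * la - 1) / (1 + la * la).
  by rewrite muE; field; rewrite la1 la0.
split=> [[e1 e2]|[_ e1 e2]]; split=> //.
have o : inner t (x - x *m S) (x *m S) = 0.
  by rewrite innerBl [X in _ - X]Sad -mulmxA Sid subrr.
have -> : inner t x x = inner t (x - x *m S) (x - x *m S) + inner t (x *m S) (x *m S).
  move: o; rewrite !innerBl !innerBr (innerC _ (x *m S) x); lra.
by rewrite h1 h2 e1 e2; field.
Qed.

End TorusModel.

Lemma unitmx_image_setI {R : realType} n (A : 'M[R]_n) (O Q T : set 'rV[R]_n) :
  A \in unitmx -> open O -> (forall x, Q x <-> T (x *m A)) ->
  exists2 O', open O' & (mulmx^~ A) @` (O `&` Q) = O' `&` T.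
Proof.
move=> uA oO QT; exists ((mulmx^~ A) @` O); first exact: open_image_unitmx.
apply/seteqP; split=> [_ [x [Ox /QT Tx] <-]|_ [[x Ox <-] /QT Qx]].
  by split=> //; exists x.
by exists x.
Qed.

Section Congruence.
Context {R : realType} (t m : nat) (M : topologicalType).
Context (phi : M -> 'rV[R]_(true + m.+1)) (x : chart R M m) (p : M).
Context (eta : 'rV[R]_m -> 'rV[R]_(true + m.+1)) (B : set 'rV[R]_m) (la mu : R).
Local Notation Phi := (phi \o chart_inv x).
Hypothesis Hx : is_chart x.
Hypothesis xp : chart_dom x p.
Hypothesis Bp : B (chart_map x p).
Hypothesis Bx : B `<=` chart_img x.
Hypothesis HP : hypersurface_patch t Phi B 1 eta.
Hypothesis lamu : la != mu.
Hypothesis Apoly : forall u, B u ->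
  (la%:M - shape_operator t Phi eta u) *m (mu%:M - shape_operator t Phi eta u) = 0.
Hypothesis lamu1 : 1 + la * mu = 0.
Context (S : 'M[R]_(true + m.+1)).
Hypothesis HS : forall u, B u -> proj_spec Phi eta la mu u S.

(** [T'] may be smaller than the transformed quadric [T]. This serves the small pseudo-hypersphere,
    which the sign of the last coordinate cuts out of its quadric. *)
Lemma patch_congruence (A : 'M[R]_(true + m.+1)) T T' :
  A *m gram t *m A^T = gram t ->
  (forall x, product_quadric t la mu S x <-> T (x *m A)) ->
  T' `<=` T -> (forall u, B u -> T (Phi u *m A) -> T' (Phi u *m A)) ->
  exists U F, [/\ open U, U p, space_form_isometry t F
    & exists2 O, open O & F @` (phi @` U) = O `&` T'].
Proof.
move=> iA QT T'T TT'; exists (chart_dom x `&` chart_map x @^-1` B), (mulmx^~ A).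
split; [exact: (chart_preimage_open Hx (patch_open HP))|by []|exact: linear_isometry|].
have [G oG imE] := local_image HP lamu Apoly lamu1 (patch_open HP) (@subset_refl _ B) HS.
have [W oW WE] := unitmx_image_setI (gram_unit iA) oG QT.
exists W => //; rewrite chart_preimage_image//.
apply/seteqP; split=> [y yB|y [Wy /T'T Ty]]; last by rewrite imE WE.
have : (W `&` T) y by rewrite -WE -imE.
case=> Wy Ty; split=> //; case: yB Ty => _ [u Bu <-] <-; exact: TT'.
Qed.

End Congruence.

(** For these parameters the second equation of the torus only fixes the square of the last
    coordinate as [1 - 1 / r]; the hypersphere takes the nonnegative root. *)
Lemma small_pseudo_hypersphere_torus {R : realType} (t m r : nat) : (t <= m)%N ->
  (0 < r)%N -> small_pseudo_hypersphere (true + m.+1) t r `<=`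
  pseudo_clifford_torus (R := R) (true + m.+1) t m t r%:R.
Proof.
move=> tm r0 y [y1 ylast]; have r0R : 0 < r%:R :> R by rewrite ltr0n.
have r1 : 0 <= 1 - r%:R^-1 :> R by rewrite subr_ge0 invf_le1// ler1n.
have tmE : (t + m - t + 1 = m.+1)%N by lia.
have lastE : y 0 ord_max ^+ 2 = 1 - r%:R^-1 by rewrite ylast// sqr_sqrtr.
have sumE : \sum_(i < m.+2 | (t <= i)%N) y 0 i * y 0 i = y 0 ord_max ^+ 2 +
    \sum_(i < m.+2 | (t <= i < m.+1)%N) y 0 i ^+ 2.
  rewrite (bigD1 ord_max) ?leqW ?leqW//= expr2; congr (_ + _).
  apply: eq_big => [i|i _]; last by rewrite expr2.
  congr (_ && _); rewrite -(inj_eq val_inj)/=; have := ltn_ord i; lia.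
split=> //; rewrite tmE.
  move: y1; rewrite /inner sumE lastE.
  by under eq_bigr do rewrite -expr2; move: (\sum_(_ < _ | _) _) => a; lra.
rewrite big_pred0; last by move=> i; lia.
rewrite oppr0 add0r (big_pred1 ord_max).
  by rewrite lastE mulrBl divff ?gt_eqF// mul1r.
move=> i; apply/idP/eqP => [mi|->//]; apply/val_inj/eqP.
by rewrite eqn_leq mi -ltnS ltn_ord.
Qed.

(** * Umbilic and mixed patches, and the passage to all of [M] *)

Section AmbientSphere.
Context {R : realType} (r m t : nat) (M : topologicalType).
Context (atlas : set (chart R M m)) (phi : M -> 'rV[R]_(true + m.+1)) (la mu : R).
Local Notation Phi x := (phi \o chart_inv x).
Local Notation data := (local_data r t atlas phi la mu).
Hypothesis r3 : (3 <= r)%N.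
Hypothesis tm : (t <= m)%N.
Hypothesis Hman : smooth_manifold atlas.
Hypothesis Hdata : forall p, exists x B eps eta epsi e k, data p x B eps eta epsi e k.
Hypothesis Htrace : forall p x B eps eta epsi e k,
  data p x B eps eta epsi e k -> k%:R * la + (m - k)%:R * mu != 0.

Let N : R := (r - 2)%:R.
Let N0 : 0 < N. Proof. by rewrite ltr0n subn_gt0. Qed.
Let rE : r%:R = N + 2. Proof. by rewrite -natrD subnK// ltnW. Qed.

Lemma data_equation p x B eps eta epsi e k : data p x B eps eta epsi e k ->
  [/\ (k <= m)%N, hypersurface_patch t (Phi x) B 1 eta &
    (k%:R * la ^+ 2 + (m - k)%:R * mu ^+ 2) ^+ 2
    - (k%:R + (m - k)%:R) * (k%:R * la ^+ 2 + (m - k)%:R * mu ^+ 2)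
    - N * (k%:R * la + (m - k)%:R * mu) ^+ 2 = 0].
Proof.
move=> D; have km := data_le D; have [_ eps1 E] := polyharmonic_equation r3 D (Htrace D).
split=> //; first by rewrite -eps1; exact: data_patch D.
by rewrite -natrD subnKC.
Qed.

(** A shape operator equal to [la] or [mu] times the identity would have a different trace, so
    [gauss_equation] applies. *)
Lemma data_mixed p x B eps eta epsi e k : data p x B eps eta epsi e k ->
  (0 < k < m)%N ->
  [/\ la != mu, 1 + la * mu = 0 &
    (k%:R * (la ^+ 2) ^+ 2 + (m - k)%:R) * (la ^+ 2 - 1)
    = N * la ^+ 2 * (k%:R * la ^+ 2 - (m - k)%:R)].
Proof.
move=> D /andP[k0 km]; have [kle HP E] := data_equation D.
have lm : la != mu.
  by apply/negP => /eqP/(data_eq D) km'; move: km; rewrite km' ltnn.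
have Bp := data_center D.
have Apoly u : B u -> (la%:M - shape_operator t (Phi x) eta u) *m
    (mu%:M - shape_operator t (Phi x) eta u) = 0.
  by move=> Bu; have [] := data_shape D Bu.
have [_ trA _ _ _] := data_shape D Bp.
have mE : m%:R = k%:R + (m - k)%:R :> R by rewrite -natrD subnKC.
have dlm : la - mu != 0 by rewrite subr_eq0.
have q : 1 + la * mu = 0.
  apply: (gauss_equation HP lm Apoly Bp).
    apply/negP => /eqP AE; move: trA; rewrite AE mxtrace_scalar -[la *+ m]mulr_natl mE => h.
    have : (m - k)%:R * (la - mu) = 0 by lra.
    by apply/eqP; rewrite mulf_neq0// pnatr_eq0 -lt0n subn_gt0.
  apply/negP => /eqP AE; move: trA; rewrite AE mxtrace_scalar -[mu *+ m]mulr_natl mE => h.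
  have : k%:R * (la - mu) = 0 by lra.
  by apply/eqP; rewrite mulf_neq0// pnatr_eq0 -lt0n.
split=> //; exact: two_curvatures_equation q (Htrace D) E.
Qed.

Lemma data_umbilic p x B eps eta epsi e k : data p x B eps eta epsi e k ->
  ~~ (0 < k < m)%N ->
  exists ka, [/\ ka = la \/ ka = mu, ka ^+ 2 = N + 1 &
    forall u, B u -> shape_operator t (Phi x) eta u = ka%:M].
Proof.
move=> D; rewrite negb_and -!leqNgt leqn0 => k0m.
have [km HP E] := data_equation D; have T0 := Htrace D.
have m0 : (0 < m)%N.
  rewrite lt0n; apply: contraNneq T0 => m0; move: km; rewrite m0 leqn0 => /eqP->.
  by rewrite subnn !mul0r addr0.
have m0R : 0 < m%:R :> R by rewrite ltr0n.
have [k0|kM] : k = 0%N \/ k = m.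
  by case/orP: k0m => [/eqP|mk]; [left|right; apply/eqP; rewrite eqn_leq km].
- exists mu; split; first by right.
    move: T0 E; rewrite k0 subn0 !mul0r !add0r mulf_eq0 negb_or => /andP[_ mu0].
    exact: umbilic_equation.
  by move=> u /(data_shape D)[_ _ _ _]; apply.
- exists la; split; first by left.
    move: T0 E; rewrite kM subnn !mul0r !addr0 mulf_eq0 negb_or => /andP[_ la0].
    exact: umbilic_equation.
  by move=> u /(data_shape D)[_ _ _ + _]; apply.
Qed.

Lemma mixed_everywhere p x B eps eta epsi e k q x' B' eps' eta' epsi' e' k' :
  data p x B eps eta epsi e k -> (0 < k < m)%N ->
  data q x' B' eps' eta' epsi' e' k' -> k' = k.
Proof.
move=> D km D'; have [_ l1 E] := data_mixed D km; have [la0 _] := gauss_curvatures l1.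
have [k0 km'] := andP km; have kle := ltnW km'.
have K0 : 0 < k%:R :> R by rewrite ltr0n.
have L0 : 0 < (m - k)%:R :> R by rewrite ltr0n subn_gt0.
have [h1 h2] := two_curvatures_not_umbilic K0 L0 N0 l1 E.
have [km2|] := boolP (0 < k' < m)%N; last first.
  by move=> /(data_umbilic D')[ka [[->|->] h _]].
have [_ _ E'] := data_mixed D' km2; have [_ /ltnW km3] := andP km2.
apply/eqP; rewrite -(eqr_nat R); apply/eqP.
apply: (two_curvatures_multiplicity N0 la0 _ _ E' E).
  by rewrite -natrD subnKC// ltr0n (ltn_trans k0).
by rewrite -!natrD !subnKC.
Qed.

Lemma umbilic_congruent :
  (forall p x B eps eta epsi e k, data p x B eps eta epsi e k -> ~~ (0 < k < m)%N) ->
  locally_congruent t phi (small_pseudo_hypersphere (true + m.+1) t r).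
Proof.
move=> umb p; have [x [B [eps [eta [epsi [e [k D]]]]]]] := Hdata p.
have [ka [_ ka2 Aka]] := data_umbilic D (umb _ _ _ _ _ _ _ _ D).
have [_ HP _] := data_equation D; have Bp := data_center D.
have ka0 : ka != 0.
  by apply: contraTneq N0 => k0; move: ka2; rewrite k0 expr0n /= -leNgt; lra.
pose nu := - ka^-1; have kn1 : 1 + ka * nu = 0 by rewrite mulrN divff// subrr.
have kn : ka != nu.
  by apply/eqP => kE; move: kn1 N0; rewrite -kE -expr2 ka2; lra.
have Apoly u : B u -> (ka%:M - shape_operator t (Phi x) eta u) *m
    (nu%:M - shape_operator t (Phi x) eta u) = 0.
  by move=> Bu; rewrite (Aka u Bu) subrr mul0mx.
have [rho rho0 BE] := data_ball D.
have He := data_frame D.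
have HS := proj_constant HP kn Apoly kn1 rho0 BE He.
have trS := trace_proj ka nu HP He Bp.
rewrite (Aka _ Bp) mxtrace_scalar mulr_natl subrr mul0r add0r in trS.
set S := focal_proj _ _ _ _ _ _ _ _ in HS trS.
(* [b] has the sign of [ka]: the product of [Phi] with the normalised focal vector is [b * ka], the
   nonnegative last coordinate prescribed by the model. *)
pose b := Num.sqrt (1 - r%:R^-1) / ka.
have r0 : 0 < r%:R :> R by rewrite ltr0n (leq_trans _ r3).
have r1 : 0 <= 1 - r%:R^-1 :> R by rewrite subr_ge0 invf_le1// ler1n (leq_trans _ r3).
have kr : 1 + ka ^+ 2 = r%:R by rewrite ka2 rE; lra.
have bE : b ^+ 2 * (1 + ka ^+ 2) = 1.
  rewrite /b expr_div_n sqr_sqrtr// ka2 rE; field.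
  by rewrite !lt0r_neq0// addr_gt0.
have trS' : \tr S = (m - m + 1)%:R by rewrite subnn.
have [l [A [[lm lt tl iA] [QT last]]]] := torus_coordinates HP kn Apoly kn1
  (leqnn m) (leq_trans tm (leqW (leqnSn m))) Bp (HS _ Bp) trS' bE.
have lE : l = t by apply/eqP; rewrite eqn_leq lt -subn_eq0 -leqn0 -(subnn m).
rewrite lE kr in QT.
apply: (patch_congruence (atlas_chart Hman (data_atlas D)) (data_dom D) Bp (data_sub D)
  HP kn Apoly kn1 HS iA QT).
- apply: small_pseudo_hypersphere_torus tm _; rewrite ltn_neqAle eq_sym; lia.
- move=> u Bu [y1 _ _]; split=> // i iE.
  have -> : i = ord_max by apply/val_inj.
  have dF y : B y -> differentiable (focal (Phi x) eta ka) y.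
    apply: smooth_differentiable.
    exact: (smooth_lincomb ka (patch_open HP) (patch_smooth_normal HP) (patch_smooth HP)).
  (* The whole tangent space is the eigenspace of [ka], so this focal map is constant on the ball;
     it is the axis of the hypersphere. *)
  have FE : focal (Phi x) eta ka u = focal (Phi x) eta ka (chart_map x p).
    apply: (dder_constant (r := rho)); rewrite -BE; [exact: dF| |exact: Bu].
    move=> y By z; rewrite (dfocal HP ka z By) (Aka y By) subrr mulmx0.
    by rewrite dder_dir0//; exact: smooth_differentiable (patch_smooth HP) By.
  rewrite last// -FE /focal innerZr innerDr innerZr (position_normal HP Bu)//.
  by rewrite (patch_sphere HP Bu)// add0r mulr1 divfK.
Qed.

(** Quantifying over chart, neighbourhood and normal allows projections of different patches to be
    compared at a common point; the polynomial identity restricts the sign of the normal. *)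
Definition focal_rel p (S : 'M[R]_(true + m.+1)) : Prop :=
  exists x U eta, [/\ atlas x, chart_dom x p, U (chart_map x p), U `<=` chart_img x &
  [/\ hypersurface_patch t (Phi x) U 1 eta,
      forall u, U u -> (la%:M - shape_operator t (Phi x) eta u) *m
        (mu%:M - shape_operator t (Phi x) eta u) = 0
    & proj_spec (Phi x) eta la mu (chart_map x p) S]].

Section Mixed.
Hypothesis lamu : la != mu.
Hypothesis lamu1 : 1 + la * mu = 0.
Hypothesis la1 : la ^+ 2 != 1.
Hypothesis m0 : (0 < m)%N.

(** Subtracting the identities leaves [2 (la + mu) A = 0], and [la + mu] is nonzero because
    [la ^+ 2 != 1]. So [A = 0] and [la * mu = 0], against [1 + la * mu = 0]. This forbids reversing
    the normal. *)
Lemma shape_sign (A : 'M[R]_m) : (la%:M - A) *m (mu%:M - A) = 0 ->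
  (la%:M + A) *m (mu%:M + A) = 0 -> False.
Proof.
move=> h1 h2; have [la0 muE] := gauss_curvatures lamu1.
have lm0 : la + mu != 0.
  rewrite muE; apply: contraNneq la1 => E.
  have : la * (la - la^-1) = 0 by rewrite E mulr0.
  by rewrite mulrBr divff// -expr2 => /eqP; rewrite subr_eq0.
have dif : (la + mu) *: A = 0.
  have two : (2 : R) != 0 by rewrite pnatr_eq0.
  apply: (scalerI two); rewrite scaler0.
  transitivity ((la%:M + A) *m (mu%:M + A) - (la%:M - A) *m (mu%:M - A)); last first.
    by rewrite h1 h2 subrr.
  rewrite !mulmxDl !mulmxDr !mulNmx !mulmxN !mul_scalar_mx !mul_mx_scalar opprK.
  by apply/matrixP => i j; rewrite !mxE; ring.
have A0 : A = 0 by apply/eqP; move/eqP: dif; rewrite scaler_eq0 (negbTE lm0).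
move: h1; rewrite A0 !subr0 -scalar_mxM => /matrixP/(_ (Ordinal m0) (Ordinal m0)).
rewrite !mxE eqxx mulr1n => lm; move: lamu1; rewrite lm addr0.
by apply/eqP; rewrite oner_eq0.
Qed.

(** By [shape_sign] two admissible normals agree at [p]; hence so do the focal maps, and their
    differentials up to the change of coordinates [C]. *)
Lemma focal_rel_unique p S S' : focal_rel p S -> focal_rel p S' -> S = S'.
Proof.
move=> [x [U [eta [ax xp Uu Ux [HP Apoly HS]]]]].
move=> [y [V [zeta [ay yp Vw Vy [HP' Apoly' [HS1 HS2 HS3]]]]]].
apply: (proj_spec_unique HP lamu lamu1 Uu HS).
have [C [s [uC s1 _ ez E]]] :=
  chart_comparison Hman ax ay xp yp HP HP' Vy Uu Vw.
have sE : s = 1.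
  have AE := shape_comparison HP HP' Uu Vw uC E.
  case: s1 => // sN; have h1 := Apoly _ Uu; have := Apoly' _ Vw.
  rewrite AE sN scaleN1r; move: (shape_operator _ _ _ _) h1 => A h1 h2.
  case: (@shape_sign A) => //.
  have conj a : a%:M - - (C *m A *m invmx C) = C *m (a%:M + A) *m invmx C.
    by rewrite opprK mulmxDr mulmxDl mul_mx_scalar -scalemxAl mulmxV// scalemx1.
  move: h2; rewrite !conj -!mulmxA => /(congr1 (mulmx (invmx C))).
  rewrite mulKmx// mulmx0 => /(congr1 (mulmxr C)) /=.
  by rewrite -!mulmxA mulVmx// mulmx1 mulKmx// mul0mx.
rewrite sE in E ez.
have PhiE' : Phi y (chart_map y p) = Phi x (chart_map x p).
  by rewrite /= (chart_invK (atlas_chart Hman ay) yp) (chart_invK (atlas_chart Hman ax) xp).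
have FE a : focal (Phi y) zeta a (chart_map y p) = focal (Phi x) eta a (chart_map x p).
  by rewrite /focal ez scale1r PhiE'.
split; last 2 first.
- by rewrite -FE.
- by rewrite -FE.
move=> v; have [e1 e2] := E (v *m invmx C).
rewrite mulmxKV// in e1 e2.
have dFE : dder (v *m invmx C) (focal (Phi y) zeta la) (chart_map y p) =
           dder v (focal (Phi x) eta la) (chart_map x p).
  rewrite (dder_lincomb la _ (patch_smooth_normal HP') (patch_smooth HP') Vw).
  rewrite (dder_lincomb la _ (patch_smooth_normal HP) (patch_smooth HP) Uu).
  by rewrite e1 e2 scale1r.
by rewrite -dFE -e1; exact: HS1.
Qed.

Lemma data_focal p x B eps eta epsi e k : data p x B eps eta epsi e k ->
  exists S, [/\ \tr S = (m - k + 1)%:R,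
    forall u, B u -> proj_spec (Phi x) eta la mu u S &
    forall q, (chart_dom x `&` chart_map x @^-1` B) q -> focal_rel q S].
Proof.
move=> D; have [km HP _] := data_equation D; have Bp := data_center D.
have Apoly u : B u -> (la%:M - shape_operator t (Phi x) eta u) *m
    (mu%:M - shape_operator t (Phi x) eta u) = 0.
  by move=> Bu; have [] := data_shape D Bu.
have [rho rho0 BE] := data_ball D; have He := data_frame D.
have HS := proj_constant HP lamu Apoly lamu1 rho0 BE He.
have [_ trA _ _ _] := data_shape D Bp.
have := trace_proj la mu HP He Bp; rewrite trA => trS.
exists (focal_proj t (Phi x) eta la mu epsi e (chart_map x p)).
split; [|exact: HS|].
  rewrite trS natrD natrB//; congr (_ + _).
  by field; rewrite subr_eq0.
move=> q [xq Bq]; exists x, B, eta; split=> //.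
- exact: data_atlas D.
- exact: data_sub D.
- by split=> //; exact: HS.
Qed.

Hypothesis cM : connected [set: M].

Lemma mixed_congruent (p0 : M) k : (k <= m)%N ->
  (forall p x B eps eta epsi e k', data p x B eps eta epsi e k' -> k' = k) ->
  exists l, [/\ (l <= k)%N, (l <= t)%N, (t - l <= m - k)%N &
    locally_congruent t phi (pseudo_clifford_torus (true + m.+1) t k l (1 + la ^+ 2))].
Proof.
move=> km kE.
have [x0 [B0 [eps0 [eta0 [epsi0 [e0 [k0 D0]]]]]]] := Hdata p0.
have [S [trS HS0 relS]] := data_focal D0.
have all_rel : forall p, focal_rel p S.
  apply: (connected_propagation cM _ (relS p0 (conj (data_dom D0) (data_center D0)))).
  move=> p; have [x [B [eps [eta [epsi [e [k1 D]]]]]]] := Hdata p.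
  have [S' [_ _ relS']] := data_focal D.
  have pU : (chart_dom x `&` chart_map x @^-1` B) p.
    by split; [exact: data_dom D|exact: data_center D].
  exists (chart_dom x `&` chart_map x @^-1` B); split; [exact: (data_open Hman D)|exact: pU|].
  move=> q qU; split=> rS.
    by rewrite (focal_rel_unique rS (relS' q qU)); exact: relS'.
  by rewrite (focal_rel_unique rS (relS' p pU)); exact: relS'.
have [_ HP0 _] := data_equation D0; have B0p := data_center D0.
have poly p x B eps eta epsi e k' (D : data p x B eps eta epsi e k') u : B u ->
    (la%:M - shape_operator t (Phi x) eta u) *m
    (mu%:M - shape_operator t (Phi x) eta u) = 0.
  by move=> Bu; have [] := data_shape D Bu.
have l2 : 0 < 1 + la ^+ 2 by rewrite expr2 focal_norm_gt0.
have bE : (Num.sqrt (1 + la ^+ 2))^-1 ^+ 2 * (1 + la ^+ 2) = 1.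
  by rewrite exprVn sqr_sqrtr ?ltW// mulVf ?gt_eqF.
rewrite (kE _ _ _ _ _ _ _ _ D0) in trS.
(* The isometry is built once, at the centre of the first patch, and serves every point of [M]; thus
   [l] is chosen before [p]. *)
have [l [A [[lk lt tl iA] [QT _]]]] := torus_coordinates HP0 lamu
  (poly _ _ _ _ _ _ _ _ D0) lamu1 km (leq_trans tm (leqW (leqnSn m))) B0p
  (HS0 _ B0p) trS bE.
exists l; split=> // p.
have [x [B [eps [eta [epsi [e [k1 D]]]]]]] := Hdata p.
have [S' [_ HS' relS']] := data_focal D.
have pU : (chart_dom x `&` chart_map x @^-1` B) p.
  by split; [exact: data_dom D|exact: data_center D].
rewrite -(focal_rel_unique (all_rel p) (relS' p pU)) in HS'.
have [_ HP _] := data_equation D.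
by apply: (patch_congruence (atlas_chart Hman (data_atlas D)) (data_dom D)
  (data_center D) (data_sub D) HP lamu (poly _ _ _ _ _ _ _ _ D) lamu1 HS' iA QT).
Qed.

End Mixed.
End AmbientSphere.

Theorem theorem3p13 (R : realType) (r m t t' : nat) (c0 : bool)
    (M : topologicalType) (atlas : set (chart R M m))
    (phi : M -> 'rV[R]_(c0 + m.+1)) :
  (3 <= r)%N -> (2 <= m)%N -> (1 <= t <= m)%N ->
  smooth_manifold atlas -> connected [set: M] ->
  pseudo_hypersurface t atlas phi t' ->
  diagonalizable_shape_operator t atlas phi ->
  at_most_two_constant_principal_curvatures t atlas phi ->
  proper_polyharmonic t atlas phi r ->
  c0 = true /\
  (locally_congruent t phi (small_pseudo_hypersphere (c0 + m.+1) t r) \/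
   exists (k l : nat) (c : R),
     [/\ (1 <= k <= m - 1)%N, (l <= k)%N, (l <= t)%N & (t - l <= m - k)%N] /\
     [/\ 1 < c, c != m%:R / k%:R,
         k%:R * c ^+ 3 - k%:R * (r%:R + 2) * c ^+ 2
         + (m%:R * (r%:R - 1) + k%:R * (r%:R + 2)) * c - m%:R * r%:R = 0
       & locally_congruent t phi
           (pseudo_clifford_torus (c0 + m.+1) t k l c)]).
Proof.
move=> r3 m2 /andP[t1 tm] Hman cM Hhyp Hdiag [la [mu H2]] [Hpoly nmin].
have Hdata := local_data_exists Hman Hhyp Hdiag H2 Hpoly.
have Htrace := nowhere_minimal Hman Hhyp Hdiag H2 Hpoly cM nmin.
(* An empty [M] would be minimal. *)
have [p0] : exists p : M, True.
  apply: contrapT => noM; apply: nmin => x _ O eps eta _ Ox _ u Ou.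
  by exfalso; apply: noM; have [p] := Ox _ Ou; exists p.
move=> _; have c0T : c0.
  have [x [B [eps [eta [epsi [e [k D]]]]]]] := Hdata p0.
  by have [] := polyharmonic_equation r3 D (Htrace _ _ _ _ _ _ _ _ D).
split; first exact: c0T.
move: Hdata Htrace; case: c0 c0T phi {Hhyp Hdiag H2 Hpoly nmin} => // _ phi Hdata Htrace.
have [x0 [B0 [eps0 [eta0 [epsi0 [e0 [k D0]]]]]]] := Hdata p0.
have [km|kum] := boolP (0 < k < m)%N; [right|left]; last first.
  apply: (umbilic_congruent r3 tm Hman Hdata Htrace) => p x B eps eta epsi e k' D.
  apply: contra kum => km'.
  by rewrite (mixed_everywhere r3 Htrace D km' D0).
have [lamu lamu1 E] := data_mixed r3 Htrace D0 km.
have [k0 /ltnW kle] := andP km.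
have mE : m%:R = k%:R + (m - k)%:R :> R by rewrite -natrD subnKC.
have N0 : 0 < (r - 2)%:R :> R by rewrite ltr0n subn_gt0.
have rE : r%:R = (r - 2)%:R + 2 :> R by rewrite -natrD subnK// ltnW.
have [la0 muE] := gauss_curvatures lamu1.
have l2 : 0 < la ^+ 2 by rewrite exprn_even_gt0.
(* This is [la] times the trace of the shape operator. *)
have T0 : k%:R * la ^+ 2 - (m - k)%:R != 0.
  have := Htrace _ _ _ _ _ _ _ _ D0; rewrite muE; apply: contraNneq => T0.
  by apply/eqP; apply: (mulfI la0); rewrite mulr0 -[RHS]T0; field.
(* At [la ^+ 2 = 1] the left-hand side of [E] is zero, so [k = m - k] and the trace would vanish. *)
have la1 : la ^+ 2 != 1.
  apply: contraNneq T0 => l1; move/esym/eqP: E; rewrite l1 subrr mulr0.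
  by rewrite mulf_eq0 mulr1 gt_eqF// => /eqP.
have kE p x B eps eta epsi e k' : local_data r t atlas phi la mu p x B eps eta epsi e k' -> k' = k.
  exact: mixed_everywhere D0 km.
have [l [lk lt tl cong]] := mixed_congruent r3 tm Hman Hdata Htrace lamu lamu1 la1
  (ltnW m2) cM p0 kle kE.
exists k, l, (1 + la ^+ 2); split; split=> //.
- by rewrite k0 leq_subRL ?(ltnW m2)// add1n; case/andP: km.
- by rewrite ltrDl.
(* [c = m / k] means [k (1 + la ^+ 2) = m], which is again the vanishing of the trace. *)
- apply: contraNneq T0 => cE; have k0R : k%:R != 0 :> R by rewrite pnatr_eq0 -lt0n.
  have : (1 + la ^+ 2) * k%:R = m%:R by rewrite cE divfK.
  rewrite mE; lra.
- by rewrite mE rE; have := two_curvatures_cubic E; rewrite -!addrA.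
Qed.
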